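(* Let $\delta\in(0,1)$, $\epsilon\in(0,1)$, $u_k=\frac{1+\bar h}{2^k(1-\gamma)}$, $k_0=\lceil\log_2\frac{1+\bar h}{1-\gamma}\rceil$, and let $D_0$ be a constant with $\|D^{\pi}_{\hat\pi_0}\|_\infty\le D_0$ for every policy $\pi$. Run the SVMD algorithm (described in the context) with $$K=\left\lceil\log_2\left(\tfrac{1+\bar h}{(1-\gamma)\epsilon}\right)\right\rceil,\quad T_k=\left\lceil\tfrac{28}{(1-\gamma)\min\{u_k,1\}}\right\rceil,\quad \eta_{k,t}=\tfrac{2^{\min\{k,k_0\}}D_0}{7\max\{u_k,1\}}\ \ (t=0,\dots,T_k-1),$$ $$m_{k,1}\ge\tfrac{[250\sqrt2(1+\bar h)]^2\ln(12K|\mathbb S||\mathbb A|\delta^{-1})\lceil\log_2(\epsilon^{-1})\rceil^2}{(1-\gamma)^3\min\{u_k,1\}^2},\qquad m_{k,2}\ge\tfrac{(100\sqrt2)^2\ln[4K(T_k-1)|\mathbb S||\mathbb A|\delta^{-1}]\lceil\log_2(\epsilon^{-1})\rceil^2}{(1-\gamma)^2}$$ for $k=0,\dots,K-1$. Then with probability at least $1-\delta$, the output $\hat\pi_K$ is $\epsilon$-optimal, i.e. $\|V^{\hat\pi_K}-V^*\|_\infty\le\epsilon$, and $$\|D^{\pi^*}_{\hat\pi_K}\|_\infty\le\frac{4(1+\bar h)D_0}{(1-\gamma)^2}.$$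
   Context: MDP. $(\mathbb S,\mathbb A,\mathbb P,c,\gamma)$ is a discounted Markov decision process with finite $\mathbb S,\mathbb A$, transition kernel $\mathbb P(s'|s,a)$, cost $c(s,a)\in[0,1]$, $\gamma\in(0,1)$. For any kernel $Q$ on $\mathbb S\times\mathbb A$ and $V\in\mathbb R^{|\mathbb S|}$: $Q_{s,a}=Q(\cdot|s,a)$, $(QV)_{s,a}=Q_{s,a}^\top V$, and $Q_sV\in\mathbb R^{|\mathbb A|}$ is the row of $QV$ at $s$. $\Delta_{\mathbb A}$ is the probability simplex over $\mathbb A$; a policy $\pi$ assigns $\pi(\cdot|s)\in\Delta_{\mathbb A}$ to each $s$; $Q_\pi(s,s')=\sum_a\pi(a|s)Q(s'|s,a)$, $c_\pi(s)=\sum_a\pi(a|s)c(s,a)$. $h:\Delta_{\mathbb A}\to[0,\bar h]$ is a continuous convex regularizer, $(h(\pi))(s)=h(\pi(\cdot|s))$. $V^\pi(s)=\mathbb E[\sum_{t\ge0}\gamma^t(c(s_t,a_t)+h(\pi(\cdot|s_t)))\mid s_0=s,\ a_t\sim\pi(\cdot|s_t),\ s_{t+1}\sim\mathbb P(\cdot|s_t,a_t)]$. $\pi^*$ is an optimal policy ($V^{\pi^*}\le V^\pi$ componentwise for all $\pi$), $V^*=V^{\pi^*}$. Bregman divergence. $\omega:\Delta_{\mathbb A}\to\mathbb R$ is continuously differentiable and $1$-strongly convex with respect to a norm; $D(x_1,x_2)=\omega(x_2)-\omega(x_1)-\langle\nabla\omega(x_1),x_2-x_1\rangle$; $D^{\pi}_{\pi'}\in\mathbb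 R^{|\mathbb S|}$ has entries $D^{\pi}_{\pi'}(s)=D(\pi'(\cdot|s),\pi(\cdot|s))$. Sampling. $\hat{\mathbb P}^{(m)}$ is the empirical kernel: for each $(s,a)$, $m$ independent samples $s_1,\dots,s_m\sim\mathbb P(\cdot|s,a)$ are drawn from a generative model and $\hat{\mathbb P}^{(m)}_{s,a}(s')=\frac1m\sum_{i}\mathbb I\{s_i=s'\}$. Samples are independent across $(s,a)$, and fresh samples are used each time an estimator is formed. SVMD algorithm. Input: positive integers $K$, $T_k$, $m_{k,1}$, $m_{k,2}$, positive stepsizes $\eta_{k,t}$; $\hat\pi_0(\cdot|s)=\hat\pi_0'(\cdot|s)$ uniform on $\mathbb A$ for all $s$; $\hat V_0=\frac{1+\bar h}{1-\gamma}\mathbf 1_{\mathbb S}$. For each epoch $k=0,\dots,K-1$: set $\pi_0=\hat\pi_k$, $\tilde\pi_0=\hat\pi_k'$, $\eta_t=\eta_{k,t}$, and draw $\tilde{\mathbb P}^0=\hat{\mathbb P}^{(m_{k,1})}$. If $k=0$ set $V_0=\hat V_0$; otherwise $V_0=(I-\gamma\tilde{\mathbb P}^0_{\pi_0})^{-1}(c_{\pi_0}+h(\pi_0))$. For $t=0,\dots,T_k-1$: if $t>0$, draw a fresh $\hat{\mathbb P}^{(m_{k,2})}$ and set $(\tilde{\mathbb P}^tV_t)_{s,a}=(\tilde{\mathbb P}^0V_0)_{s,a}+(\hat{\mathbb P}^{(m_{k,2})}_{s,a})^\top(V_t-V_0)$; then for all $s$, $$\tilde\pi_{t+1}(\cdot|s)=\arg\min_{\pi(\cdot|s)\in\Delta_{\mathbb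 A}}\{\eta_t[\langle c(s,\cdot)+\gamma\tilde{\mathbb P}^t_sV_t,\pi(\cdot|s)\rangle+h(\pi(\cdot|s))]+D^{\pi}_{\tilde\pi_t}(s)\},$$ $$V_{t+1}(s)=\min\{\tilde V_{t+1}(s),V_t(s)\},\quad \tilde V_{t+1}(s):=\langle c(s,\cdot)+\gamma\tilde{\mathbb P}^t_sV_t,\tilde\pi_{t+1}(\cdot|s)\rangle+h(\tilde\pi_{t+1}(\cdot|s)),$$ and $\pi_{t+1}(\cdot|s)=\tilde\pi_{t+1}(\cdot|s)$ if $V_{t+1}(s)=\tilde V_{t+1}(s)$, $\pi_{t+1}(\cdot|s)=\pi_t(\cdot|s)$ otherwise. At the end of the epoch set $\hat\pi_{k+1}=\pi_{T_k}$, $\hat\pi'_{k+1}=\tilde\pi_{T_k}$. Output $\hat\pi_K$. *)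

(* Defs.v *)
From HB Require Import structures.
From mathcomp Require Import all_boot all_order all_algebra.
From mathcomp Require Import all_classical all_reals all_analysis.

Set Implicit Arguments.
Unset Strict Implicit.
Unset Printing Implicit Defensive.

Import Order.TTheory GRing.Theory Num.Theory.
Import numFieldNormedType.Exports.

Local Open Scope classical_set_scope.
Local Open Scope ring_scope.

Section Simplex.
Context {R : realType} {T : finType}.
Implicit Types (x y : T -> R).

Definition dotp x y : R := \sum_a x a * y a.

Definition supnorm x : R := \big[Num.max/0]_a `|x a|.

Definition simplex : set (T -> R) :=
  [set x | (forall a, 0 <= x a) /\ \sum_a x a = 1].

Definition is_norm (N : (T -> R) -> R) : Prop :=
  [/\ forall x, N x = 0 -> x = 0,
      forall (r : R) x, N (r *: x) = `|r| * N x
    & forall x y, N (x + y) <= N x + N y].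

(* The functions below are only meaningful on the simplex, which has empty
   interior in R^T; continuity and differentiability are relative to it.
   [{ptws T -> R}] is [T -> R] with its (finite) product topology. *)
Definition continuous_on_simplex (f : (T -> R) -> R) : Prop :=
  {within (simplex : set {ptws T -> R}),
    continuous (f : {ptws T -> R} -> R)}.

(* [g] is a continuous gradient of [w] on the simplex: the first-order
   expansion of [w] at each point holds along the simplex.  This fixes
   [dotp (g x) (y - x)] for all [x], [y] in the simplex, although [g x] itself
   is only determined up to an additive constant vector. *)
Definition is_C1_gradient (w : (T -> R) -> R) (g : (T -> R) -> (T -> R)) :
    Prop :=
  (forall a, continuous_on_simplex (fun x => g x a)) /\
  (forall x, simplex x -> forall e : R, 0 < e ->
    \forall y \near within (simplex : set {ptws T -> R})
                           (nbhs (x : {ptws T -> R})),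
      `|w y - w x - dotp (g x) (y - x)| <= e * \sum_a `|y a - x a|).

Definition strongly_convex1 (N : (T -> R) -> R) (w : (T -> R) -> R) : Prop :=
  forall x y (r : R), simplex x -> simplex y -> 0 <= r <= 1 ->
    w (r *: x + (1 - r) *: y)
      <= r * w x + (1 - r) * w y - r * (1 - r) / 2 * N (x - y) ^+ 2.

Definition bregman (w : (T -> R) -> R) (g : (T -> R) -> (T -> R)) x1 x2 : R :=
  w x2 - w x1 - dotp (g x1) (x2 - x1).

(* The default value [0] is used only if there is no minimizer. *)
Definition argmin_simplex (F : (T -> R) -> R) : T -> R :=
  xget (fun=> 0) [set x | simplex x /\ forall y, simplex y -> F x <= F y].

End Simplex.

Section MDP.
Context {R : realType} {S A : finType}.

Definition kernel_type := S -> A -> S -> R.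
Definition policy_type := S -> A -> R.

Implicit Types (Q P : kernel_type) (pi : policy_type) (V : S -> R).

Definition is_kernel Q : Prop := forall s a, simplex (Q s a).
Definition is_policy pi : Prop := forall s, simplex (pi s).

Definition kernel_app Q V (s : S) (a : A) : R := dotp (Q s a) V.

Definition policy_kernel Q pi (s s' : S) : R := \sum_a pi s a * Q s a s'.

Definition policy_cost (c : S -> A -> R) pi (s : S) : R := dotp (pi s) (c s).

Definition bregman_policy w g pi' pi (s : S) : R :=
  bregman w g (pi' s) (pi s).

Definition uniform_policy : policy_type := fun _ _ => #|A|%:R^-1.

(* Under [Pr], the process (st, act) is the trajectory of the MDP with kernel
   [P], started at [s0] and following [pi]: s_0 = s0, a_t ~ pi(.|s_t) and
   s_{t+1} ~ P(.|s_t, a_t), given by its finite-dimensional laws. *)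
Definition is_trajectory P pi (s0 : S) d (W : measurableType d)
    (Pr : probability W R) (st : nat -> W -> S) (act : nat -> W -> A) : Prop :=
  forall (n : nat) (x : nat -> S) (b : nat -> A),
    Pr [set w | forall t, (t <= n)%N -> st t w = x t /\ act t w = b t] =
    ((x 0%N == s0)%:R * pi (x 0%N) (b 0%N) *
      \prod_(t < n) (P (x t) (b t) (x t.+1) * pi (x t.+1) (b t.+1)))%:E.

Definition is_trajectory_model P d (W : measurableType d)
    (Ptraj : policy_type -> S -> probability W R)
    (st : nat -> W -> S) (act : nat -> W -> A) : Prop :=
  [/\ forall t s, measurable (st t @^-1` [set s]),
      forall t a, measurable (act t @^-1` [set a])
    & forall pi s0, is_policy pi -> is_trajectory P pi s0 (Ptraj pi s0) st act].

Definition discounted_cost (c : S -> A -> R) (gamma : R) (h : (A -> R) -> R)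
    pi (st : nat -> S) (act : nat -> A) : R :=
  limn (series (fun t => gamma ^+ t * (c (st t) (act t) + h (pi (st t))))).

Definition value c gamma h d (W : measurableType d)
    (Ptraj : policy_type -> S -> probability W R)
    (st : nat -> W -> S) (act : nat -> W -> A) pi (s : S) : R :=
  fine 'E_(Ptraj pi s)[fun w =>
    discounted_cost c gamma h pi (fun t => st t w) (fun t => act t w)].

Definition is_optimal (Vf : policy_type -> S -> R) pi : Prop :=
  is_policy pi /\ forall pi', is_policy pi' -> forall s, Vf pi s <= Vf pi' s.

(* (I - gamma Q_pi)^-1 (c_pi + h(pi)), through the enumeration of S. *)
Definition policy_eval (c : S -> A -> R) (gamma : R) (h : (A -> R) -> R) Q pi
    (s : S) : R :=
  let M : 'M[R]_#|S| :=
    \matrix_(i, j) policy_kernel Q pi (enum_val i) (enum_val j) in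
  let r : 'cV[R]_#|S| :=
    \col_i (policy_cost c pi (enum_val i) + h (pi (enum_val i))) in
  (invmx (1%:M - gamma *: M) *m r) (enum_rank s) 0.

End MDP.

Arguments kernel_type : clear implicits.
Arguments policy_type : clear implicits.

Section Sampling.
Context {R : realType} {S A : finType}.

Definition empirical_kernel (m : nat) (y : S -> A -> nat -> S) :
    kernel_type R S A :=
  fun s a s' => (\sum_(i < m) (y s a i == s')%:R) / m%:R.

(* (k, t, s, a, i): i-th next-state sample drawn at (s, a) in epoch k for the
   estimator formed at inner iteration t. *)
Definition sample_index := (nat * nat * S * A * nat)%type.

Definition samples_at (y : sample_index -> S) (k t : nat) : S -> A -> nat -> S :=
  fun s a i => y (k, t, s, a, i).

Definition used_index (K : nat) (T m1 m2 : nat -> nat) : pred sample_index :=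
  fun j => let: (k, t, _, _, i) := j in
    [&& (k < K)%N, (t < T k)%N & (i < if t == 0%N then m1 k else m2 k)%N].

Definition mutually_independent (I : eqType) (U : pred I) d
    (W : measurableType d) (Pr : probability W R) (X : I -> W -> S) : Prop :=
  forall (J : seq I) (B : I -> set S), uniq J -> all U J ->
    Pr [set w | forall j, j \in J -> B j (X j w)] =
    (\prod_(j <- J) Pr (X j @^-1` B j))%E.

Definition is_generative_sample (U : pred sample_index)
    (P : kernel_type R S A) d (W : measurableType d) (Pr : probability W R)
    (X : sample_index -> W -> S) : Prop :=
  [/\ forall j s', U j -> measurable (X j @^-1` [set s']),
      forall k t s a i s', U (k, t, s, a, i) ->
        Pr (X (k, t, s, a, i) @^-1` [set s']) = (P s a s')%:E
    & mutually_independent U Pr X].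

End Sampling.

Arguments sample_index : clear implicits.

Section SVMD.
Context {R : realType} {S A : finType}.
Variables (c : S -> A -> R) (gamma hbar : R) (h : (A -> R) -> R).
Variables (w : (A -> R) -> R) (g : (A -> R) -> (A -> R)).

(* The state (V_t, pi_t, tilde pi_t) of the inner loop. *)
Record iterate := Iterate {
  it_V : S -> R ;
  it_pi : policy_type R S A ;
  it_tpi : policy_type R S A }.

(* [PV] is the current estimate (tilde P^t V_t)_{s,a}. *)
Definition svmd_step (eta : R) (PV : S -> A -> R) (it : iterate) : iterate :=
  let q s a := c s a + gamma * PV s a in
  let tpi s := argmin_simplex (fun x =>
    eta * (dotp (q s) x + h x) + bregman w g (it_tpi it s) x) in
  let tV s := dotp (q s) (tpi s) + h (tpi s) in
  let V s := Num.min (tV s) (it_V it s) in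
  Iterate V (fun s => if V s == tV s then tpi s else it_pi it s) tpi.

(* [P0] is tilde P^0 and [Ph t], for t > 0, is the fresh kernel of step t. *)
Fixpoint svmd_inner (eta : nat -> R) (P0 : kernel_type R S A)
    (Ph : nat -> kernel_type R S A) (it0 : iterate) (t : nat) : iterate :=
  if t is t'.+1 then
    let it := svmd_inner eta P0 Ph it0 t' in
    let PV s a :=
      if t' == 0%N then kernel_app P0 (it_V it0) s a
      else kernel_app P0 (it_V it0) s a
           + kernel_app (Ph t') (it_V it - it_V it0) s a in
    svmd_step (eta t') PV it
  else it0.

Variables (T m1 m2 : nat -> nat) (eta : nat -> nat -> R).
Variable y : sample_index S A -> S.

(* The pair (hat pi_k, hat pi'_k). *)
Fixpoint svmd_epochs (k : nat) : policy_type R S A * policy_type R S A :=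
  if k is k'.+1 then
    let: (pi0, tpi0) := svmd_epochs k' in
    let P0 := empirical_kernel (m1 k') (samples_at y k' 0) in
    let V0 := if k' == 0%N then fun=> (1 + hbar) / (1 - gamma)
              else policy_eval c gamma h P0 pi0 in
    let it := svmd_inner (eta k') P0
      (fun t => empirical_kernel (m2 k') (samples_at y k' t))
      (Iterate V0 pi0 tpi0) (T k') in
    (it_pi it, it_tpi it)
  else (uniform_policy, uniform_policy).

Definition svmd_output (K : nat) : policy_type R S A := (svmd_epochs K).1.

End SVMD.

Section StepParams.
Context {R : realType}.

Definition log2 (x : R) : R := ln x / ln 2.

Definition epoch_gap (hbar gamma : R) (k : nat) : R :=
  (1 + hbar) / (2 ^+ k * (1 - gamma)).

End StepParams.

(* Main.v *)
(** Write [G_pi] for the resolvent [(I - gamma P_pi)^-1] and [D_t] for the Bregman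
    divergence from the [t]-th mirror iterate to [pi^*]. An epoch estimates
    [P V_0] once and afterwards only [P (V_t - V_0)], whose sampling error is
    proportional to the current gap. Up to these errors [V_t >= T_{pi_t} V_t], so
    [V^{pi_t} - V_t <= G_{pi_t} err]; by Bernstein's inequality the error made on
    [P V_0] is of order [sqrt (Var V_0 / m)], and [G_pi sqrt (Var V^pi)] is only
    [O((1 - gamma)^(-3/2))]. Conversely the three-point inequality against
    [pi^*] reads
      [V_{t+1} - V^* + D_{t+1} / eta
         <= gamma P_{pi^*} (V_t - V^* ) + D_t / eta + err].
    Applying [G_{pi^*}] makes it telescope: an epoch halves the gap, while the
    potential [G_{pi^*} D] has a bound which at most doubles in each of the first
    [k0] epochs and grows by a bounded factor over all the others, of which there
    are at most [ceil (log2 (1 / eps))].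

    [V_0] depends on the kernel [P0] of its epoch, so Bernstein's inequality does
    not apply to [(P0 - P) V_0] directly. At a state [s] one writes
    [V_0 = w + (V_0 s - V^{pi_0} s) psi], where [w] and [psi] are the value and the
    discounted hitting probability of the process stopped at [s] with terminal
    value [V^{pi_0} s]; neither depends on the samples drawn at [s]. *)

Require Import Defs.
From HB Require Import structures.
From mathcomp Require Import all_boot all_order all_algebra.
From mathcomp Require Import all_classical all_reals all_analysis.
From mathcomp Require Import measurable_realfun.
From mathcomp Require Import ring lra.

Set Implicit Arguments.
Unset Strict Implicit.
Unset Printing Implicit Defensive.

Import Order.TTheory GRing.Theory Num.Theory.
Import numFieldNormedType.Exports.

Local Open Scope classical_set_scope.
Local Open Scope ring_scope.

(** The noise is rationed by [nu], the inverse of [ceil (log2 (1 / eps))]. After [k0] there are at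
    most that many epochs, and besides a geometric term each adds a noise proportional to [nu] to
    the potential, so the total stays bounded; hence the squared logarithm in the sample sizes. The
    constants 28 and 7 meet in the halving step: the Bregman term contributes at most
    [151 / 100 * 7 / 28 * u], and everything else fits below [u / 2].

    Two circularities shape the estimates. The error at step [t] depends on the size of [V_t - V_0],
    known only once [V_t] is an approximate supersolution: this is resolved by induction on [t]. The
    variance of [V_0] is traded for that of [V^pi] at the price of their distance, which is the
    quantity being estimated: its coefficient is small, so it is absorbed.

    Accuracy is deterministic on every sample path satisfying three families of deviation bounds.
    Probability enters only through the law of the finitely many samples used, written as an
    iterated finite sum whose order can be chosen so that a given block comes last. *)

Section Dotp.
Context {R : realType} {T : finType}.
Implicit Types (p x y f g : T -> R) (k : R).

(** Mass at most one rather than exactly one: the kernel of a process stopped at a state has a zero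
    row there. *)
Definition subprob p := (forall a, 0 <= p a) /\ \sum_a p a <= 1.

Lemma simplex_subprob p : simplex p -> subprob p.
Proof. by case=> p0 p1; split=> //; rewrite p1. Qed.

Lemma simplex_inhabited p : simplex p -> exists a : T, true.
Proof.
case=> _ p1; have [a _|T0] := pickP (@predT T); first by exists a.
by move: p1; rewrite big_pred0 // => /eqP; rewrite eq_sym oner_eq0.
Qed.

Lemma dotpC x y : dotp x y = dotp y x.
Proof. by apply: eq_bigr => a _; rewrite mulrC. Qed.

Lemma dotpD x y z : dotp x (fun a => y a + z a) = dotp x y + dotp x z.
Proof. by rewrite /dotp -big_split; apply: eq_bigr => a _; rewrite /= mulrDr. Qed.

Lemma dotpN x y : dotp x (fun a => - y a) = - dotp x y.
Proof. by rewrite /dotp -sumrN; apply: eq_bigr => a _; rewrite mulrN. Qed.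

Lemma dotpB x y z : dotp x (fun a => y a - z a) = dotp x y - dotp x z.
Proof. by rewrite (dotpD x y (fun a => - z a)) dotpN. Qed.

Lemma dotpZ x k y : dotp x (fun a => k * y a) = k * dotp x y.
Proof. by rewrite /dotp mulr_sumr; apply: eq_bigr => a _; rewrite mulrCA. Qed.

Lemma dotp_cst p k : simplex p -> dotp p (fun=> k) = k.
Proof. by case=> _ p1; rewrite /dotp -mulr_suml p1 mul1r. Qed.

Lemma le_dotp p f g : (forall a, 0 <= p a) -> (forall a, f a <= g a) ->
  dotp p f <= dotp p g.
Proof. by move=> p0 fg; apply: ler_sum => a _; apply: ler_wpM2l. Qed.

Lemma dotp_ge0 p f : (forall a, 0 <= p a) -> (forall a, 0 <= f a) ->
  0 <= dotp p f.
Proof. by move=> p0 f0; apply: sumr_ge0 => a _; apply: mulr_ge0. Qed.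

Lemma dotp_subprob_le p f k : subprob p -> 0 <= k -> (forall a, f a <= k) ->
  dotp p f <= k.
Proof.
move=> [p0 p1] k0 fk; apply: (le_trans (le_dotp p0 fk)).
by rewrite /dotp -mulr_suml; apply: ler_piMl.
Qed.

Lemma dotp_le p f k : simplex p -> (forall a, f a <= k) -> dotp p f <= k.
Proof. by move=> px fk; rewrite -(dotp_cst k px); apply: le_dotp => //; case: px. Qed.

Lemma dotp_ge p f k : simplex p -> (forall a, k <= f a) -> k <= dotp p f.
Proof. by move=> px fk; rewrite -(dotp_cst k px); apply: le_dotp => //; case: px. Qed.

Lemma ler_norm_sub_dotp p f lo hi z : simplex p -> (forall a, lo <= f a <= hi) ->
  `|f z - dotp p f| <= hi - lo.
Proof.
move=> ps fb; have /andP[f0 f1] := fb z.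
have d0 : lo <= dotp p f by apply: dotp_ge => // a; case/andP: (fb a).
have d1 : dotp p f <= hi by apply: dotp_le => // a; case/andP: (fb a).
rewrite ler_norml; lra.
Qed.

Lemma ler_norm_dotp p f : (forall a, 0 <= p a) ->
  `|dotp p f| <= dotp p (fun a => `|f a|).
Proof.
move=> p0; apply: (le_trans (ler_norm_sum _ _ _)).
by apply: ler_sum => a _; rewrite normrM (ger0_norm (p0 a)).
Qed.

End Dotp.

Lemma le_supnorm (R : realType) (T : finType) (x : T -> R) a : `|x a| <= supnorm x.
Proof. by rewrite /supnorm (bigD1 a) //= le_max lexx. Qed.

Lemma supnorm_ge0 (R : realType) (T : finType) (x : T -> R) : 0 <= supnorm x.
Proof. by rewrite /supnorm; elim/big_ind: _ => // u v u0 v0; rewrite le_max u0. Qed.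

Lemma supnorm_le (R : realType) (T : finType) (x : T -> R) k :
  0 <= k -> (forall a, `|x a| <= k) -> supnorm x <= k.
Proof.
move=> k0 xk; rewrite /supnorm; elim/big_ind: _ => // u v uk vk.
by rewrite ge_max uk.
Qed.

(** * Variance and standard deviation *)

Section Variance.
Context {R : realType} {T : finType}.
Implicit Types (p f g : T -> R) (k : R).

Definition fvar p f : R := dotp p (fun a => f a ^+ 2) - dotp p f ^+ 2.

Definition fsd p f : R := Num.sqrt (fvar p f).

Lemma fvarE p f k : simplex p ->
  fvar p f = dotp p (fun a => (f a - k) ^+ 2) - (dotp p f - k) ^+ 2.
Proof.
move=> px; rewrite (_ : (fun a => (f a - k) ^+ 2) =
  (fun a => f a ^+ 2 + ((- 2 * k) * f a + k ^+ 2))); last by apply/funext => a; ring.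
by rewrite !dotpD dotpZ dotp_cst // /fvar; ring.
Qed.

Lemma fvar_le p f k : simplex p -> fvar p f <= dotp p (fun a => (f a - k) ^+ 2).
Proof. by move=> px; rewrite (fvarE f k px) gerBl sqr_ge0. Qed.

Lemma fvar_center p f : simplex p ->
  fvar p f = dotp p (fun a => (f a - dotp p f) ^+ 2).
Proof. by move=> px; rewrite (fvarE f (dotp p f) px) subrr expr0n /= subr0. Qed.

Lemma fvar_ge0 p f : simplex p -> 0 <= fvar p f.
Proof.
by move=> px; rewrite fvar_center //; apply: dotp_ge0 => [|a]; [case: px|rewrite /= sqr_ge0].
Qed.

Lemma fsd_ge0 p f : 0 <= fsd p f.
Proof. exact: sqrtr_ge0. Qed.

Lemma sqr_fsd p f : simplex p -> fsd p f ^+ 2 = fvar p f.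
Proof. by move=> px; rewrite sqr_sqrtr // fvar_ge0. Qed.

Lemma dotp_cauchy_schwarz p f g : simplex p ->
  dotp p (fun a => f a * g a) <=
  Num.sqrt (dotp p (fun a => f a ^+ 2)) * Num.sqrt (dotp p (fun a => g a ^+ 2)).
Proof.
move=> [p0 p1].
set C := dotp p (fun a => f a * g a); set F := dotp p (fun a => f a ^+ 2).
set G := dotp p (fun a => g a ^+ 2).
have F0 : 0 <= F by apply: dotp_ge0 => // a /=; apply: sqr_ge0.
have G0 : 0 <= G by apply: dotp_ge0 => // a /=; apply: sqr_ge0.
(* Weighted AM-GM, with optimal weights [s = Y] and [t = X]. If one of the two norms vanishes, a
   large weight on its side forces [C <= 0]. *)
have quad (s t : R) : 2 * (s * t) * C <= s ^+ 2 * F + t ^+ 2 * G.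
  rewrite -!dotpZ -dotpD; apply: le_dotp => // a.
  have := sqr_ge0 (s * f a - t * g a); lra.
set X := Num.sqrt F; set Y := Num.sqrt G.
have X0 : 0 <= X by apply: sqrtr_ge0.
have Y0 : 0 <= Y by apply: sqrtr_ge0.
have XF : X ^+ 2 = F by rewrite sqr_sqrtr.
have YG : Y ^+ 2 = G by rewrite sqr_sqrtr.
have [X1|X1] := eqVneq X 0.
  have F1 : F = 0 by rewrite -XF X1 expr0n.
  rewrite X1 mul0r leNgt; apply/negP => C0.
  have := quad ((G + 1) / (2 * C)) 1.
  rewrite F1 mulr0 add0r !expr1n mul1r mulr1 (_ : 2 * _ * C = G + 1); first lra.
  by field; rewrite gt_eqF.
have [Y1|Y1] := eqVneq Y 0.
  have G1 : G = 0 by rewrite -YG Y1 expr0n.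
  rewrite Y1 mulr0 leNgt; apply/negP => C0.
  have := quad 1 ((F + 1) / (2 * C)).
  rewrite G1 mulr0 addr0 !expr1n !mul1r (_ : 2 * _ * C = F + 1); first lra.
  by field; rewrite gt_eqF.
have XY : 0 < 2 * (X * Y) by rewrite mulr_gt0 // mulr_gt0 // lt_def ?X1 ?Y1.
rewrite -(ler_pM2l XY) [X * Y in X in X * C]mulrC.
apply: (le_trans (quad Y X)); rewrite -XF -YG.
by rewrite le_eqVlt; apply/orP; left; apply/eqP; ring.
Qed.

(** Minkowski's inequality for centered functions, from Cauchy-Schwarz applied to the cross term. *)
Lemma fsdD p f g : simplex p -> fsd p (fun a => f a + g a) <= fsd p f + fsd p g.
Proof.
move=> px; rewrite -(ler_pXn2r (n := 2)) ?nnegrE ?addr_ge0 ?fsd_ge0 //.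
rewrite sqrrD !sqr_fsd // !fvar_center //.
set mf := dotp p f; set mg := dotp p g.
rewrite (_ : (fun a => _) = fun a => (f a - mf) ^+ 2 +
   (2 * ((f a - mf) * (g a - mg)) + (g a - mg) ^+ 2)); last first.
  by apply/funext => a; rewrite dotpD -/mf -/mg; ring.
rewrite !dotpD dotpZ addrA lerD2r lerD2l mulr_natl lerMn2r /=.
by rewrite /fsd !fvar_center //; apply: dotp_cauchy_schwarz.
Qed.

(** Popoviciu's inequality: the second moment about the midpoint dominates the variance. *)
Lemma fsd_range p f lo hi : simplex p -> (forall a, lo <= f a <= hi) ->
  fsd p f <= (hi - lo) / 2.
Proof.
move=> px fb.
have [a _] := simplex_inhabited px.
have /andP[h1 h2] := fb a.
rewrite -(ler_pXn2r (n := 2)) ?nnegrE ?fsd_ge0 //; last by lra.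
rewrite sqr_fsd //; apply: (le_trans (fvar_le f ((hi + lo) / 2) px)).
apply: dotp_le => // b; have /andP[k1 k2] := fb b; nra.
Qed.

Lemma fsdZ p f k : 0 <= k -> fsd p (fun a => k * f a) = k * fsd p f.
Proof.
move=> k0; rewrite /fsd (_ : fvar _ _ = k ^+ 2 * fvar p f).
  by rewrite sqrtrM ?sqr_ge0 // sqrtr_sqr ger0_norm.
rewrite /fvar dotpZ (_ : (fun a => (k * f a) ^+ 2) = fun a => k ^+ 2 * f a ^+ 2).
  by rewrite dotpZ; ring.
by apply/funext => a; ring.
Qed.

Lemma fsdN p f : fsd p (fun a => - f a) = fsd p f.
Proof.
rewrite /fsd /fvar dotpN sqrrN; congr (Num.sqrt (_ - _)).
by apply: eq_bigr => a _; rewrite sqrrN.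
Qed.

End Variance.

(** * The discounted resolvent *)

Section Resolvent.
Context {R : realType} {S : finType}.
Variable gamma : R.
Hypothesis gamma_bound : 0 < gamma < 1.
Implicit Types (Q : S -> S -> R) (r v d : S -> R).

Let gamma_ge0 : 0 <= gamma. Proof. by case/andP: gamma_bound => /ltW. Qed.
Let gamma_lt1 : gamma < 1. Proof. by case/andP: gamma_bound. Qed.

(** Same body as [policy_eval], for an arbitrary kernel and reward, so that policy values are
    resolvents by conversion. It is also applied to stopped kernels, errors and Bregman
    divergences. *)
Definition resolvent Q r (s : S) : R :=
  let M : 'M[R]_#|S| := \matrix_(i, j) Q (enum_val i) (enum_val j) in
  let b : 'cV[R]_#|S| := \col_i r (enum_val i) in
  (invmx (1%:M - gamma *: M) *m b) (enum_rank s) 0.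

(** Maximum principle: at a maximizer [m], a positive [d m] would satisfy [d m <= gamma * d m]. *)
Lemma subsolution_le0 Q d : (forall s, subprob (Q s)) ->
  (forall s, d s <= gamma * dotp (Q s) d) -> forall s, d s <= 0.
Proof.
move=> Qs dQ s.
have [m _ dm] := @arg_maxP _ _ S s xpredT d isT.
apply: (le_trans (dm s isT)); rewrite leNgt; apply/negP => m0.
have : d m <= gamma * d m.
  apply: (le_trans (dQ m)); apply: ler_wpM2l => //.
  by apply: dotp_subprob_le => //; [exact: ltW|move=> a; apply: dm].
by apply/negP; rewrite -ltNge gtr_pMl.
Qed.

Lemma comparison Q v v' : (forall s, subprob (Q s)) ->
  (forall s, v s - gamma * dotp (Q s) v <= v' s - gamma * dotp (Q s) v') ->
  forall s, v s <= v' s.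
Proof.
move=> Qs h s; rewrite -subr_le0.
apply: (@subsolution_le0 Q (fun s => v s - v' s)) => // t.
by rewrite dotpB mulrBr; have := h t; lra.
Qed.

Lemma resolventE Q r : (forall s, subprob (Q s)) ->
  forall s, resolvent Q r s = r s + gamma * dotp (Q s) (resolvent Q r).
Proof.
move=> Qs s; rewrite /resolvent /=.
set M : 'M[R]_#|S| := \matrix_(i, j) _; set b : 'cV[R]_#|S| := \col_i _.
have mulE (x : 'cV[R]_#|S|) t : (M *m x) (enum_rank t) 0 =
    dotp (Q t) (fun s' => x (enum_rank s') 0).
  rewrite mxE /dotp (reindex (@enum_val S xpredT)) /=; last first.
    by apply: onW_bij; exact: enum_val_bij.
  apply: eq_bigr => j _; rewrite mxE !enum_rankK //; congr (_ * x _ _).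
  by rewrite enum_valK.
(* A vector in the kernel and its opposite are both subsolutions, hence both nonpositive. *)
have inj (x : 'cV[R]_#|S|) : (1%:M - gamma *: M) *m x = 0 -> x = 0.
  rewrite mulmxBl mul1mx -scalemxAl => /eqP; rewrite subr_eq0 => /eqP xM.
  have xE t : x (enum_rank t) 0 = gamma * dotp (Q t) (fun s' => x (enum_rank s') 0).
    by rewrite {1}xM mxE; congr (_ * _); exact: mulE.
  apply/colP => i; rewrite mxE -(enum_valK i); apply/eqP.
  rewrite eq_le; apply/andP; split.
    apply: (@subsolution_le0 Q (fun s' => x (enum_rank s') 0)) => // t.
    by rewrite {1}xE.
  rewrite -oppr_le0.
  apply: (@subsolution_le0 Q (fun s' => - x (enum_rank s') 0)) => // t.
  by rewrite {1}xE dotpN mulrN.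
have uM : 1%:M - gamma *: M \in unitmx.
  rewrite -unitmx_tr -row_free_unit -kermx_eq0; apply/eqP/row_matrixP => i.
  rewrite row0; apply: trmx_inj; rewrite trmx0; apply: inj.
  by apply: trmx_inj; rewrite trmx_mul trmx0 trmxK -row_mul mulmx_ker row0.
set y := invmx _ *m b.
have : (1%:M - gamma *: M) *m y = b by rewrite mulmxA mulmxV // mul1mx.
rewrite mulmxBl mul1mx -scalemxAl => /eqP; rewrite subr_eq addrC => /eqP yE.
by rewrite {1}yE addrC 3!mxE enum_rankK; congr (_ + _ * _); exact: mulE.
Qed.

Section Substochastic.
Variable Q : S -> S -> R.
Hypothesis Qs : forall s, subprob (Q s).

Lemma le_resolvent r v : (forall s, v s <= r s + gamma * dotp (Q s) v) ->
  forall s, v s <= resolvent Q r s.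
Proof. by move=> h; apply: (comparison Qs) => s; rewrite {1}resolventE //; have := h s; lra. Qed.

Lemma resolvent_le r v : (forall s, r s + gamma * dotp (Q s) v <= v s) ->
  forall s, resolvent Q r s <= v s.
Proof. by move=> h; apply: (comparison Qs) => s; rewrite {1}resolventE //; have := h s; lra. Qed.

Lemma resolvent_uniq r v : (forall s, v s = r s + gamma * dotp (Q s) v) ->
  forall s, v s = resolvent Q r s.
Proof.
move=> h s; apply/eqP; rewrite eq_le; apply/andP; split.
  by apply: le_resolvent => t; rewrite {1}h.
by apply: resolvent_le => t; rewrite [leRHS]h.
Qed.

Lemma resolventD r r' s :
  resolvent Q (fun s => r s + r' s) s = resolvent Q r s + resolvent Q r' s.
Proof.
apply/esym; move: s; apply: resolvent_uniq => s.
rewrite (dotpD (Q s) (resolvent Q r)) {1}(resolventE r Qs) {1}(resolventE r' Qs); ring.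
Qed.

Lemma resolventZ k r s :
  resolvent Q (fun s => k * r s) s = k * resolvent Q r s.
Proof.
apply/esym; move: s; apply: resolvent_uniq => s.
by rewrite (dotpZ (Q s) k (resolvent Q r)) {1}(resolventE r Qs); ring.
Qed.

Lemma ler_resolvent r r' : (forall s, r s <= r' s) ->
  forall s, resolvent Q r s <= resolvent Q r' s.
Proof.
by move=> rr'; apply: le_resolvent => s; rewrite {1}resolventE // lerD2r.
Qed.

Lemma resolvent_cst_le r k : 0 <= k -> (forall s, r s <= k) ->
  forall s, resolvent Q r s <= k / (1 - gamma).
Proof.
have g1 : 0 < 1 - gamma by rewrite subr_gt0.
move=> k0 rk; apply: resolvent_le => s.
set c := k / (1 - gamma).
have c0 : 0 <= c by apply: divr_ge0 => //; exact: ltW.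
have ck : c = k + gamma * c by rewrite /c; field; rewrite gt_eqF.
have /(ler_wpM2l gamma_ge0) : dotp (Q s) (fun=> c) <= c by apply: dotp_subprob_le.
have := rk s; lra.
Qed.

Lemma resolvent_ge r k : 0 <= k -> (forall s, - k <= r s) ->
  forall s, - (k / (1 - gamma)) <= resolvent Q r s.
Proof.
move=> k0 rk s; rewrite lerNl -mulN1r -resolventZ.
by apply: resolvent_cst_le => // t; rewrite mulN1r lerNl.
Qed.

Lemma resolvent_ge0 r : (forall s, 0 <= r s) -> forall s, 0 <= resolvent Q r s.
Proof.
by move=> r0 s; rewrite -oppr0 -(mul0r (1 - gamma)^-1) resolvent_ge // => t; rewrite oppr0.
Qed.

Lemma resolvent_ge_self r : (forall s, 0 <= r s) -> forall s, r s <= resolvent Q r s.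
Proof.
move=> r0 s; rewrite resolventE // lerDl mulr_ge0 // dotp_ge0 //; first by case: (Qs s).
exact: resolvent_ge0.
Qed.

End Substochastic.

End Resolvent.

Section PolicyKernel.
Context {R : realType} {S A : finType}.
Implicit Types (P Q : S -> A -> S -> R) (pi : S -> A -> R) (v : S -> R).

Lemma dotp_policy_kernel Q pi v s :
  dotp (policy_kernel Q pi s) v = dotp (pi s) (kernel_app Q v s).
Proof.
rewrite /kernel_app {2}/dotp {1}/dotp /policy_kernel.
under eq_bigr do rewrite mulr_suml.
rewrite exchange_big /=; apply: eq_bigr => a _.
by rewrite mulr_sumr; apply: eq_bigr => s' _; rewrite mulrA.
Qed.

Lemma policy_kernel_simplex Q pi s : is_kernel Q -> simplex (pi s) ->
  simplex (policy_kernel Q pi s).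
Proof.
move=> Qk pis; split.
  move=> s'; apply: (@dotp_ge0 _ _ (pi s) (fun a => Q s a s')); first by case: pis.
  by move=> a; case: (Qk s a).
rewrite /policy_kernel exchange_big /= -[RHS](dotp_cst 1 pis).
by apply: eq_bigr => a _; rewrite -mulr_sumr; case: (Qk s a) => _ ->.
Qed.

Lemma policy_kernel_subprob Q pi s : is_kernel Q -> simplex (pi s) ->
  subprob (policy_kernel Q pi s).
Proof. by move=> Qk pis; apply/simplex_subprob/policy_kernel_simplex. Qed.

End PolicyKernel.

(** * Total variance of a discounted value *)

Section VarianceBound.
Context {R : realType} {S A : finType}.
Variables (P : S -> A -> S -> R) (gamma H : R) (pi : S -> A -> R).
Variables (r V : S -> R).
Hypotheses (P_kernel : is_kernel P) (pi_policy : is_policy pi).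
Hypotheses (gamma_bound : 0 < gamma < 1) (H_gt0 : 0 < H).
Hypothesis r_bound : forall s, 0 <= r s <= H.
Hypothesis V_fix : forall s, V s = r s + gamma * dotp (policy_kernel P pi s) V.

Let Qs s : subprob (policy_kernel P pi s).
Proof. exact: policy_kernel_subprob. Qed.

Lemma value_bound s : 0 <= V s <= H / (1 - gamma).
Proof.
have VE := resolvent_uniq gamma_bound Qs V_fix.
rewrite !VE; apply/andP; split.
  by apply: resolvent_ge0 => // t; case/andP: (r_bound t).
by apply: resolvent_cst_le => //; [exact: ltW|move=> t; case/andP: (r_bound t)].
Qed.

(* [theta / 2 * (2 B V - V ^+ 2)] is a supersolution for the squared
   fluctuations [gamma ^+ 2 * Var V], and AM-GM with weight [theta] passes from
   these to the standard deviations. *)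
Lemma sd_subsolution_le (d : S -> R) (a b : R) : 0 <= a -> 0 <= b ->
  (forall s, d s <= gamma * dotp (policy_kernel P pi s) d
     + a * (gamma * dotp (pi s) (fun x => fsd (P s x) V)) + b) ->
  forall s, d s <= a * (H / (1 - gamma) / Num.sqrt (1 - gamma)) + b / (1 - gamma).
Proof.
move=> a0 b0 dP.
have g1 : 0 < 1 - gamma by rewrite subr_gt0; case/andP: gamma_bound.
have g0 : 0 < gamma by case/andP: gamma_bound.
set z := Num.sqrt (1 - gamma).
have z0 : 0 < z by rewrite sqrtr_gt0.
have z2 : z ^+ 2 = 1 - gamma by rewrite sqr_sqrtr // ltW.
set B := H / (1 - gamma).
have B0 : 0 < B by rewrite divr_gt0.
(* This weight balances the final bound: [th / 2 * B ^+ 2] and [1 / (2 * th * (1 - gamma))] both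
   equal [B / (2 * z)]. *)
pose th := (B * z)^-1.
have th0 : 0 < th by rewrite invr_gt0 mulr_gt0.
pose F s := th / 2 * (2 * B * V s - V s ^+ 2) + 1 / (2 * th * (1 - gamma)).
pose G s := a * F s + b / (1 - gamma).
have VB s := value_bound s.
have FE s : gamma * dotp (policy_kernel P pi s) F +
    gamma * dotp (pi s) (fun x => fsd (P s x) V) <= F s.
  set Q := policy_kernel P pi s.
  have Qx : simplex Q by apply: policy_kernel_simplex.
  have -> : dotp Q F = th / 2 * (2 * B * dotp Q V - dotp Q (fun s => V s ^+ 2))
      + 1 / (2 * th * (1 - gamma)).
    by rewrite /F dotpD dotp_cst // dotpZ dotpB dotpZ.
  have sdP : gamma * dotp (pi s) (fun x => fsd (P s x) V) <=
      th / 2 * gamma ^+ 2 * (dotp Q (fun s => V s ^+ 2) - dotp Q V ^+ 2) + 1 / (2 * th).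
    have sdx x : gamma * fsd (P s x) V <=
        th / 2 * gamma ^+ 2 * fvar (P s x) V + 1 / (2 * th).
      rewrite -sqr_fsd //; have := sqr_ge0 (th * gamma * fsd (P s x) V - 1).
      rewrite -(pmulr_rge0 _ (_ : 0 < (2 * th)^-1)) ?invr_gt0 ?mulr_gt0 //.
      rewrite -subr_ge0 => h; rewrite -subr_ge0; congr (0 <= _): h.
      by field; rewrite gt_eqF.
    rewrite -dotpZ; apply: (le_trans (le_dotp _ sdx)); first by case: (pi_policy s).
    rewrite dotpD dotp_cst // dotpZ lerD2r ler_pM2l; last first.
      by rewrite !mulr_gt0 // invr_gt0.
    rewrite /fvar dotpB !dotp_policy_kernel lerD2l lerN2.
    (* Law of total variance: the variance over actions of the conditional means is dropped. *)
    have := fvar_ge0 (fun x => dotp (P s x) V) (pi_policy s).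
    by rewrite /fvar subr_ge0.
  have q2 : 0 <= dotp Q (fun s => V s ^+ 2).
    by apply: dotp_ge0 => [|t /=]; [case: Qx|exact: sqr_ge0].
  have /andP[r0 rH] := r_bound s; have /andP[V0 VB'] := VB s.
  have QV : gamma * dotp Q V = V s - r s by rewrite V_fix addrC addKr.
  rewrite -/B in VB'.
  have e1 : 1 / (2 * th * (1 - gamma)) =
      gamma * (1 / (2 * th * (1 - gamma))) + 1 / (2 * th).
    by field; rewrite !gt_eqF.
  rewrite /F {2}e1 mulrDr.
  apply: (@le_trans _ _ (
    gamma * (th / 2 * (2 * B * dotp Q V - dotp Q (fun s => V s ^+ 2))) +
    gamma * (1 / (2 * th * (1 - gamma))) +
    (th / 2 * gamma ^+ 2 * (dotp Q (fun s => V s ^+ 2) - dotp Q V ^+ 2) + 1 / (2 * th)))).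
    by rewrite lerD2l.
  (* Substituting [gamma * dotp Q V = V s - r s], the right side exceeds the left by
     [2 * (B - V s) * r s + r s ^+ 2] plus [gamma * (1 - gamma)] times the second moment of [V]. *)
  have key : gamma * (2 * B * dotp Q V - dotp Q (fun s => V s ^+ 2)) +
      gamma ^+ 2 * (dotp Q (fun s => V s ^+ 2) - dotp Q V ^+ 2) <=
      2 * B * V s - V s ^+ 2.
    rewrite !mulrBr (mulrCA gamma (2 * B)) -exprMn QV.
    have : 0 <= gamma * (1 - gamma) * dotp Q (fun s => V s ^+ 2).
      by rewrite !mulr_ge0 // ltW.
    have : 0 <= (B - V s) * r s by rewrite mulr_ge0 // subr_ge0.
    have := sqr_ge0 (r s); nra.
  have th2 : 0 < th / 2 by rewrite divr_gt0.
  have := ler_wpM2l (ltW th2) key; lra.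
have GE s : d s <= G s.
  move: s; apply: (comparison gamma_bound Qs) => s.
  have -> : dotp (policy_kernel P pi s) G =
      a * dotp (policy_kernel P pi s) F + b / (1 - gamma).
    by rewrite /G dotpD dotpZ dotp_cst //; apply: policy_kernel_simplex.
  have := ler_wpM2l a0 (FE s); have := dP s.
  have : b = (1 - gamma) * (b / (1 - gamma)) by field; rewrite gt_eqF.
  rewrite /G; lra.
move=> s; apply: (le_trans (GE s)); rewrite /G lerD2r; apply: ler_wpM2l => //.
have -> : B / z = th / 2 * B ^+ 2 + 1 / (2 * th * (1 - gamma)).
  by rewrite /th -z2; field; rewrite !gt_eqF.
rewrite lerD2r ler_pM2l ?divr_gt0 //.
by have := sqr_ge0 (B - V s); lra.
Qed.

End VarianceBound.

(** * Mirror descent steps on the simplex *)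

Lemma cvg_sum_fin (R : realType) (I : finType) (U : Type) (F : set_system U)
    (FF : Filter F) (f : I -> U -> R) (l : I -> R) :
  (forall i, f i x @[x --> F] --> l i) ->
  \sum_i f i x @[x --> F] --> \sum_i l i.
Proof. by move=> fl; apply: cvg_big => // ; exact: (@add_continuous R). Qed.

Section MirrorStep.
Context {R : realType} {A : finType}.
Implicit Types (x y q : A -> R) (w : (A -> R) -> R) (g : (A -> R) -> A -> R).

Lemma simplexD_segment x y (r : R) : simplex x -> simplex y -> 0 <= r <= 1 ->
  simplex (r *: y + (1 - r) *: x).
Proof.
move=> [x0 x1] [y0 y1] /andP[r0 r1]; split.
  by move=> a; rewrite addr_ge0 // mulr_ge0 // subr_ge0.
rewrite big_split /= -2!mulr_sumr x1 y1; lra.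
Qed.

Lemma continuous_dotp q : continuous (dotp q : {ptws A -> R} -> R).
Proof.
move=> y; rewrite /dotp.
apply: (@cvg_sum_fin R A _ (nbhs y) _
  (fun a (z : {ptws A -> R}) => q a * z a) (fun a => q a * y a)) => a.
apply: cvgM; first exact: cvg_cst.
exact: (@proj_continuous A (fun=> R) a y).
Qed.

Lemma compact_simplex : compact (simplex : set {ptws A -> R}).
Proof.
have cl (a : A) : continuous (fun y : {ptws A -> R} => y a).
  exact: (@proj_continuous A (fun=> R) a).
apply: (@subclosed_compact _ _ [set f : {ptws A -> R} | forall a, `[0, 1]%classic (f a)]).
- have -> : (simplex : set {ptws A -> R}) =
      (\bigcap_(a in [set: A]) ((fun y : {ptws A -> R} => y a) @^-1` [set u | 0 <= u]))
      `&` (dotp (fun=> 1) : {ptws A -> R} -> R) @^-1` [set u | u = 1].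
    apply/seteqP; split=> [y [y0 y1]|y [y0 y1]]; split.
    + by move=> a _; exact: y0.
    + by rewrite /= /dotp -[RHS]y1; apply: eq_bigr => a _; rewrite mul1r.
    + by move=> a; exact: (y0 a I).
    + by rewrite -[RHS]y1 /dotp; apply: eq_bigr => a _; rewrite mul1r.
  apply: closedI.
    apply: closed_bigI => a _.
    by move/continuous_closedP: (cl a); apply; exact: closed_ge.
  by move/continuous_closedP: (continuous_dotp (q := fun=> 1)); apply; exact: closed_eq.
- by apply: (@tychonoff A (fun=> R) (fun=> `[0, 1]%classic)) => a; exact: segment_compact.
- move=> y [y0 y1] a; rewrite /= in_itv /= y0 /= -y1 (bigD1 a) //= lerDl.
  by apply: sumr_ge0.
Qed.

Section Bregman.
Variables (w : (A -> R) -> R) (g : (A -> R) -> A -> R).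
Hypothesis w_C1 : is_C1_gradient w g.

Lemma C1_continuous : continuous_on_simplex w.
Proof.
apply/subspace_continuousP => x xs /=.
have cl (a : A) : continuous (fun y : {ptws A -> R} => y a).
  exact: (@proj_continuous A (fun=> R) a).
pose b (y : {ptws A -> R}) := `|dotp (g x) y - dotp (g x) x| + \sum_a `|y a - x a|.
have b0 : b y @[y --> nbhs (x : {ptws A -> R})] --> (0 : R).
  rewrite (_ : 0 = `|dotp (g x) x - dotp (g x) x| + \sum_a `|x a - x a|); last first.
    by rewrite subrr normr0 add0r big1 // => a _; rewrite subrr normr0.
  apply: cvgD.
    apply: (@cvg_norm R R^o _ _ _ (fun z : {ptws A -> R} => dotp (g x) z - dotp (g x) x)).
    by apply: cvgB; [exact: continuous_dotp|exact: cvg_cst].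
  apply: (@cvg_sum_fin R A _ (nbhs (x : {ptws A -> R})) _
    (fun a (z : {ptws A -> R}) => `|z a - x a|) (fun a => `|x a - x a|)) => a.
  apply: (@cvg_norm R R^o _ _ _ (fun z : {ptws A -> R} => z a - x a)).
  by apply: cvgB; [exact: cl|exact: cvg_cst].
apply/cvgrPdist_lt => e e0.
have [_ /(_ _ xs _ ltr01) near1] := w_C1.
have near2 : \forall y \near within (simplex : set {ptws A -> R})
    (nbhs (x : {ptws A -> R})), b y < e.
  apply: cvg_within; move/cvgrPdist_lt: b0 => /(_ _ e0); apply: filterS => y.
  by rewrite sub0r normrN => /(le_lt_trans (ler_norm _)).
near=> y.
have h1 : `|w y - w x - dotp (g x) (y - x)| <= 1 * \sum_a `|y a - x a| by near: y.
have h2 : b y < e by near: y.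
rewrite distrC; apply: (le_lt_trans _ h2).
have -> : w y - w x = dotp (g x) (y - x) + (w y - w x - dotp (g x) (y - x)) by ring.
apply: (le_trans (ler_normD _ _)); apply: lerD; last by rewrite -[leRHS]mul1r.
by rewrite (dotpB (g x) y x).
Unshelve. all: by end_near.
Qed.

(** One small [r] replaces a limit along the segment. Requiring [r <= e] as well makes terms of
    order [r ^+ 2] negligible after division by [r]. *)
Lemma C1_directional x y (e : R) : simplex x -> simplex y -> 0 < e ->
  exists2 r : R, 0 < r <= Num.min 1 e &
    `|w (r *: y + (1 - r) *: x) - w x - r * dotp (g x) (y - x)| <= e * r.
Proof.
move=> xs ys e0.
pose M := \sum_a `|y a - x a| + 1.
have M0 : 0 < M by rewrite ltr_wpDl // sumr_ge0.
have [_ /(_ _ xs (e / M))] := w_C1.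
rewrite divr_gt0 // => /(_ isT).
pose c (r : R) : {ptws A -> R} := r *: y + (1 - r) *: x.
have cc : c r @[r --> nbhs (0 : R)] --> (x : {ptws A -> R}).
  have -> : (x : {ptws A -> R}) = c 0 by rewrite /c scale0r add0r subr0 scale1r.
  apply/cvg_sup => a.
  apply: (@continuous_comp_initial (A -> R) R R (fun f => f a) c) => r.
  have -> : (fun f => f a) \o c = (fun r => r * y a + (1 - r) * x a) by [].
  apply: cvgD; first by apply: cvgMl; exact: cvg_id.
  by apply: cvgMl; apply: cvgB; [exact: cvg_cst|exact: cvg_id].
move=> /cc /= /nbhs_ballP[r0 /= r00 hr].
pose r := Num.min (r0 / 2) (Num.min 1 e).
have rgt0 : 0 < r by rewrite !lt_min ltr01 e0 divr_gt0.
have r1e : r <= Num.min 1 e by rewrite ge_min lexx orbT.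
have r1 : r <= 1 by apply: (le_trans r1e); rewrite ge_min lexx.
exists r; first by rewrite rgt0.
have /hr /= : ball (0 : R) r0 r.
  rewrite /ball /= sub0r normrN gtr0_norm // gt_min; apply/orP; left.
  by rewrite ltr_pdivrMr // ltr_pMr // ltr1n.
rewrite /c => /(_ (simplexD_segment xs ys _)); rewrite (ltW rgt0) r1 => /(_ isT).
have -> : r *: y + (1 - r) *: x - x = r *: (y - x).
  by rewrite scalerBr scalerBl scale1r addrA addrAC addrK.
rewrite (dotpZ (g x) r (y - x)) => h; apply: (le_trans h).
have -> : \sum_a `|(r *: y + (1 - r) *: x) a - x a| = r * \sum_a `|y a - x a|.
  rewrite mulr_sumr; apply: eq_bigr => a _.
  have -> : (r *: y + (1 - r) *: x) a - x a = r * (y a - x a).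
    by change (r * y a + (1 - r) * x a - x a = r * (y a - x a)); ring.
  by rewrite normrM gtr0_norm.
rewrite mulrCA mulrC ler_pM2r // -mulrA -[leRHS]mulr1 ler_pM2l //.
by rewrite mulrC ler_pdivrMr // mul1r lerDl.
Qed.

(** Strong convexity between [x] and a point at fraction [r] towards [y], divided by [r]; the loss
    [r * (n / 2)] and the first-order error together stay below [e]. *)
Lemma bregman_ge_norm (N : (A -> R) -> R) x y : strongly_convex1 N w ->
  simplex x -> simplex y -> N (y - x) ^+ 2 / 2 <= bregman w g x y.
Proof.
move=> sc xs ys; rewrite /bregman; set n := N _ ^+ 2.
have n0 : 0 <= n := sqr_ge0 _.
apply/ler_addgt0Pr => e e0; pose e' := e / (n / 2 + 1).
have n1 : 0 < n / 2 + 1 by rewrite ltr_wpDl // divr_ge0.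
have e'0 : 0 < e' by rewrite divr_gt0.
have -> : e = e' * (n / 2 + 1) by rewrite /e' divfK // gt_eqF.
have [r /andP[r0]] := C1_directional xs ys e'0.
rewrite le_min => /andP[r1 re]; rewrite ler_norml => /andP[lo _].
have := sc y x r ys xs; rewrite (ltW r0) r1 -/n => /(_ isT) up.
have : r * (n / 2) <= r * (w y - w x - dotp (g x) (y - x) + r * (n / 2) + e') by lra.
rewrite ler_pM2l // => h; apply: (le_trans h).
have : r * (n / 2) <= e' * (n / 2) by apply: ler_wpM2r => //; apply: divr_ge0.
lra.
Qed.

Lemma bregman_ge0 (N : (A -> R) -> R) x y : strongly_convex1 N w ->
  simplex x -> simplex y -> 0 <= bregman w g x y.
Proof.
move=> sc xs ys; apply: (le_trans _ (bregman_ge_norm sc xs ys)).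
by rewrite divr_ge0 // sqr_ge0.
Qed.

Variable h : (A -> R) -> R.
Hypotheses (h_cont : continuous_on_simplex h).
Hypothesis h_convex : convex_function (E := A -> R) simplex h.

Lemma convex_segment x y (r : R) : simplex x -> simplex y -> 0 <= r <= 1 ->
  h (r *: y + (1 - r) *: x) <= r * h y + (1 - r) * h x.
Proof.
move=> xs ys /andP[r0 r1].
by have := @h_convex (Itv01 r0 r1) y x (mem_set ys) (mem_set xs); rewrite convRE.
Qed.

Definition mirror_objective (eta : R) q (x0 x : A -> R) : R :=
  eta * (dotp q x + h x) + bregman w g x0 x.

(** Compactness of the simplex and continuity of the objective rule out the default value of
    [argmin_simplex]. *)
Lemma argmin_mirror_objective eta q x0 : (0 < #|A|)%N ->
  let x := argmin_simplex (mirror_objective eta q x0) in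
  simplex x /\ forall y, simplex y ->
    mirror_objective eta q x0 x <= mirror_objective eta q x0 y.
Proof.
move=> A0 x; have [a0 _] : exists a : A, true by case/card_gt0P: A0 => a _; exists a.
apply: (@xgetPex _ (fun=> 0) [set x | simplex x /\ forall y, simplex y ->
  mirror_objective eta q x0 x <= mirror_objective eta q x0 y]).
have := @compact_EVT_min {ptws A -> R} R (mirror_objective eta q x0) simplex.
case.
- exists (fun a => (a == a0)%:R); split; first by move=> a; rewrite ler0n.
  by rewrite (bigD1 a0) //= eqxx big1 ?addr0 // => a /negPf ->.
- exact: compact_simplex.
- apply/subspace_continuousP => y ys.
  have dc q' : dotp q' z @[z --> within (simplex : set {ptws A -> R})
      (nbhs (y : {ptws A -> R}))] --> dotp q' y.
    move=> U hU; have : nbhs (y : {ptws A -> R}) ((dotp q' : {ptws A -> R} -> R) @^-1` U).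
      exact: (@continuous_dotp q' y U hU).
    by rewrite /within; apply: filterS => z hz _.
  have hc : h z @[z --> within (simplex : set {ptws A -> R})
      (nbhs (y : {ptws A -> R}))] --> h y.
    by have /subspace_continuousP hh := h_cont; exact: hh.
  have wc : w z @[z --> within (simplex : set {ptws A -> R})
      (nbhs (y : {ptws A -> R}))] --> w y.
    by have /subspace_continuousP hh := C1_continuous; exact: hh.
  have -> : mirror_objective eta q x0 = fun z => eta * (dotp q z + h z) +
      (w z - w x0 - (dotp (g x0) z - dotp (g x0) x0)).
    by apply/funext => z; rewrite /mirror_objective /bregman (dotpB (g x0) z x0).
  apply: cvgD; first by apply: cvgMr; apply: cvgD.
  apply: cvgB; first by apply: cvgB; [exact: wc|exact: cvg_cst].
  by apply: cvgB; [exact: dc|exact: cvg_cst].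
- move=> z /set_mem zs zmin; exists z; split=> // y ys.
  exact: zmin (mem_set ys).
Qed.

(* First-order optimality of the minimizer, tested along the segment to [y]. *)
Lemma three_point eta q x0 x y : 0 <= eta -> simplex x -> simplex y ->
  (forall z, simplex z -> mirror_objective eta q x0 x <= mirror_objective eta q x0 z) ->
  mirror_objective eta q x0 x + bregman w g x y <= mirror_objective eta q x0 y.
Proof.
move=> eta0 xs ys xmin; apply/ler_addgt0Pr => e e0.
have [r /andP[r0]] := C1_directional xs ys e0.
rewrite le_min => /andP[r1 _]; rewrite ler_norml => /andP[_ up].
have r01 : 0 <= r <= 1 by rewrite ltW.
have := xmin _ (simplexD_segment xs ys r01).
have hr := ler_wpM2l eta0 (convex_segment xs ys r01).
move: up; rewrite /mirror_objective /bregman.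
have dseg q' : dotp q' (r *: y + (1 - r) *: x) = r * dotp q' y + (1 - r) * dotp q' x.
  by rewrite -!dotpZ -dotpD.
rewrite !(dotpB _ _ x) !(dotpB _ _ x0) !dseg => up le.
rewrite -(ler_pM2l r0); lra.
Qed.

End Bregman.
End MirrorStep.

(** * Concentration on finite product spaces *)

(** [G x = (1 + x + x ^+ 2) * expR (- x)] has derivative [(x - x ^+ 2) * expR (- x)], so on [x <= 1]
    it is least at 0, where it is 1. *)
Lemma expR_le_quadratic (R : realType) (y : R) : y <= 1 -> expR y <= 1 + y + y ^+ 2.
Proof.
move=> y1; pose G (x : R) := (1 + x + x ^+ 2) * expR (- x).
have dG (x : R) : is_derive x 1 G ((x - x ^+ 2) * expR (- x)).
  have dN : is_derive x 1 (fun t : R => expR (- t)) (- expR (- x)).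
    have := @is_derive1_comp R expR (fun t => - t) x _ _ (is_derive_expR _)
      (is_deriveN (is_derive_id x 1)).
    by rewrite mulrN1.
  have dq : is_derive x 1 (fun t : R => 1 + t + t ^+ 2) (1 + 2 * x).
    apply: is_derive_eq.
    by rewrite add0r; congr (_ + _); rewrite /GRing.scale /=; ring.
  apply: is_derive_eq; rewrite /GRing.scale /=; ring.
have cG (a b : R) : {within `[a, b], continuous G}.
  apply: continuous_subspaceT => x; apply: differentiable_continuous.
  by apply/derivable1_diffP; apply: ex_derive.
have G0 : G 0 = 1 by rewrite /G oppr0 expR0 expr0n /= !addr0 mulr1.
suff : 1 <= G y.
  by rewrite /G expRN ler_pdivlMr ?expR_gt0 // mul1r.
have [y0|y0|->] := ltgtP y 0; last by rewrite G0.
  have [c] := MVT y0 (fun x _ => dG x) (cG _ _).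
  rewrite in_itv /= G0 => /andP[_ c0] e.
  have : 0 <= (c ^+ 2 - c) * expR (- c) * (0 - y).
    by rewrite mulr_ge0 ?mulr_ge0 ?expR_ge0 //; nra.
  lra.
have [c] := MVT y0 (fun x _ => dG x) (cG _ _).
rewrite in_itv /= G0 => /andP[c0 cy] e.
have : 0 <= (c - c ^+ 2) * expR (- c) * (y - 0).
  by rewrite mulr_ge0 ?mulr_ge0 ?expR_ge0 //; nra.
lra.
Qed.

Section Expect.
Context {R : realType} {I : eqType} {S : finType}.
Variable p : I -> S -> R.
Hypothesis p_simplex : forall j, simplex (p j).
Implicit Types (J : seq I) (F G : (I -> S) -> R) (y : I -> S).

Definition update y j z : I -> S := fun i => if i == j then z else y i.

(* The expectation of [F] when the coordinates listed in [J] are drawn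
   independently from the laws [p j] and all others are as in [y]. *)
Fixpoint expect J F y : R :=
  if J is j :: J' then \sum_z p j z * expect J' F (update y j z) else F y.

Lemma expect_cat J J' F y : expect (J ++ J') F y = expect J (expect J' F) y.
Proof. by elim: J y => //= j J IH y; apply: eq_bigr => z _; rewrite IH. Qed.

(** Used to treat whatever depends only on coordinates outside [J] as a constant under the sum. *)
Lemma eq_expect J F G y :
  (forall y', (forall i, i \notin J -> y' i = y i) -> F y' = G y') ->
  expect J F y = expect J G y.
Proof.
elim: J y => [|j J IH] y FG /=; first exact: FG.
apply: eq_bigr => z _; congr (_ * _); apply: IH => y' y'E; apply: FG => i.
rewrite inE negb_or => /andP[ij iJ]; rewrite y'E // /update; case: eqP ij => //.
Qed.

Lemma le_expect J F G y : (forall y', F y' <= G y') -> expect J F y <= expect J G y.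
Proof.
move=> FG; elim: J y => [|j J IH] y //=.
by apply: ler_sum => z _; apply: ler_wpM2l => //; case: (p_simplex j).
Qed.

Lemma expect_cst J k y : expect J (fun=> k) y = k.
Proof.
elim: J y => [|j J IH] y //=.
by rewrite -[RHS](dotp_cst k (p_simplex j)); apply: eq_bigr => z _; rewrite IH.
Qed.

Lemma expectZ J k F y : expect J (fun y' => k * F y') y = k * expect J F y.
Proof.
elim: J y => [|j J IH] y //=; rewrite mulr_sumr.
by apply: eq_bigr => z _; rewrite IH mulrCA.
Qed.

Lemma expectD J F G y :
  expect J (fun y' => F y' + G y') y = expect J F y + expect J G y.
Proof.
elim: J y => [|j J IH] y //=; rewrite -big_split /=.
by apply: eq_bigr => z _; rewrite IH mulrDr.
Qed.

Lemma expect_sum J (K : Type) (r : seq K) (F : K -> (I -> S) -> R) y :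
  expect J (fun y' => \sum_(k <- r) F k y') y = \sum_(k <- r) expect J (F k) y.
Proof.
elim: r => [|k r IH].
  rewrite big_nil -[RHS](expect_cst J 0 y).
  by apply: eq_expect => y' _; rewrite big_nil.
rewrite big_cons -IH -expectD.
by apply: eq_expect => y' _; rewrite big_cons.
Qed.

Lemma expect_prod J (phi : I -> S -> R) y : uniq J ->
  expect J (fun y' => \prod_(j <- J) phi j (y' j)) y =
  \prod_(j <- J) \sum_z p j z * phi j z.
Proof.
elim: J y => [|j J IH] y /=; first by rewrite !big_nil.
move=> /andP[jJ uJ]; rewrite big_cons mulr_suml; apply: eq_bigr => z _.
rewrite -mulrA; congr (_ * _).
rewrite -(IH (update y j z)) // -expectZ; apply: eq_expect => y' y'E.
by rewrite big_cons y'E // /update eqxx.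
Qed.

End Expect.

Section Bernstein.
Context {R : realType} {I : eqType} {S : finType}.
Variables (p : I -> S -> R) (p0 : S -> R) (f : S -> R) (b : R).
Hypothesis p_simplex : forall j, simplex (p j).
Hypothesis p0_simplex : simplex p0.
Hypothesis f_bound : forall z, `|f z - dotp p0 f| <= b.

(** The Bernstein radius, parametrized by [th] of order [sqrt (log / m)] so that a mean of [m]
    samples exceeds it with probability at most [expR (- (m * th ^+ 2))]. *)
Definition deviation (th : R) : R := 2 * fsd p0 f * th + 2 * b * th ^+ 2.

Lemma mgf_le (lam : R) : 0 <= lam -> lam * b <= 1 ->
  \sum_z p0 z * expR (lam * (f z - dotp p0 f)) <= expR (lam ^+ 2 * fvar p0 f).
Proof.
move=> l0 lb; set mu := dotp p0 f.
apply: (@le_trans _ _ (dotp p0 (fun z => 1 + (lam * (f z - mu) + lam ^+ 2 * (f z - mu) ^+ 2)))).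
  apply: le_dotp => [|z]; first by case: p0_simplex.
  apply: (le_trans (expR_le_quadratic _)); last by rewrite exprMn addrA.
  apply: (le_trans _ lb); apply: ler_wpM2l => //.
  exact: (le_trans (ler_norm _) (f_bound z)).
rewrite !dotpD dotp_cst // 2!dotpZ -fvar_center // dotpB dotp_cst // subrr mulr0 add0r.
exact: expR_ge1Dx.
Qed.

(** Chernoff's bound with parameter [th / sg] when this is at most [1 / b], and [1 / b] otherwise;
    the factors 2 in [deviation] bring the exponent per sample to at most [- th ^+ 2] in both
    cases. *)
Lemma bernstein (J : seq I) (th : R) (y : I -> S) : 0 < th -> uniq J ->
  (forall j, j \in J -> p j = p0) ->
  expect p J (fun y => ((size J)%:R * deviation th <
    \sum_(j <- J) (f (y j) - dotp p0 f))%R%:R) y <= expR (- ((size J)%:R * th ^+ 2)).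
Proof.
move=> th0 uJ pJ; set mu := dotp p0 f; set m := (size J)%:R.
have b0 : 0 <= b.
  by have [z _] := simplex_inhabited p0_simplex; apply: (le_trans _ (f_bound z)).
set sg := fsd p0 f; have sg0 : 0 <= sg by apply: fsd_ge0.
have chernoff (lam : R) : 0 <= lam -> lam * b <= 1 ->
    lam ^+ 2 * sg ^+ 2 - lam * deviation th <= - th ^+ 2 ->
    expect p J (fun y => (m * deviation th < \sum_(j <- J) (f (y j) - mu))%R%:R) y
    <= expR (- (m * th ^+ 2)).
  move=> l0 lb expo.
  apply: (@le_trans _ _ (expect p J (fun y => \prod_(j <- J)
      expR (lam * (f (y j) - mu) - lam * deviation th)) y)).
    apply: le_expect => // y'; rewrite -expR_sum.
    case: ltP => [ev|_]; last exact: expR_ge0.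
    rewrite -expR0 ler_expR sumrB -mulr_sumr big_const_seq count_predT iter_addr_0.
    by rewrite -mulr_natr -mulrA -mulrBr mulr_ge0 // subr_ge0 mulrC ltW.
  rewrite (@expect_prod _ _ _ _ J
    (fun j z => expR (lam * (f z - mu) - lam * deviation th))) //.
  have -> : expR (- (m * th ^+ 2)) = \prod_(j <- J) expR (- th ^+ 2).
    by rewrite big_const_seq count_predT iter_mulr_1 -expRM_natl mulrN.
  rewrite !big_seq; apply: ler_prod => j jJ; apply/andP; split.
    apply: sumr_ge0 => z _; apply: mulr_ge0; last exact: expR_ge0.
    by case: (p_simplex j).
  rewrite pJ //; under eq_bigr do rewrite expRD mulrA.
  rewrite -mulr_suml; apply: (@le_trans _ _
    (expR (lam ^+ 2 * fvar p0 f) * expR (- (lam * deviation th)))).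
    by rewrite ler_wpM2r ?expR_ge0 // mgf_le.
  by rewrite -expRD ler_expR -sqr_fsd.
have [bsg|sgb] := leP (th * b) sg.
  have [sg00|sgn0] := eqVneq sg 0.
    (* If the deviation and [th * b <= sg] both degenerate, all summands are zero and the strict
       inequality never holds. *)
    have b00 : b = 0.
      apply/eqP; rewrite eq_le b0 andbT.
      by move: bsg; rewrite sg00 pmulr_rle0.
    rewrite [X in X <= _](_ : _ = 0) ?expR_ge0 //.
    rewrite -[RHS](expect_cst p_simplex J 0 y); apply: eq_expect => y' _ /=.
    rewrite big1 => [|j _]; last first.
      by apply/eqP; rewrite -normr_eq0 eq_le normr_ge0 andbT -b00 f_bound.
    by rewrite /deviation -/sg sg00 b00 !(mulr0, mul0r) addr0 mulr0 ltxx.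
  have sgp : 0 < sg by rewrite lt_def sgn0.
  apply: (chernoff (th / sg)).
  - by rewrite divr_ge0 // ltW.
  - by rewrite mulrAC ler_pdivrMr // mul1r.
  - have -> : (th / sg) ^+ 2 * sg ^+ 2 - th / sg * deviation th =
      - th ^+ 2 - 2 * b * (th ^+ 3 / sg).
      by rewrite /deviation -/sg; field; rewrite gt_eqF.
    by rewrite gerBl !mulr_ge0 ?invr_ge0 ?exprn_ge0 // ltW.
have bp : 0 < b.
  rewrite lt_def b0 andbT; apply/eqP => b00.
  by move: sgb; rewrite b00 mulr0 ltNge sg0.
apply: (chernoff b^-1); first by rewrite invr_ge0.
  by rewrite mulVf // gt_eqF.
have -> : b^-1 ^+ 2 * sg ^+ 2 - b^-1 * deviation th =
    (sg / b) ^+ 2 - 2 * (sg / b) * th - 2 * th ^+ 2.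
  by rewrite /deviation -/sg; field; rewrite gt_eqF.
have : sg / b <= th by rewrite ler_pdivrMr // ltW.
have : 0 <= sg / b by rewrite divr_ge0.
by move: (sg / b) => u u0 uth; nra.
Qed.

End Bernstein.

(** * The law of finitely many independent samples *)

Section JointLaw.
Context {R : realType} {I : eqType} {S : finType}.
Variables (p : I -> S -> R) (U : pred I).
Context d (W : measurableType d) (Pr : probability W R) (X : I -> W -> S).
Hypothesis X_measurable : forall j z, U j -> measurable (X j @^-1` [set z]).
Hypothesis X_law : forall j z, U j -> Pr (X j @^-1` [set z]) = (p j z)%:E.
Hypothesis X_independent : mutually_independent U Pr X.

Let overlay (J : seq I) (y : I -> S) (w : W) : I -> S :=
  fun i => if i \in J then X i w else y i.

Let slice (J0 J : seq I) (y : I -> S) (E : (I -> S) -> Prop) : set W :=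
  [set w | (forall i, i \in J0 -> X i w = y i) /\ E (overlay J y w)].

Let measurable_cylinder (J0 : seq I) y : all U J0 ->
  measurable [set w | forall i, i \in J0 -> X i w = y i].
Proof.
elim: J0 => [_|j J0 IH /= /andP[Uj UJ]].
  by rewrite (_ : [set w | _] = setT) //; apply/seteqP; split.
rewrite (_ : [set w | _] = X j @^-1` [set y j] `&`
  [set w | forall i, i \in J0 -> X i w = y i]); last first.
  apply/seteqP; split=> w /=.
    move=> h; split; first by apply: h; rewrite mem_head.
    by move=> i iJ; apply: h; rewrite inE iJ orbT.
  by case=> h1 h2 i; rewrite inE => /predU1P[->//|/h2].
by apply: measurableI; [exact: X_measurable|exact: IH].
Qed.

(** Induction on the coordinates [J] still free, those of [J0] being frozen: splitting on the value
    of the next coordinate moves it to [J0]. When none is left, the set is a cylinder and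
    independence gives the product. *)
Let slice_law J : forall J0 y (E : (I -> S) -> Prop), uniq (J0 ++ J) ->
    all U (J0 ++ J) ->
  measurable (slice J0 J y E) /\
  Pr (slice J0 J y E) =
    (\prod_(j <- J0) p j (y j) * expect p J (fun y' => `[< E y' >]%:R) y)%:E.
Proof.
elim: J => [|j J IH] J0 y E.
  rewrite cats0 => uJ UJ /=.
  have ov w : overlay [::] y w = y by apply/funext.
  case: asboolP => Ey; last first.
    rewrite mulr0 (_ : slice _ _ _ _ = set0).
      by split; [exact: measurable0|rewrite measure0].
    by apply/seteqP; split => // w [_]; rewrite ov.
  rewrite mulr1 (_ : slice _ _ _ _ = [set w | forall i, i \in J0 -> X i w = y i]).
    split; first exact: measurable_cylinder.
    rewrite -prodEFin (@X_independent J0 (fun j => [set y j])) //.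
    rewrite !big_seq; apply: eq_bigr => i iJ; apply: X_law.
    exact: (allP UJ).
  by apply/seteqP; split => w; [case|move=> h; split=> //; rewrite ov].
move=> uJ UJ.
have jJ0 : j \notin J0.
  by move: uJ; rewrite cat_uniq /= => /and3P[_]; rewrite negb_or => /andP[].
have perm : perm_eq (J0 ++ j :: J) ((j :: J0) ++ J).
  by rewrite perm_catC /= perm_cons perm_catC.
rewrite (perm_uniq perm) (perm_all _ perm) in uJ UJ.
have -> : slice J0 (j :: J) y E =
    \bigcup_(z in [set: S]) slice (j :: J0) J (update y j z) E.
  have ov w : overlay (j :: J) y w = overlay J (update y j (X j w)) w.
    apply/funext => i; rewrite /overlay /update inE.
    by have [->|ij] := eqVneq i j; case: ifP.
  have upd z i : i \in J0 -> update y j z i = y i.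
    by move=> iJ0; rewrite /update; case: eqP => // ij; rewrite -ij iJ0 in jJ0.
  apply/seteqP; split => w.
    case=> h1; rewrite ov => h2; exists (X j w) => //; split => // i.
    rewrite inE => /predU1P[->|iJ0]; first by rewrite /update eqxx.
    by rewrite upd // h1.
  case=> z _ [h1 h2].
  have Xj : X j w = z by rewrite h1 ?mem_head // /update eqxx.
  split; last by rewrite ov Xj.
  by move=> i iJ0; rewrite h1 ?inE ?iJ0 ?orbT // upd.
have H z := IH (j :: J0) (update y j z) E uJ UJ.
split.
  by apply: fin_bigcup_measurable => // z _; exact: (H z).1.
rewrite measure_fin_bigcup; [|exact: finite_finset| |by move=> z _; exact: (H z).1].
  rewrite (_ : [set: S] = [set` index_enum S]); last first.
    by apply/seteqP; split => // z _ /=; rewrite mem_index_enum.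
  rewrite -fsbig_seq ?index_enum_uniq //.
  rewrite (eq_bigr _ (fun z _ => (H z).2)) sumEFin; congr (_%:E).
  rewrite /= mulr_sumr; apply: eq_bigr => z _.
  rewrite big_cons {1}/update eqxx -mulrA [RHS]mulrCA.
  congr (_ * (_ * _)).
  rewrite !big_seq; apply: eq_bigr => i iJ0; rewrite /update; case: eqP => // ij.
  by rewrite -ij iJ0 in jJ0.
move=> z z' _ _ [w [[h1 _] [h2 _]]].
by have := h1 j (mem_head _ _); rewrite h2 ?mem_head // /update eqxx.
Qed.

Lemma joint_law (J : seq I) (y : I -> S) (E : (I -> S) -> Prop) :
  uniq J -> all U J ->
  (forall y y' : I -> S, {in J, y =1 y'} -> E y -> E y') ->
  measurable [set w | E (fun j => X j w)] /\
  Pr [set w | E (fun j => X j w)] =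
    (expect p J (fun y' => `[< E y' >]%:R) y)%:E.
Proof.
move=> uJ UJ EJ.
have [] := @slice_law J [::] y E uJ UJ; rewrite big_nil mul1r.
suff -> : slice [::] J y E = [set w | E (fun j => X j w)] by [].
apply/seteqP; split => w.
  by case=> _; apply: EJ => j jJ; rewrite /overlay jJ.
move=> h; split => //; apply: EJ h => j jJ.
by rewrite /overlay jJ.
Qed.

End JointLaw.

(** * Values of policies as resolvents *)

Section FiniteExpectation.
Context {R : realType} d (W : measurableType d) (Pr : probability W R).

Lemma measure_fin_partition (K : finType) (Z : K -> set W) :
  (forall x, measurable (Z x)) -> trivIset [set: K] Z ->
  Pr (\bigcup_(x in [set: K]) Z x) = (\sum_x Pr (Z x))%E.
Proof.
move=> mZ tZ; rewrite measure_fin_bigcup //; last exact: finite_finset.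
rewrite (_ : [set: K] = [set` index_enum K]); last first.
  by apply/seteqP; split => // x _ /=; rewrite mem_index_enum.
by rewrite -fsbig_seq ?index_enum_uniq.
Qed.

Lemma integral_sum_indic (K : finType) (Z : K -> set W) (k : K -> R) :
  (forall x, measurable (Z x)) -> (forall x, 0 <= k x) ->
  measurable_fun setT ((fun w => (\sum_x k x * \1_(Z x) w)%:E) : W -> \bar R) /\
  (\int[Pr]_w (\sum_x k x * \1_(Z x) w)%:E = (\sum_x k x * fine (Pr (Z x)))%:E)%E.
Proof.
move=> mZ k0.
have mi x : measurable_fun setT ((fun w => (\1_(Z x) w)%:E) : W -> \bar R).
  exact/measurable_EFinP/measurable_indicP.
have mk x : measurable_fun setT ((fun w => ((k x)%:E * (\1_(Z x) w)%:E)%E) : W -> \bar R).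
  exact: measurable_funeM.
have -> : (fun w => (\sum_x k x * \1_(Z x) w)%:E) =
    (fun w => \sum_(x <- index_enum K) ((k x)%:E * (\1_(Z x) w)%:E)%E).
  by apply/funext => w; rewrite -sumEFin.
split; first exact: emeasurable_sum.
rewrite ge0_integral_sum //; last first.
  by move=> x w _; rewrite -EFinM lee_fin mulr_ge0.
rewrite -sumEFin; apply: eq_bigr => x _.
rewrite [LHS](ge0_integralZl_EFin _ _ _ (mi x) (k0 x)) //.
by rewrite integral_indic // setIT /= EFinM fineK // fin_num_measure.
Qed.

End FiniteExpectation.

Section TrajectoryLaw.
Context {R : realType} {S A : finType}.
Variables (P : S -> A -> S -> R) (pi : S -> A -> R) (s0 : S).
Hypotheses (P_kernel : is_kernel P) (pi_policy : is_policy pi).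
Context d (W : measurableType d) (Pr : probability W R).
Variables (st : nat -> W -> S) (act : nat -> W -> A).
Hypothesis st_measurable : forall t s, measurable (st t @^-1` [set s]).
Hypothesis act_measurable : forall t a, measurable (act t @^-1` [set a]).
Hypothesis traj : is_trajectory P pi s0 Pr st act.

Fixpoint state_law (n : nat) (s : S) : R :=
  if n is n'.+1 then \sum_s' state_law n' s' * policy_kernel P pi s' s
  else (s == s0)%:R.

Lemma state_law_simplex n : simplex (state_law n).
Proof.
elim: n => [|n [IH0 IH1]]; split => /=.
- by move=> s; rewrite ler0n.
- by rewrite (bigD1 s0) //= eqxx big1 ?addr0 // => s /negPf ->.
- move=> s; apply: sumr_ge0 => s' _; apply: mulr_ge0 => //.
  by case: (policy_kernel_simplex P_kernel (pi_policy s')).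
- rewrite exchange_big /= -[RHS]IH1; apply: eq_bigr => s' _.
  rewrite -mulr_sumr; case: (policy_kernel_simplex P_kernel (pi_policy s')) => _ ->.
  by rewrite mulr1.
Qed.

Let window (k n : nat) (x : nat -> S) (b : nat -> A) : set W :=
  [set w | forall t, (k <= t <= n)%N -> st t w = x t /\ act t w = b t].

Let measurable_window k n x b : measurable (window k n x b).
Proof.
rewrite (_ : window k n x b = \bigcap_t (if (k <= t <= n)%N then
  st t @^-1` [set x t] `&` act t @^-1` [set b t] else setT)).
  by apply: bigcapT_measurable => t; case: ifP => // _; apply: measurableI.
apply/seteqP; split => [w h t _|w h t tkn]; first by case: ifP => // /h.
by have := h t I; rewrite tkn.
Qed.

(* The coordinates before time [k] are summed out one at a time. *)
Let window_law k : forall n x b, (k <= n)%N ->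
  Pr (window k n x b) = (state_law k (x k) * pi (x k) (b k) *
    \prod_(k <= t < n) (P (x t) (b t) (x t.+1) * pi (x t.+1) (b t.+1)))%:E.
Proof.
elim: k => [|k IH] n x b kn; first by rewrite big_mkord; exact: traj.
have -> : window k.+1 n x b = \bigcup_(z in [set: S * A])
    window k n (update x k z.1) (update b k z.2).
  apply/seteqP; split => [w h|w [[s a] _ h] t /andP[kt tn]].
    exists (st k w, act k w) => // t /andP[kt tn] /=; rewrite /update.
    have [->//|tk] := eqVneq t k; apply: h.
    by rewrite tn ltn_neqAle eq_sym tk kt.
  have := h t; rewrite /update (ltnW kt) tn gtn_eqF // => /(_ isT).
  by [].
rewrite measure_fin_partition //; last first.
  move=> [s a] [s' a'] _ _ [w [h1 h2]].
  have /= [] := h1 k; first by rewrite leqnn ltnW.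
  have /= [] := h2 k; first by rewrite leqnn ltnW.
  by rewrite /update eqxx => -> -> -> ->.
rewrite (eq_bigr _ (fun z _ => IH n _ _ (ltnW kn))) sumEFin; congr (_%:E).
have prodE s a : \prod_(k <= t < n) (P (update x k s t) (update b k a t) (update x k s t.+1) *
      pi (update x k s t.+1) (update b k a t.+1)) =
    P s a (x k.+1) * pi (x k.+1) (b k.+1) *
    \prod_(k.+1 <= t < n) (P (x t) (b t) (x t.+1) * pi (x t.+1) (b t.+1)).
  rewrite big_ltn // /update eqxx gtn_eqF //; congr (_ * _).
  rewrite !big_nat; apply: eq_bigr => t /andP[kt _].
  by rewrite !gtn_eqF // ltnS ltnW.
rewrite (eq_bigr (fun z : S * A => state_law k z.1 * pi z.1 z.2 *
    (P z.1 z.2 (x k.+1) * pi (x k.+1) (b k.+1)) *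
    \prod_(k.+1 <= t < n) (P (x t) (b t) (x t.+1) * pi (x t.+1) (b t.+1)))); last first.
  by move=> [s a] _; rewrite prodE /update eqxx mulrA.
rewrite -mulr_suml -(pair_bigA _ (fun s a => state_law k s * pi s a *
    (P s a (x k.+1) * pi (x k.+1) (b k.+1)))) /=.
congr (_ * _); rewrite mulr_suml; apply: eq_bigr => s _.
rewrite /policy_kernel -mulrA mulr_suml mulr_sumr; apply: eq_bigr => a _.
by rewrite !mulrA.
Qed.

Lemma state_action_law n s a :
  measurable [set w | st n w = s /\ act n w = a] /\
  Pr [set w | st n w = s /\ act n w = a] = (state_law n s * pi s a)%:E.
Proof.
have -> : [set w | st n w = s /\ act n w = a] = window n n (fun=> s) (fun=> a).
  apply/seteqP; split=> [w sa t|w /(_ n)]; last by rewrite leqnn; apply.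
  by rewrite -eqn_leq => /eqP <-.
split; first exact: measurable_window.
by rewrite window_law // big_geq // mulr1.
Qed.

Variables (c : S -> A -> R) (gamma H : R) (h : (A -> R) -> R).
Hypothesis gamma_bound : 0 < gamma < 1.
Hypothesis cost_bound : forall s a, 0 <= c s a + h (pi s) <= H.

Let r s := policy_cost c pi s + h (pi s).

Let rE s : r s = dotp (pi s) (fun a => c s a + h (pi s)).
Proof. by rewrite dotpD dotp_cst. Qed.

Let r_bound s : 0 <= r s <= H.
Proof.
rewrite rE; apply/andP; split.
  by apply: dotp_ge => // a; case/andP: (cost_bound s a).
by apply: dotp_le => // a; case/andP: (cost_bound s a).
Qed.

(** The terms are nonnegative, so expectation and series commute; each term has finitely many
    values, and its mean is read off from [state_action_law]. *)
Lemma value_trajectory :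
  'E_Pr[fun w => discounted_cost c gamma h pi (fun t => st t w) (fun t => act t w)]%E
  = (policy_eval c gamma h P pi s0)%:E.
Proof.
have g0 : 0 <= gamma by case/andP: gamma_bound => /ltW.
have g1 : gamma < 1 by case/andP: gamma_bound.
have Qs s : subprob (policy_kernel P pi s) by apply: policy_kernel_subprob.
set V := policy_eval c gamma h P pi.
have VR : V = resolvent gamma (policy_kernel P pi) r by [].
have VE s : V s = r s + gamma * dotp (policy_kernel P pi s) V.
  by rewrite VR; exact: resolventE.
have H0 : 0 <= H.
  by case/andP: (r_bound s0) => /le_trans h1 /h1.
have V0 s : 0 <= V s.
  by rewrite VR; apply: (resolvent_ge0 gamma_bound Qs) => t; case/andP: (r_bound t).
have VB s : V s <= H / (1 - gamma).
  by rewrite VR; apply: (resolvent_cst_le gamma_bound Qs) => // t; case/andP: (r_bound t).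
pose u (w : W) t := gamma ^+ t * (c (st t w) (act t w) + h (pi (st t w))).
have u0 w t : 0 <= u w t.
  by rewrite /u mulr_ge0 ?exprn_ge0 //; case/andP: (cost_bound (st t w) (act t w)).
have series_cvg (f : nat -> R) : (forall t, 0 <= f t <= gamma ^+ t * H) ->
    (limn (series f))%:E = (\sum_(0 <= t <oo) (f t)%:E)%E.
  move=> f0; rewrite -EFin_lim.
    by apply: congr_lim; apply/funext => n /=; rewrite /series /= -sumEFin.
  apply: (@series_le_cvg _ f (fun t => H * gamma ^+ t)).
  - by move=> t; case/andP: (f0 t).
  - by move=> t; rewrite mulr_ge0 ?exprn_ge0.
  - by move=> t; rewrite mulrC; case/andP: (f0 t).
  - by apply: is_cvg_geometric_series; rewrite ger0_norm.
rewrite unlock.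
under eq_integral => w _.
  rewrite /discounted_cost -/(u w) series_cvg; last first.
    move=> t; rewrite u0 /= ler_wpM2l ?exprn_ge0 //.
    by case/andP: (cost_bound (st t w) (act t w)).
  over.
pose k t (x : S * A) := gamma ^+ t * (c x.1 x.2 + h (pi x.1)).
pose Z t (x : S * A) : set W := [set w | st t w = x.1 /\ act t w = x.2].
have uE w t : u w t = \sum_x k t x * \1_(Z t x) w.
  rewrite (bigD1 (st t w, act t w)) //= big1 => [|[s a] sa].
    by rewrite indicE mem_set // mulr1 addr0.
  rewrite indicE memNset ?mulr0 // => -[/= e1 e2].
  by move: sa; rewrite e1 e2 eqxx.
have intu t := @integral_sum_indic _ _ _ Pr _ (Z t) (k t)
  (fun x => (state_action_law t x.1 x.2).1)
  (fun x => mulr_ge0 (exprn_ge0 t g0) (proj1 (andP (cost_bound x.1 x.2)))).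
rewrite integral_nneseries //; last 2 first.
- move=> t; rewrite (_ : (fun w => _) = fun w => (\sum_x k t x * \1_(Z t x) w)%:E).
    exact: (intu t).1.
  by apply/funext => w; rewrite uE.
- by move=> t w _; rewrite lee_fin.
have ut t : (\int[Pr]_w (u w t)%:E = (gamma ^+ t * dotp (state_law t) r)%:E)%E.
  rewrite (eq_integral (fun w => (\sum_x k t x * \1_(Z t x) w)%:E)); last first.
    by move=> w _; rewrite uE.
  rewrite (intu t).2; congr (_%:E); rewrite /dotp mulr_sumr.
  rewrite -(pair_bigA _ (fun s a => k t (s, a) * fine (Pr (Z t (s, a))))) /=.
  apply: eq_bigr => s _; rewrite rE /dotp 2!mulr_sumr; apply: eq_bigr => a _.
  by rewrite (state_action_law t s a).2 /k /=; ring.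
under eq_eseriesr => t _ do rewrite ut.
rewrite -series_cvg; last first.
  move=> t; have lawt := state_law_simplex t.
  rewrite mulr_ge0 ?exprn_ge0 //=; last first.
    by apply: dotp_ge => // s; case/andP: (r_bound s).
  by rewrite ler_wpM2l ?exprn_ge0 //; apply: dotp_le => // s; case/andP: (r_bound s).
congr (_%:E); apply/cvg_lim => //.
(* Bellman's equation makes the partial sums telescope, leaving the discounted mean of [V] at time
   [n]. *)
have part n : series (fun t => gamma ^+ t * dotp (state_law t) r) n =
    V s0 - gamma ^+ n * dotp (state_law n) V.
  elim: n => [|n IH].
    rewrite /series /= big_geq // expr0 mul1r /dotp (bigD1 s0) //= eqxx mul1r.
    by rewrite big1 ?addr0 ?subrr // => s /negPf ->; rewrite mul0r.
  rewrite seriesSr IH.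
  have -> : dotp (state_law n) r =
      dotp (state_law n) V - gamma * dotp (state_law n.+1) V.
    have -> : dotp (state_law n.+1) V =
        dotp (state_law n) (fun s => dotp (policy_kernel P pi s) V).
      rewrite /dotp /=; under eq_bigr do rewrite mulr_suml.
      rewrite exchange_big /=; apply: eq_bigr => s _.
      by rewrite mulr_sumr; apply: eq_bigr => s' _; rewrite mulrA.
    rewrite -dotpZ -dotpB; apply: eq_bigr => s _; congr (_ * _).
    by rewrite {1}VE addrK.
  by rewrite exprS; ring.
have lim0 : gamma ^+ n * dotp (state_law n) V @[n --> \oo] --> (0 : R).
  apply: (@squeeze_cvgr _ _ _ _ (fun=> 0) (fun n => H / (1 - gamma) * gamma ^+ n)).
  - apply: nearW => n; have lawn := state_law_simplex n.
    rewrite mulr_ge0 ?exprn_ge0 //=; last by apply: dotp_ge.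
    by rewrite mulrC ler_wpM2r ?exprn_ge0 //; apply: dotp_le.
  - exact: cvg_cst.
  - by apply: cvg_geometric; rewrite ger0_norm.
have -> : series (fun t => gamma ^+ t * dotp (state_law t) r) =
    (fun=> V s0) - (fun n => gamma ^+ n * dotp (state_law n) V).
  by apply/funext => n; rewrite part.
by have := cvgB (cvg_cst (V s0)) lim0; rewrite subr0; apply.
Qed.

End TrajectoryLaw.

(** * One epoch of the algorithm *)

Section Epoch.
Context {R : realType} {S A : finType}.
Variables (P : S -> A -> S -> R) (c : S -> A -> R) (gamma hbar : R).
Variable h : (A -> R) -> R.
Hypotheses (A_gt0 : (0 < #|A|)%N) (P_kernel : is_kernel P).
Hypothesis c_bound : forall s a, 0 <= c s a <= 1.
Hypothesis gamma_bound : 0 < gamma < 1.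
Hypothesis h_bound : forall x, simplex x -> 0 <= h x <= hbar.
Hypothesis hbar_ge0 : 0 <= hbar.
Hypothesis h_cont : continuous_on_simplex h.
Hypothesis h_convex : convex_function (E := A -> R) simplex h.
Variables (omega : (A -> R) -> R) (grad : (A -> R) -> A -> R).
Hypothesis omega_C1 : is_C1_gradient omega grad.

Let g0 : 0 < gamma. Proof. by case/andP: gamma_bound. Qed.
Let g1 : 0 < 1 - gamma. Proof. by rewrite subr_gt0; case/andP: gamma_bound. Qed.
Let H : R := 1 + hbar.
Let H_gt0 : 0 < H. Proof. by rewrite ltr_wpDr. Qed.

Definition policy_reward pi (s : S) : R := policy_cost c pi s + h (pi s).
Definition policy_value pi : S -> R := policy_eval c gamma h P pi.

Lemma policy_reward_bound pi s : is_policy pi -> 0 <= policy_reward pi s <= H.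
Proof.
move=> pip; have /andP[h0 h1] := h_bound (pip s).
have cs0 : 0 <= policy_cost c pi s.
  by apply: dotp_ge => // a; case/andP: (c_bound s a).
have cs1 : policy_cost c pi s <= 1.
  by apply: dotp_le => // a; case/andP: (c_bound s a).
by rewrite /policy_reward addr_ge0 // lerD.
Qed.

Lemma policy_evalE Q pi s : is_kernel Q -> is_policy pi ->
  policy_eval c gamma h Q pi s = policy_reward pi s +
    gamma * dotp (policy_kernel Q pi s) (policy_eval c gamma h Q pi).
Proof.
move=> Qk pip; apply: (resolventE gamma_bound (policy_reward pi)).
by move=> t; apply: policy_kernel_subprob.
Qed.

Lemma policy_eval_bound Q pi s : is_kernel Q -> is_policy pi ->
  0 <= policy_eval c gamma h Q pi s <= H / (1 - gamma).
Proof.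
move=> Qk pip; apply: (@value_bound _ _ _ Q gamma H pi (policy_reward pi)) => //.
  by move=> t; apply: policy_reward_bound.
by move=> t; apply: policy_evalE.
Qed.

Variable pistar : S -> A -> R.
Hypothesis pistar_policy : is_policy pistar.
Hypothesis pistar_opt : forall pi, is_policy pi ->
  forall s, policy_value pistar s <= policy_value pi s.

(** Dividing by [D0] makes the initial potential at most [1 / (1 - gamma)] and leaves only the ratio
    of stepsize to [D0], later [ee], in the estimates. *)
Definition mirror_potential (D0 : R) (tpi : S -> A -> R) : S -> R :=
  resolvent gamma (policy_kernel P pistar)
    (fun s => bregman_policy omega grad tpi pistar s / D0).

Variables (eta : nat -> R) (P0 : S -> A -> S -> R) (Ph : nat -> S -> A -> S -> R).
Variables (V0 : S -> R) (pi0 tpi0 : S -> A -> R) (T : nat).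
Hypotheses (pi0_policy : is_policy pi0) (tpi0_policy : is_policy tpi0).

Let it t := svmd_inner c gamma h omega grad eta P0 Ph (Iterate V0 pi0 tpi0) t.
Let V t := it_V (it t).
Let PV t s a : R := if t == 0%N then kernel_app P0 V0 s a
  else kernel_app P0 V0 s a + kernel_app (Ph t) (V t - V0) s a.
Let q t s a : R := c s a + gamma * PV t s a.
Let tpi t := it_tpi (it t).
Let pi t := it_pi (it t).
Let tV t s := dotp (q t s) (tpi t.+1 s) + h (tpi t.+1 s).

Let V_step t s : V t.+1 s = Num.min (tV t s) (V t s).
Proof. by []. Qed.

Let pi_step t s : pi t.+1 s = if V t.+1 s == tV t s then tpi t.+1 s else pi t s.
Proof. by []. Qed.

Let tpi_policy t : is_policy (tpi t).
Proof.
case: t => [|t] s //.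
by case: (argmin_mirror_objective omega_C1 h_cont (eta t) (q t s) (tpi t s) A_gt0).
Qed.

Let pi_policy t : is_policy (pi t).
Proof.
elim: t => [|t IH] //= s; rewrite pi_step.
by case: ifP => _; [exact: tpi_policy|exact: IH].
Qed.

Lemma inner_tpi_policy t : is_policy (it_tpi (svmd_inner c gamma h omega grad
  eta P0 Ph (Iterate V0 pi0 tpi0) t)).
Proof. exact: tpi_policy. Qed.

Lemma inner_pi_policy t : is_policy (it_pi (svmd_inner c gamma h omega grad
  eta P0 Ph (Iterate V0 pi0 tpi0) t)).
Proof. exact: pi_policy. Qed.

(** At each state the current policy is either the initial one or some mirror iterate; this carries
    Bregman bounds from the iterates to the output. *)
Lemma inner_pi_tpi t s (Q : (A -> R) -> Prop) : Q (pi0 s) ->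
  (forall t', (t' <= t)%N -> Q (it_tpi (svmd_inner c gamma h omega grad
  eta P0 Ph (Iterate V0 pi0 tpi0) t') s)) ->
  Q (it_pi (svmd_inner c gamma h omega grad eta P0 Ph (Iterate V0 pi0 tpi0) t) s).
Proof.
move=> Q0; elim: t => [|t IH] Qt //.
have := pi_step t s; rewrite /pi /it => ->; case: ifP => _; first exact: Qt.
by apply: IH => t' t't; apply: Qt; apply: leqW.
Qed.

Let V_nonincr t t' s : (t <= t')%N -> V t' s <= V t s.
Proof.
move=> /subnK <-; elim: (t' - t)%N => [|n IH] //=.
by rewrite addSn; apply: le_trans IH; rewrite V_step ge_min lexx orbT.
Qed.

Lemma inner_V_le t s : it_V (svmd_inner c gamma h omega grad eta P0 Ph
  (Iterate V0 pi0 tpi0) t) s <= V0 s.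
Proof. exact: (V_nonincr s (leq0n t)). Qed.

(** [u] is the gap allowed at the start of the epoch and [nu] the noise level; [alpha] and [c1]
    govern the error of [P0] on [V0], and [b2] is the relative error of the fresh kernels on
    [V t - V0]. The slack in [101 / 100 * u] pays for evaluating the initial policy under [P0]. *)
Variables (u nu alpha c1 b2 : R).
Let kap := Num.min u 1.
Hypotheses (u_gt0 : 0 < u) (nu_gt0 : 0 < nu) (nu_le1 : nu <= 1).
Hypotheses (alpha_ge0 : 0 <= alpha) (c1_ge0 : 0 <= c1) (b2_ge0 : 0 <= b2).
Hypothesis alpha_Z :
  alpha * (H / (1 - gamma) / Num.sqrt (1 - gamma)) <= kap * nu / 353.
Hypothesis alpha_le : alpha <= (1 - gamma) * (kap * nu / 353).
Hypothesis c1_le : c1 <= (1 - gamma) * (kap * nu / 10000).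
Hypothesis b2_le : b2 <= (1 - gamma) * (nu / 139).

Let dev0 s a : R := `|kernel_app P0 V0 s a - kernel_app P V0 s a|.

Hypothesis dev0_le : forall s a, dev0 s a <= 2 * alpha * fsd (P s a) V0 + c1.
Hypothesis V0_le : forall s, V0 s <= policy_value pistar s + 101 / 100 * u.
Hypothesis V0_super : forall s, policy_reward pi0 s +
  gamma * dotp (policy_kernel P pi0 s) V0 - gamma * dotp (pi0 s) (dev0 s) <= V0 s.
Hypothesis Ph_dev : forall t s a, (0 < t < T)%N ->
  `|kernel_app (Ph t) (V t - V0) s a - kernel_app P (V t - V0) s a| <=
  b2 * supnorm (V t - V0).

(** [11 / 10 * u] bounds the sup norm of [V t - V0], since [101 / 100 + 1 / 40 < 11 / 10]. *)
Let err s a : R := gamma * (dev0 s a + 11 / 10 * u * b2).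

Let kap_u : kap <= u. Proof. by rewrite ge_min lexx. Qed.
Let kap_1 : kap <= 1. Proof. by rewrite ge_min lexx orbT. Qed.
Let kap_gt0 : 0 < kap. Proof. by rewrite lt_min u_gt0 ltr01. Qed.

(** The standard deviation of [V0] exceeds that of the value of [pi1] by at most half the range of
    their difference, and [sd_subsolution_le] handles the latter. The coefficient of [u * nu] is
    [301 / 100 / 353 + 1 / 10000 + 11 / 10 / 139], which is below [1 / 60]. *)
Let err_subsolution pi1 (del : R) (d : S -> R) : is_policy pi1 -> 0 <= del ->
  (forall s, - del <= V0 s - policy_value pi1 s <= 101 / 100 * u) ->
  (forall s, d s <= gamma * dotp (policy_kernel P pi1 s) d + dotp (pi1 s) (err s)) ->
  forall s, d s <= u * nu / 60 + del * nu / 353.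
Proof.
move=> pip del0 Vd dP s.
have [u0' nu0' g0' g1'] := And4 u_gt0 nu_gt0 g0 g1.
set b := alpha * (101 / 100 * u + del) + c1 + 11 / 10 * u * b2.
have w0 : 0 <= 101 / 100 * u + del by lra.
have u0 : 0 <= 11 / 10 * u by lra.
have b0 : 0 <= b.
  have := c1_ge0; have := mulr_ge0 alpha_ge0 w0; have := mulr_ge0 u0 b2_ge0.
  by rewrite /b; lra.
have sdle s' a : fsd (P s' a) V0 <= fsd (P s' a) (policy_value pi1) + (101 / 100 * u + del) / 2.
  have -> : V0 = (fun t => policy_value pi1 t + (V0 t - policy_value pi1 t)).
    by apply/funext => t; rewrite addrC subrK.
  apply: (le_trans (fsdD _ _ _)) => //; rewrite lerD2l.
  apply: le_trans (_ : (101 / 100 * u - - del) / 2 <= _).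
    by apply: fsd_range.
  by rewrite opprK.
apply: (le_trans (@sd_subsolution_le _ _ _ P gamma H pi1 (policy_reward pi1)
  (policy_value pi1) P_kernel pip gamma_bound H_gt0 (fun s => policy_reward_bound s pip)
  (fun s => policy_evalE s P_kernel pip) d (2 * alpha) b _ b0 _ s)).
- by rewrite mulr_ge0.
- move=> s'; apply: (le_trans (dP s')); rewrite -addrA lerD2l.
  rewrite -!dotpZ -(dotp_cst b (pip s')) -dotpD.
  apply: le_dotp => [|a]; first by case: (pip s').
  rewrite /err.
  have h1 : dev0 s' a + 11 / 10 * u * b2 <=
      2 * alpha * fsd (P s' a) (policy_value pi1) + b.
    apply: (@le_trans _ _ (2 * alpha * fsd (P s' a) V0 + c1 + 11 / 10 * u * b2)).
      by rewrite lerD2r.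
    have := ler_wpM2l alpha_ge0 (sdle s' a); rewrite /b; lra.
  have := ler_wpM2l (ltW g0) h1.
  have : gamma * b <= b by rewrite ler_piMl //; lra.
  lra.
- have -> : b / (1 - gamma) = alpha / (1 - gamma) * (101 / 100 * u + del)
      + c1 / (1 - gamma) + 11 / 10 * u * (b2 / (1 - gamma)).
    by rewrite /b; field; rewrite gt_eqF.
  have a1 : alpha / (1 - gamma) <= kap * nu / 353 by rewrite ler_pdivrMr // mulrC.
  have a2 : c1 / (1 - gamma) <= kap * nu / 10000 by rewrite ler_pdivrMr // mulrC.
  have a3 : b2 / (1 - gamma) <= nu / 139 by rewrite ler_pdivrMr // mulrC.
  have k1 : kap * nu <= u * nu by rewrite ler_pM2r.
  have k2 : kap * nu <= nu by rewrite ler_piMl // ltW.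
  have a1' : alpha / (1 - gamma) <= nu / 353 by lra.
  have := ler_wpM2r w0 a1'.
  have := ler_wpM2l u0 a3.
  have un0 : 0 < u * nu by rewrite mulr_gt0.
  move: alpha_Z; lra.
Qed.

Let almost_super t := forall s, policy_reward (pi t) s +
  gamma * dotp (policy_kernel P (pi t) s) (V t) - dotp (pi t s) (err s) <= V t s.

(** With [m] a maximizer of the difference [d], monotonicity gives [V0 >= V t >= V^pi - d m]. So
    [err_subsolution] applies with [del = d m], and the resulting [d m * nu / 353] is absorbed on
    the left. *)
Let almost_upper t : almost_super t ->
  forall s, policy_value (pi t) s - V t s <= u * nu / 40.
Proof.
move=> sup; pose d s := policy_value (pi t) s - V t s; rewrite -/(d _).
have [u0' nu0' g0' g1'] := And4 u_gt0 nu_gt0 g0 g1.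
have dP s : d s <= gamma * dotp (policy_kernel P (pi t) s) d + dotp (pi t s) (err s).
  rewrite (dotpB _ (policy_value (pi t)) (V t)) /d {1}/policy_value policy_evalE //.
  by have := sup s; rewrite /policy_value; lra.
move=> s; have [m _ dm] := @arg_maxP _ _ S s xpredT d isT.
apply: (le_trans (dm s isT)).
have un0 : 0 < u * nu by rewrite mulr_gt0.
have [d0|d0] := leP (d m) 0; first by apply: (le_trans d0); lra.
have : d m <= u * nu / 60 + d m * nu / 353.
  apply: (err_subsolution (pi_policy t) (ltW d0) _ dP) => s'; apply/andP; split.
    have := dm s' isT; rewrite /d; have := V_nonincr s' (leq0n t); rewrite /(V 0) /=; lra.
  have := V0_le s'; have := pistar_opt (pi_policy t) s'; lra.
have : d m * nu <= d m by rewrite ler_piMr // ltW.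
lra.
Qed.

Let V_ge t : almost_super t -> forall s, policy_value pistar s - u * nu / 40 <= V t s.
Proof.
move=> sup s; have := almost_upper sup s; have := pistar_opt (pi_policy t) s; lra.
Qed.

Let PV_err t s a : (t < T)%N -> almost_super t ->
  gamma * `|PV t s a - kernel_app P (V t) s a| <= err s a.
Proof.
have [u0' nu0' g0' g1'] := And4 u_gt0 nu_gt0 g0 g1.
move=> tT sup; rewrite /err ler_pM2l //.
have nu_u : u * nu <= u by rewrite ler_piMr // ltW.
have ub0 : 0 <= 11 / 10 * u * b2 by rewrite mulr_ge0 //; lra.
rewrite /PV; case: eqP => [->|/eqP t0]; first by rewrite lerDl.
have -> : kernel_app P (V t) s a = kernel_app P V0 s a + kernel_app P (V t - V0) s a.
  by rewrite /kernel_app (dotpB (P s a) (V t) V0) addrC subrK.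
rewrite opprD addrACA; apply: (le_trans (ler_normD _ _)); rewrite lerD2l.
apply: (le_trans (Ph_dev s a _)); first by rewrite lt0n t0.
rewrite mulrC ler_wpM2r //; apply: supnorm_le => [|s']; first by lra.
have -> : (V t - V0) s' = V t s' - V0 s' by [].
rewrite ler_norml; have := V_nonincr s' (leq0n t); have := V_ge sup s'.
have := V0_le s'; rewrite /(V 0) /=; lra.
Qed.

Let PV_bound t s a : (t < T)%N -> almost_super t ->
  gamma * kernel_app P (V t) s a - err s a <= gamma * PV t s a <=
  gamma * kernel_app P (V t) s a + err s a.
Proof.
move=> tT sup; have := PV_err s a tT sup.
by rewrite -[X in X * `|_|](gtr0_norm g0) -normrM mulrBr ler_norml; lra.
Qed.

(** The induction is forced: the error of step [t] is controlled only through the lower bound [V_ge]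
    on [V t], which itself needs [almost_super t]. *)
Let super_all t : (t <= T)%N -> almost_super t.
Proof.
have [u0' nu0' g0' g1'] := And4 u_gt0 nu_gt0 g0 g1.
elim: t => [_ s|t IH tT s].
  apply: le_trans (V0_super s); rewrite lerD2l lerN2 -dotpZ.
  apply: le_dotp => [|a]; first by case: (pi0_policy s).
  rewrite /err ler_pM2l // lerDl mulr_ge0 //; lra.
have sup := IH (ltnW tT).
have Vmon s' : V t.+1 s' <= V t s' by apply: V_nonincr.
have [eqtV|netV] := eqVneq (V t.+1 s) (tV t s).
  have piE : pi t.+1 s = tpi t.+1 s by rewrite pi_step eqtV eqxx.
  rewrite eqtV dotp_policy_kernel /policy_reward /policy_cost piE /tV (dotpC (q t s)).
  set x := tpi t.+1 s; have xs : simplex x by apply: tpi_policy.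
  suff : dotp x (fun a => c s a + gamma * kernel_app P (V t.+1) s a - err s a) <=
      dotp x (q t s).
    by rewrite (dotpB x (fun a => _ + _)) dotpD dotpZ; lra.
  apply: le_dotp => [|a]; first by case: xs.
  have /andP[lo _] := PV_bound s a tT sup.
  (* The update was computed from [V t]; since the values decrease, it also dominates the backup of
     [V t.+1]. *)
  have : kernel_app P (V t.+1) s a <= kernel_app P (V t) s a.
    by apply: le_dotp => //; case: (P_kernel s a).
  by move=> /(ler_wpM2l (ltW g0)); rewrite /q; lra.
have piE : pi t.+1 s = pi t s by rewrite pi_step (negPf netV).
have VE : V t.+1 s = V t s.
  by move: netV; rewrite V_step; case: leP => //; rewrite eqxx.
rewrite VE; apply: le_trans (sup s).
rewrite !dotp_policy_kernel /policy_reward /policy_cost piE lerD2r lerD2l.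
rewrite ler_pM2l //; apply: le_dotp => [|a]; first by case: (pi_policy t s).
by apply: le_dotp => //; case: (P_kernel s a).
Qed.

Let Vs := policy_value pistar.
Let Qst s : subprob (policy_kernel P pistar s).
Proof. exact: policy_kernel_subprob. Qed.
Let G := resolvent gamma (policy_kernel P pistar).

(** The source of the telescoping: under [G], one discounted step of [pistar] costs exactly
    [v s]. *)
Let G_drift v s : G (fun t => gamma * dotp (policy_kernel P pistar t) v) s = G v s - v s.
Proof.
apply/esym; move: s; apply: (resolvent_uniq gamma_bound Qst) => s.
by rewrite dotpB {1}/G resolventE //; rewrite -/G; ring.
Qed.

Variables (N : (A -> R) -> R) (D0 ee : R).
Hypothesis omega_sc : strongly_convex1 N omega.
Hypotheses (ee_gt0 : 0 < ee) (D0_ge0 : 0 <= D0).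
Hypothesis D0_eq0 : D0 = 0 -> forall x y : A -> R, simplex x -> simplex y -> x = y.
Hypothesis eta_eq : forall t, (t < T)%N -> eta t = ee * D0.

(* When [D0 = 0] the simplex is a point and the junk value [x / 0 = 0] is the
   right one. *)
Let dd t s := bregman_policy omega grad (tpi t) pistar s / D0.

Let dd_ge0 t s : 0 <= dd t s.
Proof.
rewrite /dd divr_ge0 // /bregman_policy.
by apply: (bregman_ge0 omega_C1 omega_sc); [exact: tpi_policy|exact: pistar_policy].
Qed.

Let dd_step t s : (t < T)%N ->
  tV t s + dd t.+1 s / ee <=
  dotp (q t s) (pistar s) + h (pistar s) + dd t s / ee.
Proof.
move=> tT; have [D00|D0n0] := eqVneq D0 0.
  by rewrite /dd D00 invr0 !mulr0 /tV (D0_eq0 D00 (tpi_policy t.+1 s) (pistar_policy s)).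
have D0p : 0 < D0 by rewrite lt_def D0n0.
have eta0 : 0 < eta t by rewrite eta_eq // mulr_gt0.
have [xs xmin] := argmin_mirror_objective omega_C1 h_cont (eta t) (q t s) (tpi t s) A_gt0.
have := three_point omega_C1 h_convex (ltW eta0) xs (pistar_policy s) xmin.
rewrite /mirror_objective -/(tpi t.+1 s) => le.
have : eta t * tV t s + bregman omega grad (tpi t.+1 s) (pistar s) <=
    eta t * (dotp (q t s) (pistar s) + h (pistar s)) + bregman omega grad (tpi t s) (pistar s).
  (* The divergence between consecutive iterates, present in the minimized objective, is nonnegative
     and dropped. *)
  have := bregman_ge0 omega_C1 omega_sc (tpi_policy t s) xs.
  by rewrite /tV; move: le; rewrite /tpi /it /=; lra.
rewrite /dd /bregman_policy -/(tV t s).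
move: (bregman _ _ _ _) (bregman _ _ (tpi t s) _) (tV t s) => x1 x2 y1.
rewrite eta_eq // in eta0 *; set y2 := dotp _ _ + _ => le'.
rewrite -(ler_pM2l eta0) [leLHS]mulrDr [leRHS]mulrDr.
have e1 x : ee * D0 * (x / D0 / ee) = x by field; rewrite !gt_eqF.
rewrite !e1; exact: le'.
Qed.

(** [G] of the error satisfies the recursion of [err_subsolution] with equality, and [V0] is at most
    [u * nu / 40] below the optimal value. *)
Let Gerr_le s : G (fun s => dotp (pistar s) (err s)) s <= u * nu / 40.
Proof.
have [u0' nu0' g0' g1'] := And4 u_gt0 nu_gt0 g0 g1.
have un0 : 0 < u * nu by rewrite mulr_gt0.
have unu : u * nu * nu <= u * nu by rewrite ler_piMr // ltW.
have del0 : 0 <= u * nu / 40 by lra.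
apply: le_trans (err_subsolution pistar_policy del0 _ _ s) _; last by lra.
- move=> s'; have := V_ge (super_all (leq0n T)) s'; have := V0_le s'.
  by rewrite /(V 0) /=; lra.
- by move=> s'; rewrite {1}/G resolventE // addrC.
Qed.

Let pot t s := G (fun s => V t s - Vs s) s + G (dd t) s / ee.

Let pot_step t s : (t < T)%N -> pot t.+1 s <= pot t s - (V t s - Vs s) + u * nu / 40.
Proof.
move=> tT; have g0' := g0.
have VsE s' : Vs s' = policy_reward pistar s' + gamma * dotp (policy_kernel P pistar s') Vs.
  exact: policy_evalE.
have step s' : V t.+1 s' - Vs s' + ee^-1 * dd t.+1 s' <=
    gamma * dotp (policy_kernel P pistar s') (fun s => V t s - Vs s) +
    (ee^-1 * dd t s' + dotp (pistar s') (err s')).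
  have h1 := dd_step s' tT.
  have h2 : V t.+1 s' <= tV t s' by rewrite V_step ge_min lexx.
  have h3 : dotp (pistar s') (q t s') <= dotp (pistar s')
      (fun a => c s' a + gamma * kernel_app P (V t) s' a + err s' a).
    apply: le_dotp => [|a]; first by case: (pistar_policy s').
    have /andP[_ up] := PV_bound s' a tT (super_all (ltnW tT)).
    by rewrite /q; lra.
  rewrite (dotpD _ (fun a => _ + _)) dotpD dotpZ in h3.
  rewrite dotpB mulrBr {1}VsE !dotp_policy_kernel.
  rewrite (dotpC (q t s')) in h1; rewrite /policy_reward /policy_cost.
  rewrite ![ee^-1 * _]mulrC; lra.
have := ler_resolvent gamma_bound Qst step s.
rewrite (resolventD gamma_bound Qst (fun s => V t.+1 s - Vs s)).
rewrite (resolventD gamma_bound Qst (fun s' => gamma * dotp (policy_kernel P pistar s') _)).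
rewrite (resolventD gamma_bound Qst (fun s' => ee^-1 * dd t s')).
rewrite !(resolventZ gamma_bound Qst ee^-1) -/G.
have := G_drift (fun s => V t s - Vs s) s; cbv beta => ->; rewrite /pot.
by have := Gerr_le s; rewrite ![ee^-1 * _]mulrC; lra.
Qed.

Let pot_sum t s : (t <= T)%N ->
  pot t s + \sum_(i < t) (V i s - Vs s) <= pot 0 s + t%:R * (u * nu / 40).
Proof.
elim: t => [_|t IH tT]; first by rewrite big_ord0 addr0 mul0r addr0.
rewrite big_ord_recr /=; have := IH (ltnW tT); have := pot_step s tT.
by rewrite -natr1; lra.
Qed.

Let pot0_le s : pot 0 s <= 101 / 100 * u / (1 - gamma) + G (dd 0) s / ee.
Proof.
have u0' := u_gt0.
rewrite lerD2r; apply: (resolvent_cst_le gamma_bound Qst) => [|t]; first by lra.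
by rewrite /(V 0) /=; have := V0_le t; rewrite /Vs; lra.
Qed.

Let pot_ge t s : (t <= T)%N -> - (u * nu / 40 / (1 - gamma)) + G (dd t) s / ee <= pot t s.
Proof.
move=> tT; have un0 : 0 < u * nu by rewrite mulr_gt0.
rewrite lerD2r; apply: (resolvent_ge gamma_bound Qst) => [|s']; first by lra.
by have := V_ge (super_all tT) s'; rewrite /Vs; lra.
Qed.

(** [207 / 200] is [101 / 100 + 1 / 40], from the two ends of the telescoping sum. The noise rate
    [1 / 20] is twice [1 / 40]: once for the error of each step, once because each [V i] may lie
    below the optimal value by that much. *)
Lemma epoch_potential t s : (t <= T)%N ->
  mirror_potential D0 (it_tpi (svmd_inner c gamma h omega grad eta P0 Ph
    (Iterate V0 pi0 tpi0) t)) s <=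
  mirror_potential D0 tpi0 s +
  ee * (207 / 200 * u / (1 - gamma) + t%:R * (u * nu / 20)).
Proof.
move=> tT; rewrite /mirror_potential -/(dd t) -/(dd 0) -/G.
have un1 : u * nu <= u by rewrite ler_piMr // ltW.
have : - (t%:R * (u * nu / 40)) <= \sum_(i < t) (V i s - Vs s).
  rewrite mulr_natl -mulNrn -[t in X in X <= _]card_ord -sumr_const.
  apply: ler_sum => i _; have := V_ge (super_all (leq_trans (ltnW (ltn_ord i)) tT)) s.
  by rewrite /Vs; lra.
have := pot_sum s tT; have := pot0_le s; have := pot_ge s tT.
have g1' : 0 < (1 - gamma)^-1 by rewrite invr_gt0.
have := ler_wpM2r (ltW g1') un1.
move=> h1 h2 h3 h4 h5.
have : G (dd t) s / ee <= G (dd 0) s / ee + (207 / 200 * u / (1 - gamma) + t%:R * (u * nu / 20)).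
  lra.
rewrite -(ler_pM2r ee_gt0) mulrDl !divfK ?gt_eqF //.
by rewrite [_ * ee]mulrC.
Qed.

(** Telescoping bounds the average of the gaps; because the minimum in the update makes [V]
    nonincreasing, the last gap is at most the average. *)
Lemma epoch_gap_le s : (0 < T)%N ->
  policy_value (it_pi (svmd_inner c gamma h omega grad eta P0 Ph
    (Iterate V0 pi0 tpi0) T)) s - policy_value pistar s <=
  (207 / 200 * u / (1 - gamma) + mirror_potential D0 tpi0 s / ee) / T%:R + u * nu / 20.
Proof.
move=> T0; rewrite /mirror_potential -/(dd 0) -/G -/(pi T) -/Vs.
have T0' : 0 < T%:R :> R by rewrite ltr0n.
have un1 : u * nu <= u by rewrite ler_piMr // ltW.
have h0 : T%:R * (V T s - Vs s) <= \sum_(i < T) (V i s - Vs s).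
  have -> : T%:R * (V T s - Vs s) = \sum_(i < T) (V T s - Vs s).
    by rewrite sumr_const card_ord mulr_natl.
  by apply: ler_sum => i _; rewrite lerD2r; apply/V_nonincr/ltnW.
have h1 := almost_upper (super_all (leqnn T)) s.
have := pot_sum s (leqnn T); have := pot0_le s; have := pot_ge s (leqnn T).
have g1' : 0 < (1 - gamma)^-1 by rewrite invr_gt0.
have := ler_wpM2r (ltW g1') un1.
have : 0 <= G (dd T) s / ee.
  rewrite divr_ge0 ?(ltW ee_gt0) //.
  by apply: (resolvent_ge0 gamma_bound Qst) => t; exact: dd_ge0.
move=> h2 h3 h4 h5 h6.
have : V T s - Vs s <= (207 / 200 * u / (1 - gamma) + G (dd 0) s / ee) / T%:R + u * nu / 40.
  rewrite -(ler_pM2l T0') [leRHS]mulrDr [_ * (_ / T%:R)]mulrC divfK ?gt_eqF //; lra.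
lra.
Qed.

End Epoch.

(** * Accuracy of the empirical value of a policy *)

Section EmpiricalValue.
Context {R : realType} {S A : finType}.
Variables (P P0 : S -> A -> S -> R) (c : S -> A -> R) (gamma hbar : R).
Variables (h : (A -> R) -> R) (pi : S -> A -> R).
Hypotheses (P_kernel : is_kernel P) (P0_kernel : is_kernel P0).
Hypothesis c_bound : forall s a, 0 <= c s a <= 1.
Hypothesis gamma_bound : 0 < gamma < 1.
Hypothesis h_bound : forall x, simplex x -> 0 <= h x <= hbar.
Hypotheses (hbar_ge0 : 0 <= hbar) (pi_policy : is_policy pi).

Let H : R := 1 + hbar.
Let U := policy_value P c gamma h pi.
Let V0 := policy_eval c gamma h P0 pi.

Definition absorbed_kernel (Q : S -> A -> S -> R) (s s' s'' : S) : R :=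
  if s' == s then 0 else policy_kernel Q pi s' s''.

(* The value of [pi] under [Q] when the process stops on reaching [s], with
   terminal value [U s], and the discounted probability of reaching [s]. Neither
   depends on the rows of [Q] at [s]. *)
Definition absorbed_value (Q : S -> A -> S -> R) (s : S) : S -> R :=
  resolvent gamma (absorbed_kernel Q s)
    (fun s' => if s' == s then policy_value P c gamma h pi s
               else policy_reward c h pi s').

Definition hitting_weight (Q : S -> A -> S -> R) (s : S) : S -> R :=
  resolvent gamma (absorbed_kernel Q s) (fun s' => (s' == s)%:R).

Lemma absorbed_subprob Q s s' : is_kernel Q -> subprob (absorbed_kernel Q s s').
Proof.
move=> Qk; rewrite /absorbed_kernel /subprob; case: eqP => _.
  by split => //; rewrite big1.
exact: policy_kernel_subprob.
Qed.

Lemma absorbed_value_bound Q s s' : is_kernel Q ->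
  0 <= absorbed_value Q s s' <= H / (1 - gamma).
Proof.
move=> Qk; have Qs t := absorbed_subprob s t Qk.
have g1 : 0 < 1 - gamma by rewrite subr_gt0; case/andP: gamma_bound.
have g0 : 0 <= gamma by case/andP: gamma_bound => /ltW.
have H0 : 0 <= H / (1 - gamma) by rewrite divr_ge0 ?ltW // ltr_wpDr.
have UB t : 0 <= U t <= H / (1 - gamma) by apply: policy_eval_bound.
have rB t := policy_reward_bound c_bound h_bound t pi_policy.
apply/andP; split.
  apply: (resolvent_ge0 gamma_bound Qs) => t; case: ifP => _.
    by case/andP: (UB s).
  by case/andP: (rB t).
move: s'; apply: (resolvent_le gamma_bound Qs) => t.
rewrite /absorbed_kernel; case: ifP => _.
  rewrite (_ : dotp _ _ = 0) ?mulr0 ?addr0; first by case/andP: (UB s).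
  by rewrite /dotp big1 // => a _; rewrite mul0r.
rewrite (dotp_cst _ (policy_kernel_simplex Qk (pi_policy t))).
rewrite [leRHS](_ : _ = H + gamma * (H / (1 - gamma))); last first.
  by field; rewrite gt_eqF.
by rewrite lerD2r; case/andP: (rB t).
Qed.

Lemma hitting_weight_bound Q s s' : is_kernel Q -> 0 <= hitting_weight Q s s' <= 1.
Proof.
move=> Qk; have Qs t := absorbed_subprob s t Qk.
have g0 : 0 <= gamma by case/andP: gamma_bound => /ltW.
have g1 : gamma <= 1 by case/andP: gamma_bound => _ /ltW.
apply/andP; split.
  by apply: (resolvent_ge0 gamma_bound Qs) => t; rewrite ler0n.
move: s'; apply: (resolvent_le gamma_bound Qs) => t.
rewrite /absorbed_kernel; case: (t == s).
  by rewrite /dotp big1 ?mulr0 ?addr0 // => a _; rewrite mul0r.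
by rewrite (dotp_cst _ (policy_kernel_simplex Qk (pi_policy t))) add0r mulr1.
Qed.

Let V0E s : V0 s = policy_reward c h pi s + gamma * dotp (policy_kernel P0 pi s) V0.
Proof. exact: policy_evalE. Qed.

(** [V0] solves the equation stopped at [s] with terminal value [V0 s], and the resolvent is linear
    in the terminal value. *)
Lemma absorbed_decomposition s s' : policy_eval c gamma h P0 pi s' =
  absorbed_value P0 s s' +
  (policy_eval c gamma h P0 pi s - policy_value P c gamma h pi s) * hitting_weight P0 s s'.
Proof.
have Qs t := absorbed_subprob s t P0_kernel.
transitivity (resolvent gamma (absorbed_kernel P0 s)
    (fun t => (if t == s then U s else policy_reward c h pi t) +
      (V0 s - U s) * (t == s)%:R) s'); last first.
  rewrite (resolventD gamma_bound Qs (fun t => if t == s then U s else policy_reward c h pi t)).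
  by rewrite (resolventZ gamma_bound Qs).
move: s'; apply: (resolvent_uniq gamma_bound Qs) => t.
rewrite /absorbed_kernel; case: eqP => [->|_]; last by rewrite mulr0 addr0.
rewrite (_ : dotp _ V0 = 0) ?mulr0 ?addr0; first by rewrite -/U mulr1 addrC subrK.
by rewrite /dotp big1 // => a _; rewrite mul0r.
Qed.

Variables (kap nu alpha : R).
Hypotheses (kap_gt0 : 0 < kap) (kap_le1 : kap <= 1).
Hypotheses (nu_gt0 : 0 < nu) (nu_le1 : nu <= 1) (alpha_ge0 : 0 <= alpha).
Hypothesis alpha_le : alpha * H <= Num.sqrt (1 - gamma) ^+ 3 * (kap * nu / 353).

Let z := Num.sqrt (1 - gamma).
Let g1 : 0 < 1 - gamma. Proof. by rewrite subr_gt0; case/andP: gamma_bound. Qed.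
Let z_gt0 : 0 < z. Proof. by rewrite sqrtr_gt0. Qed.
Let z_sqr : z ^+ 2 = 1 - gamma. Proof. by rewrite sqr_sqrtr // ltW. Qed.
Let z_le1 : z <= 1.
Proof.
have z0 := ltW z_gt0; rewrite -(ler_pXn2r (n := 2)) ?nnegrE // z_sqr expr1n.
by rewrite gerBl; case/andP: gamma_bound => /ltW.
Qed.
Let H_ge1 : 1 <= H. Proof. by rewrite lerDl. Qed.
Let kn_gt0 : 0 < kap * nu. Proof. exact: mulr_gt0. Qed.
Let kn_le1 : kap * nu <= 1.
Proof. by apply: (le_trans (ler_wpM2l (ltW kap_gt0) nu_le1)); rewrite mulr1. Qed.

Lemma accuracy_param_Z :
  alpha * (H / (1 - gamma) / Num.sqrt (1 - gamma)) <= kap * nu / 353.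
Proof.
rewrite -/z !mulrA ler_pdivrMr // ler_pdivrMr // -z_sqr.
by apply: (le_trans alpha_le); rewrite -/z le_eqVlt; apply/orP; left; apply/eqP; ring.
Qed.

Lemma accuracy_param_le : alpha <= (1 - gamma) * (kap * nu / 353).
Proof.
have h1 : alpha <= alpha * H by rewrite ler_peMr.
apply: (le_trans h1); apply: (le_trans alpha_le); rewrite -/z -z_sqr.
apply: ler_wpM2r; first by have := kn_gt0; lra.
by rewrite exprS ler_piMl // exprn_ge0 // ltW.
Qed.

Let alpha_sqr : 2 * (H / (1 - gamma)) * alpha ^+ 2 <=
  (1 - gamma) * (2 * (kap * nu) / 353 / 353).
Proof.
have a1 : alpha <= z ^+ 2 * (kap * nu / 353) by rewrite z_sqr accuracy_param_le.
rewrite -z_sqr.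
have h1 : alpha * (alpha * H) <= (z ^+ 2 * (kap * nu / 353)) * (z ^+ 3 * (kap * nu / 353)).
  apply: ler_pM => //; rewrite mulr_ge0 //.
  exact: le_trans ler01 H_ge1.
have -> : 2 * (H / z ^+ 2) * alpha ^+ 2 = 2 / z ^+ 2 * (alpha * (alpha * H)).
  by field; rewrite gt_eqF.
have z2 : 0 <= 2 / z ^+ 2 by rewrite divr_ge0 // exprn_ge0 // ltW.
apply: (le_trans (ler_wpM2l z2 h1)).
have -> : 2 / z ^+ 2 * (z ^+ 2 * (kap * nu / 353) * (z ^+ 3 * (kap * nu / 353))) =
   (z ^+ 2 * (2 * (kap * nu) / 353 / 353)) * (z * (kap * nu)).
  by field; rewrite gt_eqF.
have kn0 : 0 <= 2 * (kap * nu) / 353 / 353 by have := kn_gt0; lra.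
apply: ler_piMr; first by apply: mulr_ge0 => //; exact: sqr_ge0.
by apply: mulr_ile1; rewrite ?(ltW z_gt0) ?(ltW kn_gt0).
Qed.

Let dev0 s a : R := `|kernel_app P0 V0 s a - kernel_app P V0 s a|.

Hypothesis absorbed_dev : forall s a,
  `|kernel_app P0 (absorbed_value P0 s) s a - kernel_app P (absorbed_value P0 s) s a|
  <= deviation (P s a) (absorbed_value P0 s) (H / (1 - gamma)) alpha.
Hypothesis hitting_dev : forall s a,
  `|kernel_app P0 (hitting_weight P0 s) s a - kernel_app P (hitting_weight P0 s) s a|
  <= deviation (P s a) (hitting_weight P0 s) 1 alpha.

Let e := supnorm (fun s => V0 s - U s).

(** Bernstein's bound for each of the two parts. A hitting weight lies in [0, 1], so its standard
    deviation is at most [1 / 2]; replacing [fsd w] by [fsd V0] therefore costs [e / 2], and the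
    weight part itself costs [e * (alpha + 2 * alpha ^+ 2)]. *)
Let dev0_le_e s a : dev0 s a <= 2 * alpha * fsd (P s a) V0 +
  (2 * (H / (1 - gamma)) * alpha ^+ 2 + e * (2 * alpha + 2 * alpha ^+ 2)).
Proof.
set w := absorbed_value P0 s; set psi := hitting_weight P0 s; set D := V0 s - U s.
have De : `|D| <= e by apply: (le_supnorm (fun s => V0 s - U s)).
have V0wD : V0 = (fun s' => w s' + D * psi s').
  by apply/funext => s'; apply: absorbed_decomposition.
have sdpsi : fsd (P s a) psi <= 1 / 2.
  have -> : 1 / 2 = (1 - 0) / 2 :> R by rewrite subr0.
  by apply: fsd_range => // s'; apply: hitting_weight_bound.
have sdw : fsd (P s a) w <= fsd (P s a) V0 + e / 2.
  have -> : w = (fun s' => V0 s' + - (D * psi s')).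
    by apply/funext => s'; rewrite V0wD addrK.
  apply: (le_trans (fsdD _ _ _)) => //; rewrite lerD2l fsdN.
  have [D0|D0] := leP 0 D.
    rewrite fsdZ //; move: De; rewrite ger0_norm // => De.
    have := ler_pM D0 (fsd_ge0 (P s a) psi) De sdpsi; lra.
  have -> : (fun s' => D * psi s') = (fun s' => - (- D * psi s')).
    by apply/funext => s'; rewrite mulNr opprK.
  rewrite fsdN fsdZ; last by rewrite oppr_ge0 ltW.
  move: De; rewrite ltr0_norm // => De.
  have D0' : 0 <= - D by rewrite oppr_ge0 ltW.
  have := ler_pM D0' (fsd_ge0 (P s a) psi) De sdpsi; lra.
rewrite /dev0 {1 2}V0wD /kernel_app !dotpD !dotpZ opprD addrACA -mulrBr.
apply: (le_trans (ler_normD _ _)); rewrite normrM.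
have h1 := absorbed_dev s a; rewrite /deviation -/w in h1.
have h2 := hitting_dev s a; rewrite /deviation -/psi in h2.
have h3 : 2 * fsd (P s a) psi * alpha + 2 * 1 * alpha ^+ 2 <= alpha + 2 * alpha ^+ 2.
  have := ler_wpM2r alpha_ge0 sdpsi; lra.
have h4 := ler_pM (normr_ge0 D) (normr_ge0 _) De (le_trans h2 h3).
have := ler_wpM2r alpha_ge0 sdw.
rewrite /kernel_app in h1 h4; lra.
Qed.

(** The recursion is written with the true kernel, for which the variance bound on [U] is available;
    [sg] is a sign, so both sides of the absolute value are covered. *)
Let fix_diff (sg : R) s : sg ^+ 2 = 1 ->
  sg * (V0 s - U s) <=
  gamma * dotp (policy_kernel P pi s) (fun s => sg * (V0 s - U s)) +
  dotp (pi s) (fun a => gamma * dev0 s a).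
Proof.
move=> sg1; have g0 : 0 <= gamma by case/andP: gamma_bound => /ltW.
have UE : U s = policy_reward c h pi s + gamma * dotp (policy_kernel P pi s) U.
  exact: policy_evalE.
rewrite dotpZ dotpB {1}V0E {1}UE !dotp_policy_kernel dotpZ.
have : sg * (dotp (pi s) (kernel_app P0 V0 s) - dotp (pi s) (kernel_app P V0 s))
    <= dotp (pi s) (dev0 s).
  apply: (le_trans (ler_norm _)); rewrite normrM.
  have -> : `|sg| = 1.
    apply/eqP; rewrite -(eqrXn2 (n := 2)) ?normr_ge0 ?ler01 //.
    by rewrite expr1n -normrX sg1 normr1.
  rewrite mul1r -dotpB; apply: ler_norm_dotp.
  by case: (pi_policy s).
by move=> /(ler_wpM2l g0); lra.
Qed.

(** Self-bounding: [e] reappears on the right with a coefficient at most [6 / 353], since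
    [alpha <= (1 - gamma) / 353], and is absorbed. *)
Let e_le : e <= kap * nu / 100.
Proof.
have [k' n' g1'] := And3 kap_gt0 nu_gt0 g1; have kn' := kn_gt0; have kn1 := kn_le1.
have [aZ al as2] := And3 accuracy_param_Z accuracy_param_le alpha_sqr.
have g0 : 0 <= gamma by case/andP: gamma_bound => /ltW.
have e0 : 0 <= e by apply: supnorm_ge0.
have H0 : 0 < H by apply: lt_le_trans ltr01 H_ge1.
set b := 2 * alpha * e + (2 * (H / (1 - gamma)) * alpha ^+ 2 + e * (2 * alpha + 2 * alpha ^+ 2)).
have b0 : 0 <= b.
  have a2 : 0 <= alpha ^+ 2 := sqr_ge0 _.
  have hB : 0 <= H / (1 - gamma) by rewrite divr_ge0 // ltW.
  have := mulr_ge0 alpha_ge0 e0; have := mulr_ge0 hB a2; have := mulr_ge0 e0 a2.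
  by rewrite /b; lra.
have sdV s a : fsd (P s a) V0 <= fsd (P s a) U + e.
  have -> : V0 = (fun t => U t + (V0 t - U t)) by apply/funext => t; rewrite addrC subrK.
  apply: (le_trans (fsdD _ _ _)) => //; rewrite lerD2l.
  apply: le_trans (_ : (e - - e) / 2 <= _); last by lra.
  apply: fsd_range => // s'; rewrite -ler_norml.
  exact: (le_supnorm (fun s => V0 s - U s)).
have devb s a : gamma * dev0 s a <= 2 * alpha * (gamma * fsd (P s a) U) + b.
  have h1 := dev0_le_e s a; have h2 := ler_wpM2l alpha_ge0 (sdV s a).
  have h3 : dev0 s a <= 2 * alpha * fsd (P s a) U + b by rewrite /b; lra.
  have := ler_wpM2l g0 h3.
  have : gamma * b <= b by rewrite ler_piMl //; lra.
  lra.
have bnd (sg : R) s : sg ^+ 2 = 1 -> sg * (V0 s - U s) <=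
    2 * (kap * nu / 353) + b / (1 - gamma).
  move=> sg1; pose d s := sg * (V0 s - U s); rewrite -/(d s).
  have a2 : 0 <= 2 * alpha by rewrite mulr_ge0.
  have dP s' : d s' <= gamma * dotp (policy_kernel P pi s') d
      + 2 * alpha * (gamma * dotp (pi s') (fun x => fsd (P s' x) U)) + b.
    apply: (le_trans (fix_diff s' sg1)); rewrite -addrA lerD2l.
    rewrite -!dotpZ -(dotp_cst b (pi_policy s')) -dotpD.
    by apply: le_dotp => [|a]; [case: (pi_policy s')|exact: devb].
  have := sd_subsolution_le P_kernel pi_policy gamma_bound H0
    (fun s => policy_reward_bound c_bound h_bound s pi_policy)
    (fun s => policy_evalE c h gamma_bound s P_kernel pi_policy) a2 b0 dP s.
  rewrite -/H; lra.
have : e <= 2 * (kap * nu / 353) + b / (1 - gamma).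
  apply: supnorm_le => [|s].
    by rewrite addr_ge0 ?divr_ge0 // ?mulr_ge0 ?ltW.
  rewrite ler_norml; have := bnd 1 s (expr1n _ _); have := bnd (-1) s.
  by rewrite sqrrN expr1n mul1r mulN1r => /(_ erefl); lra.
have al1 : alpha <= (1 - gamma) / 353 * (kap * nu) by lra.
have al2 : alpha / (1 - gamma) <= 1 / 353.
  rewrite ler_pdivrMr //; apply: (le_trans al).
  have := ler_wpM2l (ltW g1') kn1; lra.
have al3 : alpha <= 1.
  move: al2; rewrite ler_pdivrMr //; case/andP: gamma_bound => g0' _; lra.
have -> : b / (1 - gamma) = (alpha / (1 - gamma)) * (4 * e + e * (2 * alpha)) +
    (2 * (H / (1 - gamma)) * alpha ^+ 2) / (1 - gamma).
  by rewrite /b; field; rewrite gt_eqF.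
have : (2 * (H / (1 - gamma)) * alpha ^+ 2) / (1 - gamma) <= 2 * (kap * nu) / 353 / 353.
  by rewrite ler_pdivrMr // [leRHS]mulrC.
have ea : e * (2 * alpha) <= 2 * e by rewrite mulrCA ler_pM2l // ler_piMr.
have ea0 : 0 <= 4 * e + e * (2 * alpha) by rewrite addr_ge0 // !mulr_ge0.
have : alpha / (1 - gamma) * (4 * e + e * (2 * alpha)) <= 1 / 353 * (6 * e).
  apply: ler_pM => //; first by rewrite divr_ge0 // ltW.
  lra.
lra.
Qed.

Lemma empirical_value_close s :
  `|policy_eval c gamma h P0 pi s - policy_value P c gamma h pi s| <= kap * nu / 100.
Proof. exact: le_trans (le_supnorm (fun s => V0 s - U s) s) e_le. Qed.

Lemma empirical_value_dev s a :
  `|kernel_app P0 (policy_eval c gamma h P0 pi) s a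
    - kernel_app P (policy_eval c gamma h P0 pi) s a| <=
  2 * alpha * fsd (P s a) (policy_eval c gamma h P0 pi)
    + (1 - gamma) * (kap * nu / 10000).
Proof.
have g1' := g1; have kn' := kn_gt0; have kn1 := kn_le1.
apply: (le_trans (dev0_le_e s a)); rewrite lerD2l.
have al := accuracy_param_le; have as2 := alpha_sqr; have e1 := e_le.
have al3 : alpha <= 1 / 353.
  apply: (le_trans al); have : (1 - gamma) * (kap * nu / 353) <= 1 * (kap * nu / 353).
    by apply: ler_wpM2r; [lra|case/andP: gamma_bound => /ltW g0 _; lra].
  lra.
have h1 : 2 * alpha + 2 * alpha ^+ 2 <= (1 - gamma) * (5 / 2 / 353).
  have : alpha ^+ 2 <= alpha * (1 / 353) by rewrite expr2 ler_wpM2l.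
  have : (1 - gamma) * (kap * nu / 353) <= (1 - gamma) * (1 / 353).
    by rewrite ler_pM2l //; lra.
  lra.
have e0 : 0 <= e by apply: supnorm_ge0.
have a0 : 0 <= 2 * alpha + 2 * alpha ^+ 2 by rewrite addr_ge0 // mulr_ge0 // exprn_ge0.
have := ler_pM e0 a0 e1 h1.
have : 0 < (1 - gamma) * (kap * nu) by rewrite mulr_gt0.
lra.
Qed.

Lemma empirical_value_super s : policy_reward c h pi s +
  gamma * dotp (policy_kernel P pi s) (policy_eval c gamma h P0 pi) -
  gamma * dotp (pi s) (fun a => `|kernel_app P0 (policy_eval c gamma h P0 pi) s a
    - kernel_app P (policy_eval c gamma h P0 pi) s a|) <= policy_eval c gamma h P0 pi s.
Proof.
have g0 : 0 <= gamma by case/andP: gamma_bound => /ltW.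
rewrite -/V0 -/(dev0 _ _) [leRHS]V0E -addrA lerD2l -mulrBr ler_wpM2l // !dotp_policy_kernel.
rewrite lerBlDr -lerBlDl -dotpB; apply: le_dotp => [|a]; first by case: (pi_policy s).
by rewrite /dev0 distrC ler_norm.
Qed.

End EmpiricalValue.

(** * The sequence of epochs *)

Lemma empirical_kernel_is_kernel (R : realType) (S A : finType) m
    (y : S -> A -> nat -> S) : (0 < m)%N -> is_kernel (empirical_kernel (R := R) m y).
Proof.
move=> m0 s a; split.
  by move=> s'; rewrite divr_ge0 // sumr_ge0 // => i _; rewrite ler0n.
rewrite -mulr_suml exchange_big /=.
rewrite (eq_bigr (fun=> 1)); last first.
  move=> i _; rewrite (bigD1 (y s a i)) //= eqxx big1 ?addr0 // => s' /negPf.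
  by rewrite eq_sym => ->.
by rewrite sumr_const card_ord divff // pnatr_eq0 -lt0n.
Qed.

Lemma uniform_policy_is_policy (R : realType) (S A : finType) : (0 < #|A|)%N ->
  is_policy (uniform_policy : S -> A -> R).
Proof.
move=> A_gt0 s; split; first by move=> a; rewrite invr_ge0.
transitivity ((#|A|%:R)^-1 *+ #|A| : R); first by rewrite -sumr_const.
by rewrite -[LHS]mulr_natr mulVf // pnatr_eq0 -lt0n.
Qed.

(** An increment of constant sign has standard deviation at most half its sup norm, so its Bernstein
    radius relative to that norm is [be + 2 * be ^+ 2]; going from 141 to 139 pays for the
    square. *)
Lemma step_param_le (R : realType) (x nu be : R) : 0 <= x <= 1 -> 0 < nu -> nu <= 1 ->
  0 <= be -> be <= x * (nu / 141) -> be + 2 * be ^+ 2 <= x * (nu / 139).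
Proof.
move=> /andP[x0 x1] n0 n1 b0 b1.
have xn : x * nu <= 1 by rewrite mulr_ile1 // ltW.
have be1 : be <= 1 / 141 by lra.
have : be ^+ 2 <= be * (1 / 141) by rewrite expr2 ler_wpM2l.
have : 0 <= x * nu by rewrite mulr_ge0 // ltW.
lra.
Qed.

Section Epochs.
Context {R : realType} {S A : finType}.
Variables (P : S -> A -> S -> R) (c : S -> A -> R) (gamma hbar : R).
Variable h : (A -> R) -> R.
Hypotheses (S_gt0 : (0 < #|S|)%N) (A_gt0 : (0 < #|A|)%N) (P_kernel : is_kernel P).
Hypothesis c_bound : forall s a, 0 <= c s a <= 1.
Hypothesis gamma_bound : 0 < gamma < 1.
Hypothesis h_bound : forall x, simplex x -> 0 <= h x <= hbar.
Hypothesis h_cont : continuous_on_simplex h.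
Hypothesis h_convex : convex_function (E := A -> R) simplex h.
Variables (omega : (A -> R) -> R) (grad : (A -> R) -> A -> R) (N : (A -> R) -> R).
Hypotheses (N_norm : is_norm N) (omega_C1 : is_C1_gradient omega grad).
Hypothesis omega_sc : strongly_convex1 N omega.
Variable pistar : S -> A -> R.
Hypothesis pistar_policy : is_policy pistar.
Hypothesis pistar_opt : forall pi, is_policy pi -> forall s,
  policy_value P c gamma h pistar s <= policy_value P c gamma h pi s.
Variables (D0 nu : R) (K k0 L : nat) (T m1 m2 : nat -> nat) (eta : nat -> nat -> R).
Variables (alpha beta : nat -> R).
Hypothesis D0_bound : forall pi : S -> A -> R, is_policy pi ->
  supnorm (bregman_policy omega grad uniform_policy pi) <= D0.
Let H : R := 1 + hbar.
Let u k : R := epoch_gap hbar gamma k.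
Let kap k : R := Num.min (u k) 1.
Hypotheses (nu_gt0 : 0 < nu) (nu_le1 : nu <= 1) (L_nu : L%:R * nu <= 1).
Hypotheses (k0_ge : u k0 <= 1) (k0_le : 2 ^+ k0 <= 2 * (H / (1 - gamma))).
Hypothesis K_le : (K <= k0 + L)%N.
Hypothesis T_lo : forall k, (k < K)%N -> 28 / ((1 - gamma) * kap k) <= (T k)%:R.
Hypothesis T_hi : forall k, (k < K)%N -> (T k)%:R <= 29 / ((1 - gamma) * kap k).
Hypothesis eta_def : forall k t, (k < K)%N -> (t < T k)%N ->
  eta k t = 2 ^+ minn k k0 * D0 / (7 * Num.max (u k) 1).
Hypothesis m1_gt0 : forall k, (k < K)%N -> (0 < m1 k)%N.
Hypothesis alpha_ge0 : forall k, (k < K)%N -> 0 <= alpha k.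
Hypothesis alpha_le : forall k, (k < K)%N ->
  alpha k * H <= Num.sqrt (1 - gamma) ^+ 3 * (kap k * nu / 353).
Hypothesis beta_ge0 : forall k, (k < K)%N -> 0 <= beta k.
Hypothesis beta_le : forall k, (k < K)%N -> beta k <= (1 - gamma) * (nu / 141).

Section SamplePath.
Variable y : sample_index S A -> S.

Let ep k := svmd_epochs c gamma hbar h omega grad T m1 m2 eta y k.

Definition epoch_kernel k : S -> A -> S -> R :=
  empirical_kernel (m1 k) (samples_at y k 0).

Definition step_kernel k t : S -> A -> S -> R :=
  empirical_kernel (m2 k) (samples_at y k t).

Definition epoch_start k : @iterate R S A :=
  Iterate (if k == 0%N then fun=> (1 + hbar) / (1 - gamma)
           else policy_eval c gamma h (epoch_kernel k) (ep k).1) (ep k).1 (ep k).2.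

Definition epoch_iterate k t : @iterate R S A :=
  svmd_inner c gamma h omega grad (eta k) (epoch_kernel k) (step_kernel k) (epoch_start k) t.

Definition increment k t (s : S) : R := it_V (epoch_iterate k t) s - it_V (epoch_start k) s.

Lemma svmd_epochsS k : ep k.+1 = (it_pi (epoch_iterate k (T k)), it_tpi (epoch_iterate k (T k))).
Proof.
rewrite /ep /= -/(ep k) /epoch_iterate /epoch_start.
by case: (ep k) => p q /=.
Qed.

(** In this and the next two events the tested vector is random, but it is determined by samples
    other than those forming the tested row of the empirical kernel. *)
Definition good_absorbed k := forall s a,
  let v := absorbed_value P c gamma h (ep k).1 (epoch_kernel k) s in
  `|kernel_app (epoch_kernel k) v s a - kernel_app P v s a|
  <= deviation (P s a) v (H / (1 - gamma)) (alpha k).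

Definition good_hitting k := forall s a,
  let v := hitting_weight gamma (ep k).1 (epoch_kernel k) s in
  `|kernel_app (epoch_kernel k) v s a - kernel_app P v s a|
  <= deviation (P s a) v 1 (alpha k).

Definition good_steps k := forall t s a, (0 < t < T k)%N ->
  let v := increment k t in
  `|kernel_app (step_kernel k t) v s a - kernel_app P v s a|
  <= deviation (P s a) v (supnorm v) (beta k).

Let g0 : 0 < gamma. Proof. by case/andP: gamma_bound. Qed.
Let g1 : 0 < 1 - gamma. Proof. by rewrite subr_gt0; case/andP: gamma_bound. Qed.

Let hbar_ge0 : 0 <= hbar.
Proof.
case/card_gt0P: S_gt0 => s _; have /andP[h0 h1] := h_bound (pistar_policy s).
exact: le_trans h0 h1.
Qed.

Let H_gt0 : 0 < H. Proof. by rewrite ltr_wpDr. Qed.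

Let uE k : u k = H / (1 - gamma) / 2 ^+ k.
Proof. by rewrite /u /epoch_gap -/H; field; rewrite !gt_eqF ?exprn_gt0. Qed.

Let u_gt0 k : 0 < u k.
Proof. by rewrite uE !divr_gt0 // exprn_gt0. Qed.

Let uS k : u k.+1 = u k / 2.
Proof. by rewrite !uE exprS; field; rewrite !gt_eqF ?exprn_gt0. Qed.

Let kap_gt0 k : 0 < kap k. Proof. by rewrite lt_min u_gt0 ltr01. Qed.
Let kap_le1 k : kap k <= 1. Proof. by rewrite ge_min lexx orbT. Qed.
Let kap_le k : kap k <= u k. Proof. by rewrite ge_min lexx. Qed.

Let kap_max k : kap k * Num.max (u k) 1 = u k.
Proof. by rewrite /kap; case: leP => _; rewrite ?mulr1 ?mul1r. Qed.

Let max_gt0 k : 0 < Num.max (u k) 1.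
Proof. by rewrite lt_max ltr01 orbT. Qed.

Let uniform_bregman (pi : S -> A -> R) s : is_policy pi ->
  bregman omega grad ((uniform_policy : S -> A -> R) s) (pi s) <= D0.
Proof.
move=> pip; apply: le_trans (D0_bound pip).
apply: le_trans (ler_norm _) _.
exact: (le_supnorm (bregman_policy omega grad uniform_policy pi) s).
Qed.

Let D0_ge0 : 0 <= D0.
Proof. exact: le_trans (supnorm_ge0 _) (D0_bound pistar_policy). Qed.

(** A zero Bregman radius around the uniform distribution forces, by strong convexity, [N] to vanish
    on all differences from it. *)
Let D0_eq0 : D0 = 0 -> forall x x' : A -> R, simplex x -> simplex x' -> x = x'.
Proof.
move=> D00; case/card_gt0P: S_gt0 => s _; have us := @uniform_policy_is_policy R S A A_gt0 s.
suff unif x : simplex x -> x = (uniform_policy : S -> A -> R) s by move=> x x' /unif -> /unif ->.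
move=> xs; have [N0 _ _] := N_norm.
apply/eqP; rewrite -subr_eq0; apply/eqP/N0/eqP.
rewrite -sqrf_eq0 eq_le sqr_ge0 andbT.
have := bregman_ge_norm omega_C1 omega_sc us xs.
have := @uniform_bregman (fun=> x) s (fun=> xs).
rewrite D00; lra.
Qed.

Let ee k : R := 2 ^+ minn k k0 / (7 * Num.max (u k) 1).
Let ee_gt0 k : 0 < ee k.
Proof. by rewrite divr_gt0 ?exprn_gt0 // mulr_gt0. Qed.

(* [budget k / (1 - gamma)] bounds the mirror potential at the start of epoch
   [k]; it doubles with [k] up to [k0] and grows by a bounded factor afterwards. *)
Let budget k : R := 2 ^+ minn k k0 *
  (1 + (207 / 100 * (1 - (2 ^+ (k - k0))^-1) + 29 / 20 * ((k - k0)%:R * nu)) / 7).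

(** Before [k0] the increment is at most [2 ^+ k * (207 / 200 + 29 / 20) / 7], less than the
    doubling. After [k0], [kap k <= 2 ^- (k - k0)], and [207 / 200] times this is the increase of
    the geometric term. *)
Let budgetS k : (k < K)%N ->
  budget k + 2 ^+ minn k k0 / 7 * (207 / 200 * kap k + 29 / 20 * nu) <= budget k.+1.
Proof.
move=> kK; rewrite /budget; have n0 := nu_gt0; have n1 := nu_le1.
have k1 := kap_le1 k; have kp := kap_gt0 k.
have [lt|ge] := ltnP k k0.
  rewrite (minn_idPl lt).
  have -> : (k - k0 = 0)%N by apply/eqP; rewrite subn_eq0 ltnW.
  have -> : (k.+1 - k0 = 0)%N by apply/eqP; rewrite subn_eq0.
  rewrite expr0 invr1 subrr mulr0 mul0r mulr0 addr0 mul0r addr0 !mulr1 exprS.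
  have : 0 < (2 : R) ^+ k by rewrite exprn_gt0.
  nra.
rewrite (minn_idPr (leqW ge)) subSn //.
set n := (k - k0)%N; have kn : kap k <= (2 ^+ n)^-1.
  apply: (le_trans (kap_le k)).
  have -> : u k = u k0 / 2 ^+ n.
    rewrite !uE -(subnK ge) -/n exprD; field; rewrite ?gt_eqF ?exprn_gt0 //.
  by rewrite ler_piMl // invr_ge0 exprn_ge0.
rewrite exprS -[n.+1%:R]natr1 invfM.
have p0 : 0 < (2 : R) ^+ k0 by rewrite exprn_gt0.
have : 0 <= 2 ^+ k0 * ((2 ^+ n)^-1 - kap k) by rewrite mulr_ge0 ?subr_ge0 // ltW.
move: (2 ^+ n)^-1 => w; lra.
Qed.

(** At most [L] epochs follow [k0] and [L%:R * nu <= 1], so the factor is at most [1 + (207 / 100 +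
    29 / 20) / 7 < 151 / 100]. *)
Let budget_le k : (k <= K)%N -> budget k <= 151 / 100 * 2 ^+ minn k k0.
Proof.
move=> kK; rewrite /budget mulrC ler_pM2r ?exprn_gt0 //.
have : (k - k0)%:R * nu <= 1.
  apply: le_trans L_nu; rewrite ler_pM2r // ler_nat leq_subLR.
  exact: leq_trans kK K_le.
have : 0 <= (2 ^+ (k - k0))^-1 :> R by rewrite invr_ge0 exprn_ge0.
lra.
Qed.

Let Dmax : R := 4 * H * D0 / (1 - gamma) ^+ 2.

(** A nonnegative function is below its resolvent, so the potential controls the divergence
    pointwise; [2 ^+ k0 <= 2 * (H / (1 - gamma))] then gives the factor [302 / 100 <= 4]. *)
Let potential_Dmax tpi k s : (k <= K)%N -> is_policy tpi ->
  (forall s, mirror_potential P gamma omega grad pistar D0 tpi s <= budget k / (1 - gamma)) ->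
  bregman omega grad (tpi s) (pistar s) <= Dmax.
Proof.
move=> kK tpip pot.
have Qs t : subprob (policy_kernel P pistar t) by apply: policy_kernel_subprob.
have [D00|D0n0] := eqVneq D0 0.
  rewrite (D0_eq0 D00 (tpip s) (pistar_policy s)) /bregman /Dmax D00 mulr0 mul0r.
  have -> : pistar s - pistar s = (fun=> 0 * 0).
    by apply/funext => a; rewrite mulr0 -[LHS]/(pistar s a - pistar s a) subrr.
  by rewrite dotpZ mul0r !subr0 subrr.
have D0p : 0 < D0 by rewrite lt_def D0n0.
have dd0 s' : 0 <= bregman_policy omega grad tpi pistar s' / D0.
  rewrite divr_ge0 //; apply: (bregman_ge0 omega_C1 omega_sc); first exact: tpip.
  exact: pistar_policy.
have := le_trans (resolvent_ge_self gamma_bound Qs dd0 s) (pot s).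
rewrite ler_pdivrMr // => le; apply: (le_trans le).
have -> : Dmax = 4 * (H / (1 - gamma)) / (1 - gamma) * D0.
  by rewrite /Dmax; field; rewrite gt_eqF.
rewrite ler_pM2r // ler_pM2r ?invr_gt0 //.
apply: (le_trans (budget_le kK)).
have : (2 : R) ^+ minn k k0 <= 2 ^+ k0.
  by rewrite ler_weXn2l ?geq_minr // ler1n.
have := k0_le; have : 0 < H / (1 - gamma) by rewrite divr_gt0.
lra.
Qed.

Let invariant k := [/\ is_policy (ep k).1, is_policy (ep k).2,
  forall s, policy_value P c gamma h (ep k).1 s - policy_value P c gamma h pistar s <= u k,
  forall s, mirror_potential P gamma omega grad pistar D0 (ep k).2 s <= budget k / (1 - gamma)
  & forall s, bregman omega grad ((ep k).1 s) (pistar s) <= Dmax].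

Let value_ge0 pi s : is_policy pi -> 0 <= policy_value P c gamma h pi s.
Proof.
move=> pip.
by case/andP: (policy_eval_bound c_bound gamma_bound h_bound hbar_ge0 s P_kernel pip).
Qed.

Let value_le pi s : is_policy pi -> policy_value P c gamma h pi s <= H / (1 - gamma).
Proof.
move=> pip.
by case/andP: (policy_eval_bound c_bound gamma_bound h_bound hbar_ge0 s P_kernel pip).
Qed.

Let invariant0 : invariant 0.
Proof.
have Qs t : subprob (policy_kernel P pistar t) by apply: policy_kernel_subprob.
have unip := @uniform_policy_is_policy R S A A_gt0.
have b0 : budget 0 = 1.
  by rewrite /budget min0n sub0n !expr0 invr1 subrr mulr0 mul0r mulr0 addr0 mul0r addr0 mulr1.
have pot0 s : mirror_potential P gamma omega grad pistar D0 uniform_policy s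
    <= budget 0 / (1 - gamma).
  rewrite b0; apply: (resolvent_cst_le gamma_bound Qs) => // t.
  have [D00|D0n0] := eqVneq D0 0; first by rewrite D00 invr0 mulr0.
  by rewrite ler_pdivrMr ?mul1r ?uniform_bregman // lt_def D0n0.
split => //.
  move=> s; have := value_ge0 s pistar_policy; have := value_le s unip.
  by rewrite uE expr0 divr1; lra.
by move=> s; apply: (@potential_Dmax _ 0).
Qed.

Let invariantS k : (k < K)%N -> good_absorbed k -> good_hitting k -> good_steps k ->
  invariant k -> invariant k.+1.
Proof.
move=> kK gA gH gS [pip tpip gap pot brg].
have [g0' g1' u0 kp0] := And4 g0 g1 (u_gt0 k) (kap_gt0 k).
have [n0 n1 k1 ku] := And4 nu_gt0 nu_le1 (kap_le1 k) (kap_le k).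
have al0 := alpha_ge0 kK; have be0 := beta_ge0 kK.
have P0k : is_kernel (epoch_kernel k) by apply/empirical_kernel_is_kernel/m1_gt0.
set V0 := it_V (epoch_start k).
set c1 := (1 - gamma) * (kap k * nu / 10000).
have kn0 : 0 < kap k * nu by rewrite mulr_gt0.
have c10 : 0 <= c1 by have := mulr_gt0 g1' kn0; rewrite /c1; lra.
have [dev0 V0le V0sup] : [/\
    forall s a, `|kernel_app (epoch_kernel k) V0 s a - kernel_app P V0 s a| <=
      2 * alpha k * fsd (P s a) V0 + c1,
    forall s, V0 s <= policy_value P c gamma h pistar s + 101 / 100 * u k
  & forall s, policy_reward c h (ep k).1 s + gamma * dotp (policy_kernel P (ep k).1 s) V0
    - gamma * dotp ((ep k).1 s)
        (fun a => `|kernel_app (epoch_kernel k) V0 s a - kernel_app P V0 s a|)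
    <= V0 s].
  (* In epoch 0 the starting value is constant, and every kernel averages a constant exactly: there
     is no sampling error. *)
  rewrite /V0 /=; case: eqP => [k00|_].
    have kapp0 Q s a : is_kernel Q -> kernel_app Q (fun=> (1 + hbar) / (1 - gamma)) s a =
        (1 + hbar) / (1 - gamma) by move=> Qk; apply: dotp_cst.
    split.
    - move=> s a; rewrite !kapp0 // subrr normr0 addr_ge0 // !mulr_ge0 ?fsd_ge0 //.
    - move=> s; have := value_ge0 s pistar_policy; have := u0.
      by rewrite k00 uE expr0 divr1 -/H; lra.
    - move=> s; rewrite (dotp_cst _ (policy_kernel_simplex P_kernel (pip s))).
      rewrite [X in _ - X <= _](_ : _ = 0); last first.
        rewrite (_ : (fun a => _) = (fun=> 0)) ?dotp_cst ?mulr0 //.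
        by apply/funext => a; rewrite !kapp0 // subrr normr0.
      rewrite subr0 [leRHS](_ : _ = H + gamma * (H / (1 - gamma))); last first.
        by rewrite /H; field; rewrite gt_eqF.
      by rewrite lerD2r; case/andP: (policy_reward_bound c_bound h_bound s pip).
  split.
  - exact: (empirical_value_dev P_kernel P0k c_bound gamma_bound h_bound hbar_ge0 pip
      kp0 k1 n0 n1 al0 (alpha_le kK) gA gH).
  - move=> s.
    have := empirical_value_close P_kernel P0k c_bound gamma_bound h_bound hbar_ge0 pip
      kp0 k1 n0 n1 al0 (alpha_le kK) gA gH s.
    rewrite ler_norml => /andP[_ up]; have := gap s.
    have : kap k * nu <= u k by apply: le_trans ku; rewrite ler_piMr // ltW.
    lra.
  - exact: (empirical_value_super P c h P0k gamma_bound pip).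
set b2 := beta k + 2 * beta k ^+ 2.
have be1 := beta_le kK.
have b20 : 0 <= b2 by rewrite addr_ge0 // mulr_ge0 // exprn_ge0.
have b2le : b2 <= (1 - gamma) * (nu / 139).
  by apply: step_param_le => //; rewrite ltW //= gerBl ltW.
have aZ := accuracy_param_Z gamma_bound (alpha_le kK).
have al := accuracy_param_le gamma_bound hbar_ge0 kp0 n0 al0 (alpha_le kK).
have Phdev t s a : (0 < t < T k)%N ->
    `|kernel_app (step_kernel k t) (it_V (epoch_iterate k t) - V0) s a
      - kernel_app P (it_V (epoch_iterate k t) - V0) s a|
    <= b2 * supnorm (it_V (epoch_iterate k t) - V0).
  move=> tT; apply: (le_trans (gS t s a tT)); rewrite -/(increment k t).
  have sup0 : 0 <= supnorm (increment k t) by apply: supnorm_ge0.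
  (* The values decrease within an epoch, so the increment lies between minus its sup norm and 0. *)
  have : fsd (P s a) (increment k t) <= supnorm (increment k t) / 2.
    have -> : supnorm (increment k t) / 2 = (0 - - supnorm (increment k t)) / 2.
      by rewrite opprK add0r.
    apply: fsd_range => // s'; apply/andP; split.
      by have := le_supnorm (increment k t) s'; rewrite ler_norml => /andP[].
    by rewrite subr_le0 /epoch_iterate /epoch_start; apply: inner_V_le.
  move=> /(ler_wpM2r be0); rewrite /deviation /b2.
  rewrite (_ : supnorm (_ - _) = supnorm (increment k t)) //; lra.
have etaE t : (t < T k)%N -> eta k t = ee k * D0.
  by move=> tT; rewrite eta_def // /ee; ring.
have EP := epoch_potential A_gt0 P_kernel c_bound gamma_bound h_bound hbar_ge0 h_cont
  h_convex omega_C1 pistar_policy pistar_opt pip tpip u0 n0 n1 al0 c10 b20 aZ al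
  (lexx c1) b2le dev0 V0le V0sup Phdev omega_sc (ee_gt0 k) D0_ge0 D0_eq0 etaE.
have EG := epoch_gap_le A_gt0 P_kernel c_bound gamma_bound h_bound hbar_ge0 h_cont
  h_convex omega_C1 pistar_policy pistar_opt pip tpip u0 n0 n1 al0 c10 b20 aZ al
  (lexx c1) b2le dev0 V0le V0sup Phdev omega_sc (ee_gt0 k) D0_ge0 D0_eq0 etaE.
have Tp : 0 < (T k)%:R :> R.
  by apply: lt_le_trans (T_lo kK); rewrite divr_gt0 // mulr_gt0.
have Tn : (0 < T k)%N by rewrite -(ltr0n R).
have pot' t s : (t <= T k)%N -> mirror_potential P gamma omega grad pistar D0
    (it_tpi (epoch_iterate k t)) s <= budget k.+1 / (1 - gamma).
  move=> tT; apply: (le_trans (EP t s tT)).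
  have tT' : t%:R * (u k * nu / 20) <= 29 / ((1 - gamma) * kap k) * (u k * nu / 20).
    apply: ler_wpM2r; first by have := mulr_gt0 u0 n0; lra.
    by apply: le_trans (T_hi kK); rewrite ler_nat.
  (* Here [kap k * Num.max (u k) 1 = u k] cancels the maximum in the stepsize. *)
  have eeE : ee k * (207 / 200 * u k / (1 - gamma) +
      29 / ((1 - gamma) * kap k) * (u k * nu / 20)) =
      2 ^+ minn k k0 / 7 * (207 / 200 * kap k + 29 / 20 * nu) / (1 - gamma).
    move: (kap_max k) (max_gt0 k); rewrite /ee; move: (Num.max (u k) 1) => mx um mp.
    by rewrite -um; field; rewrite !gt_eqF.
  have := budgetS kK; rewrite -(ler_pM2r (_ : 0 < (1 - gamma)^-1)) ?invr_gt0 //.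
  rewrite mulrDl -eeE => bS; apply: le_trans bS; apply: lerD; first exact: pot.
  by rewrite ler_pM2l // lerD2l.
have pip' : is_policy (it_pi (epoch_iterate k (T k))) by apply: inner_pi_policy.
have tpip' t : is_policy (it_tpi (epoch_iterate k t)) by apply: inner_tpi_policy.
rewrite /invariant svmd_epochsS; split => //=.
- move=> s; apply: (le_trans (EG s Tn)); rewrite uS.
  have p0 : 0 < (2 : R) ^+ minn k k0 by rewrite exprn_gt0.
  have h1 : mirror_potential P gamma omega grad pistar D0 (ep k).2 s / ee k <=
      151 / 100 * 7 * Num.max (u k) 1 / (1 - gamma).
    have -> : 151 / 100 * 7 * Num.max (u k) 1 / (1 - gamma) =
        151 / 100 * 2 ^+ minn k k0 / (1 - gamma) / ee k.
      by rewrite /ee; field; rewrite !gt_eqF.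
    rewrite ler_pM2r ?invr_gt0 //; apply: (le_trans (pot s)).
    by rewrite ler_pM2r ?invr_gt0 // budget_le // ltnW.
  have Ti : (T k)%:R^-1 <= (1 - gamma) * kap k / 28.
    have -> : (1 - gamma) * kap k / 28 = (28 / ((1 - gamma) * kap k))^-1.
      by field; rewrite !gt_eqF.
    rewrite lef_pV2 ?posrE // ?T_lo // divr_gt0 // mulr_gt0 //.
  have x0 : 0 <= 207 / 200 * u k / (1 - gamma) + 151 / 100 * 7 * Num.max (u k) 1 / (1 - gamma).
    have := divr_ge0 (ltW u0) (ltW g1'); have := divr_ge0 (ltW (max_gt0 k)) (ltW g1').
    lra.
  have h2 : (207 / 200 * u k / (1 - gamma) + mirror_potential P gamma omega grad pistar D0
      (ep k).2 s / ee k) / (T k)%:R <=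
      (207 / 200 * u k / (1 - gamma) + 151 / 100 * 7 * Num.max (u k) 1 / (1 - gamma)) *
      ((1 - gamma) * kap k / 28).
    apply: le_trans (_ : (207 / 200 * u k / (1 - gamma) +
      151 / 100 * 7 * Num.max (u k) 1 / (1 - gamma)) / (T k)%:R <= _).
      by rewrite ler_pM2r ?invr_gt0 // lerD2l.
    by apply: ler_wpM2l.
  (* With [7 / 28 = 1 / 4], the new gap is at most [207 / 5600 + 151 / 400 + 1 / 20] times [u k],
     which is below half. *)
  have e3 : (207 / 200 * u k / (1 - gamma) + 151 / 100 * 7 * Num.max (u k) 1 / (1 - gamma)) *
      ((1 - gamma) * kap k / 28) =
      207 / 200 / 28 * (u k * kap k) + 151 / 400 * (kap k * Num.max (u k) 1).
    by field; rewrite !gt_eqF.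
  rewrite e3 kap_max in h2.
  have : u k * kap k <= u k by rewrite ler_piMr // ltW.
  have : u k * nu <= u k by rewrite ler_piMr // ltW.
  lra.
- by move=> s; exact: pot'.
(* A state may keep a policy from an earlier step or epoch, so the divergence bound is needed for
   all mirror iterates, not only the last. *)
- move=> s; apply: (@inner_pi_tpi _ _ _ _ _ _ _ _ _ _ _ _ _ _ _ _
    (fun x => bregman omega grad x (pistar s) <= Dmax)); first exact: brg.
  move=> t tT; apply: (@potential_Dmax _ k.+1) => //; first exact: tpip'.
  by move=> s'; apply: pot'.
Qed.

Lemma svmd_accuracy : (forall k, (k < K)%N ->
    [/\ good_absorbed k, good_hitting k & good_steps k]) ->
  [/\ is_policy (ep K).1,
   forall s, policy_value P c gamma h (ep K).1 s - policy_value P c gamma h pistar s <= u K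
   & forall s, bregman omega grad ((ep K).1 s) (pistar s) <= Dmax].
Proof.
move=> good; suff : invariant K by case.
suff inv k : (k <= K)%N -> invariant k by apply: inv.
elim: k => [_|k IH kK]; first exact: invariant0.
by have [gA gH gS] := good k kK; apply: invariantS => //; apply: IH; apply: ltnW.
Qed.

End SamplePath.
End Epochs.

(** * Probability of the good events *)

Section Locality.
Context {R : realType} {S A : finType}.
Variables (P : S -> A -> S -> R) (c : S -> A -> R) (gamma hbar : R).
Variables (h omega : (A -> R) -> R) (grad : (A -> R) -> A -> R).
Variables (K : nat) (T m1 m2 : nat -> nat) (eta : nat -> nat -> R).

Let U := @used_index S A K T m1 m2.
Let ep := svmd_epochs c gamma hbar h omega grad T m1 m2 eta.

Definition sample_law (j : sample_index S A) : S -> R :=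
  let: (_, _, s, a, _) := j in P s a.

Lemma eq_empirical_kernel m (y y' : S -> A -> nat -> S) s a :
  (forall i, (i < m)%N -> y s a i = y' s a i) ->
  empirical_kernel (R := R) m y s a = empirical_kernel m y' s a.
Proof.
move=> yy'; apply/funext => s'; rewrite /empirical_kernel; congr (_ / _).
by apply: eq_bigr => i _; rewrite yy'.
Qed.

(** Step 0 uses [P0] only, and the iterate [t] has seen the fresh kernels up to [t - 1]; hence the
    strict range on both sides. *)
Lemma eq_svmd_inner (e : nat -> R) P0 (Ph Ph' : nat -> S -> A -> S -> R) it0 t :
  (forall t', (0 < t' < t)%N -> Ph t' = Ph' t') ->
  svmd_inner c gamma h omega grad e P0 Ph it0 t =
  svmd_inner c gamma h omega grad e P0 Ph' it0 t.
Proof.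
elim: t => [//|t IH] PP' /=.
rewrite IH => [|t' /andP[t0 tt']]; last by apply: PP'; rewrite t0 ltnW.
congr svmd_step; apply/funext => s; apply/funext => a.
by case: eqP => // /eqP t0; rewrite PP' // lt0n t0 /=.
Qed.

Lemma eq_step_kernel y y' k t : (k < K)%N -> (0 < t < T k)%N ->
  (forall s a i, U (k, t, s, a, i) -> y (k, t, s, a, i) = y' (k, t, s, a, i)) ->
  step_kernel (R := R) m2 y k t = step_kernel m2 y' k t.
Proof.
move=> kK /andP[t0 tT] yy'; apply/funext => s; apply/funext => a.
apply: eq_empirical_kernel => i im; apply: yy'.
by rewrite /U /used_index kK tT (gtn_eqF t0).
Qed.

Lemma eq_epoch_kernel_row y y' k s a : (k < K)%N -> (0 < T k)%N ->
  (forall i, U (k, 0%N, s, a, i) -> y (k, 0%N, s, a, i) = y' (k, 0%N, s, a, i)) ->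
  epoch_kernel (R := R) m1 y k s a = epoch_kernel m1 y' k s a.
Proof.
move=> kK T0 yy'; apply: eq_empirical_kernel => i im; apply: yy'.
by rewrite /U /used_index kK T0.
Qed.

(** Causality: this leaves the samples of epoch [k] independent of the policies it starts from. *)
Lemma eq_svmd_epochs y y' k : (k <= K)%N -> (forall k, (k < K)%N -> (0 < T k)%N) ->
  (forall j, U j -> (j.1.1.1.1 < k)%N -> y j = y' j) -> ep y k = ep y' k.
Proof.
move=> + T0; elim: k => [//|k IH] kK yy'.
have epk : ep y k = ep y' k.
  by apply: IH; [exact: ltnW|move=> j Uj jk; apply: yy' => //; exact: ltnW].
rewrite /ep !svmd_epochsS /epoch_iterate /epoch_start -/ep epk.
have -> : epoch_kernel (R := R) m1 y k = epoch_kernel m1 y' k.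
  apply/funext => s; apply/funext => a; apply: eq_epoch_kernel_row => //.
    exact: T0.
  by move=> i Ui; apply: yy' => /=.
rewrite (@eq_svmd_inner _ _ (step_kernel m2 y k) (step_kernel m2 y' k)) // => t tT.
by apply: eq_step_kernel => // s a i Ui; apply: yy' => /=.
Qed.

Lemma eq_increment y y' k t : (k < K)%N -> (0 < t < T k)%N ->
  (forall k, (k < K)%N -> (0 < T k)%N) ->
  (forall j, U j -> (j.1.1.1.1 < k)%N || (j.1.1.1.1 == k) && (j.1.1.1.2 < t)%N -> y j = y' j) ->
  increment c gamma hbar h omega grad T m1 m2 eta y k t =
  increment c gamma hbar h omega grad T m1 m2 eta y' k t.
Proof.
move=> kK /andP[t0 tT] T0 yy'; apply/funext => s.
rewrite /increment /epoch_iterate /epoch_start -/ep.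
have -> : ep y k = ep y' k.
  apply: eq_svmd_epochs => //; first exact: ltnW.
  by move=> j Uj jk; apply: yy' => //; rewrite jk.
have -> : epoch_kernel (R := R) m1 y k = epoch_kernel m1 y' k.
  apply/funext => s'; apply/funext => a; apply: eq_epoch_kernel_row => //.
    exact: T0.
  by move=> i Ui; apply: yy' => //=; rewrite eqxx t0 orbT.
rewrite (@eq_svmd_inner _ _ (step_kernel m2 y k) (step_kernel m2 y' k)) //.
move=> t' /andP[t'0 t't]; apply: eq_step_kernel => //.
  by rewrite t'0 (ltn_trans t't).
by move=> s' a i Ui; apply: yy' => //=; rewrite eqxx t't orbT.
Qed.

Lemma absorbed_kernel_local (pi : S -> A -> R) (Q Q' : S -> A -> S -> R) s :
  (forall s' a, s' != s -> Q s' a = Q' s' a) ->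
  absorbed_kernel pi Q s = absorbed_kernel pi Q' s.
Proof.
move=> QQ'; apply/funext => s'; apply/funext => s''; rewrite /absorbed_kernel.
case: eqP => // /eqP ss'; apply: eq_bigr => a _; by rewrite QQ'.
Qed.

End Locality.

(** * Deviation of one block of samples *)

Section BlockDeviation.
Context {R : realType} {S A : finType}.
Variables (P : S -> A -> S -> R).
Hypothesis P_kernel : is_kernel P.
Variables (K : nat) (T m1 m2 : nat -> nat).

Let I := sample_index S A.
Let U : pred I := @used_index S A K T m1 m2.
Let p := sample_law P.

Let p_simplex j : simplex (p j).
Proof. by case: j => [[[[k t] s] a] i]; exact: P_kernel. Qed.

Definition block_size k t := if t == 0%N then m1 k else m2 k.

Definition block k t s a : seq I := [seq (k, t, s, a, i) | i <- iota 0 (block_size k t)].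

(** The index type is infinite; a common bound [M] on steps and sample numbers gives a finite list
    to filter. *)
Definition used_indices : seq I :=
  let M := \max_(k < K) maxn (T k) (maxn (m1 k) (m2 k)) in
  undup (seq.filter U [seq (val x.1.1.1.1, val x.1.1.1.2, x.1.1.2, x.1.2, val x.2) |
    x <- enum {: 'I_K * 'I_M * S * A * 'I_M}]).

Lemma mem_used_indices j : (j \in used_indices) = U j.
Proof.
rewrite mem_undup mem_filter; case Uj : (U j) => //=.
case: j Uj => [[[[k t] s] a] i] /and3P[kK tT im].
set M := \max_(k < K) _.
have hM : (maxn (T k) (maxn (m1 k) (m2 k)) <= M)%N.
  exact: (leq_bigmax (Ordinal kK)).
have tM : (t < M)%N by apply: leq_trans hM; rewrite leq_max tT.
have iM : (i < M)%N.
  apply: leq_trans hM; rewrite !leq_max.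
  by move: im; case: ifP => _ ->; rewrite ?orbT.
apply/mapP; exists (Ordinal kK, Ordinal tM, s, a, Ordinal iM) => //.
by rewrite mem_enum.
Qed.

Lemma uniq_block k t s a : uniq (block k t s a).
Proof. by rewrite map_inj_uniq ?iota_uniq // => i i' [->]. Qed.

Lemma block_used k t s a j : (k < K)%N -> (t < T k)%N -> j \in block k t s a -> U j.
Proof.
by move=> kK tT /mapP[i]; rewrite mem_iota add0n => im ->; rewrite /U /used_index kK tT.
Qed.

Context d (W : measurableType d) (Pr : probability W R) (X : I -> W -> S).
Hypothesis X_samples : is_generative_sample U P Pr X.

Let X_law_p j z : U j -> Pr (X j @^-1` [set z]) = (p j z)%:E.
Proof.
by case: X_samples => _ Xl _; case: j => [[[[k t] s] a] i] Uj; apply: Xl.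
Qed.

Definition local_event (E : (I -> S) -> Prop) :=
  forall y y' : I -> S, (forall j, U j -> y j = y' j) -> E y -> E y'.

Lemma prob_enumeration (J : seq I) (E : (I -> S) -> Prop) y0 :
  uniq J -> J =i U -> local_event E ->
  measurable [set w | E (fun j => X j w)] /\
  Pr [set w | E (fun j => X j w)] = (expect p J (fun y => `[< E y >]%:R) y0)%:E.
Proof.
move=> uJ JU EU; have [Xm _ Xi] := X_samples.
apply: (joint_law Xm X_law_p Xi) => //.
  by apply/allP => j; rewrite JU.
by move=> y y' yy'; apply: EU => j Uj; apply: yy'; rewrite JU.
Qed.

(* The samples of a block are drawn last: given the others, the vector
   [F y] is deterministic. *)
Lemma block_deviation_prob k t s a (F : (I -> S) -> S -> R) (b : (I -> S) -> R)
    (th : R) y0 :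
  (k < K)%N -> (t < T k)%N -> (0 < block_size k t)%N -> 0 < th ->
  (forall y y' : I -> S, (forall j, U j -> j \notin block k t s a -> y j = y' j) ->
    F y = F y') ->
  (forall y y' : I -> S, (forall j, U j -> j \notin block k t s a -> y j = y' j) ->
    b y = b y') ->
  (forall y z, `|F y z - dotp (P s a) (F y)| <= b y) ->
  let E y := ~ `|kernel_app (empirical_kernel (block_size k t) (samples_at y k t)) (F y) s a
       - kernel_app P (F y) s a| <= deviation (P s a) (F y) (b y) th in
  local_event E /\
  expect p used_indices (fun y => `[< E y >]%:R) y0 <=
    2 * expR (- ((block_size k t)%:R * th ^+ 2)).
Proof.
move=> kK tT m0 th0 Fl bl Fb E.
set m := block_size k t in m0 E *; set B := block k t s a.
have kE (f : S -> R) y : kernel_app (empirical_kernel m (samples_at y k t)) f s a =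
    (\sum_(j <- B) f (y j)) / m%:R.
  rewrite /kernel_app /dotp /empirical_kernel.
  under eq_bigr do rewrite mulrAC mulr_suml.
  rewrite -mulr_suml exchange_big /= /B /block big_map -/m.
  have -> : iota 0 m = index_iota 0 m by rewrite /index_iota subn0.
  rewrite big_mkord; congr (_ / _).
  apply: eq_bigr => i _; rewrite (bigD1 (y (k, t, s, a, nat_of_ord i))) //= /samples_at eqxx mul1r.
  by rewrite big1 ?addr0 // => z /negPf; rewrite eq_sym => ->; rewrite mul0r.
have m0' : 0 < m%:R :> R by rewrite ltr0n.
have El : local_event E.
  move=> y y' yy'; rewrite /E (Fl y y') ?(bl y y'); try by move=> j Uj _; apply: yy'.
  rewrite !kE; suff -> : \sum_(j <- B) F y' (y j) = \sum_(j <- B) F y' (y' j) by [].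
  rewrite !big_seq; apply: eq_bigr => j jB; rewrite yy' //.
  exact: block_used jB.
split => //.
pose J := seq.filter (predC (mem B)) used_indices ++ B.
have uJ : uniq J.
  rewrite cat_uniq filter_uniq ?undup_uniq // uniq_block andbT /=.
  by apply/hasPn => j jB; rewrite mem_filter /= jB.
have JU : J =i U.
  move=> j; rewrite mem_cat mem_filter /= mem_used_indices.
  case jB : (j \in B) => /=; last by rewrite orbF.
  by apply/esym/(block_used kK tT jB).
(* Both enumerations compute the probability of the same event, so reordering needs no exchange of
   the iterated sums. *)
have -> : expect p used_indices (fun y => `[< E y >]%:R) y0 =
    expect p J (fun y => `[< E y >]%:R) y0.
  have [_ e1] := prob_enumeration y0 (undup_uniq _) mem_used_indices El.
  have [_ e2] := prob_enumeration y0 uJ JU El.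
  by apply: EFin_inj; rewrite -e1 -e2.
rewrite expect_cat -[leRHS](expect_cst p_simplex (seq.filter (predC (mem B)) used_indices) _ y0).
apply: le_expect => // y; set f := F y; set mu := dotp (P s a) f.
pose f' z := - f z.
pose up (g : S -> R) (y' : I -> S) : R := (m%:R * deviation (P s a) g (b y) th <
  \sum_(j <- B) (g (y' j) - dotp (P s a) g))%R%:R.
have sizeB : size B = m by rewrite size_map size_iota.
have bern (g : S -> R) : (forall z, `|g z - dotp (P s a) g| <= b y) ->
    expect p B (up g) y <= expR (- (m%:R * th ^+ 2)).
  move=> gb; rewrite /up -sizeB; apply: bernstein => //; first exact: uniq_block.
  by move=> j /mapP[i _ ->].
have mu' : dotp (P s a) f' = - mu by rewrite /f' dotpN.
have f'b z : `|f' z - dotp (P s a) f'| <= b y.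
  by rewrite mu' /f' -opprD normrN; apply: Fb.
have dev' : deviation (P s a) f' (b y) th = deviation (P s a) f (b y) th.
  by rewrite /deviation /f' fsdN.
(* Two one-sided bounds, for [f] and for its opposite, give the factor 2. *)
rewrite mulr_natl mulr2n; apply: (le_trans _ (lerD (bern f (Fb y)) (bern f' f'b))).
rewrite -expectD; apply: (@le_trans _ _ (expect p B
  (fun y' => (~~ (`|(\sum_(j <- B) f (y' j)) / m%:R - mu| <= deviation (P s a) f (b y) th))%:R) y)).
  rewrite le_eqVlt; apply/orP; left; apply/eqP; apply: eq_expect => y' y'E.
  rewrite /E (Fl y' y) ?(bl y' y) ?kE; try by move=> j _; exact: y'E.
  by congr (nat_of_bool _)%:R; apply/asboolP/idP => /negP.
apply: le_expect => // y'; rewrite /up mu' dev'.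
have -> : \sum_(j <- B) (f (y' j) - mu) = \sum_(j <- B) f (y' j) - m%:R * mu.
  by rewrite sumrB big_const_seq count_predT iter_addr_0 sizeB mulr_natl.
have -> : \sum_(j <- B) (f' (y' j) - - mu) = m%:R * mu - \sum_(j <- B) f (y' j).
  by rewrite sumrB sumrN big_const_seq count_predT iter_addr_0 sizeB mulNrn opprK addrC mulr_natl.
set x := \sum_(j <- B) _; set D := deviation _ _ _ _.
have -> : x / m%:R - mu = (x - m%:R * mu) / m%:R by field; rewrite gt_eqF.
rewrite normrM [`|m%:R^-1|]gtr0_norm ?invr_gt0 // ler_pdivrMr // [D * _]mulrC -ltNge.
rewrite -(opprB x) ; move: (x - _) (m%:R * D) => v w.
have [v0|v0] := leP 0 v; first by rewrite ger0_norm // lerDl ler0n.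
by rewrite ltr0_norm // lerDr ler0n.
Qed.

End BlockDeviation.

(** * Union bound over all blocks *)

Section HighProbability.
Context {R : realType} {S A : finType}.
Variables (P : S -> A -> S -> R) (c : S -> A -> R) (gamma hbar : R).
Variables (h omega : (A -> R) -> R) (grad : (A -> R) -> A -> R).
Hypotheses (S_gt0 : (0 < #|S|)%N) (A_gt0 : (0 < #|A|)%N) (P_kernel : is_kernel P).
Hypothesis c_bound : forall s a, 0 <= c s a <= 1.
Hypothesis gamma_bound : 0 < gamma < 1.
Hypothesis h_bound : forall x, simplex x -> 0 <= h x <= hbar.
Hypothesis hbar_ge0 : 0 <= hbar.
Hypothesis h_cont : continuous_on_simplex h.
Hypothesis omega_C1 : is_C1_gradient omega grad.
Variables (K : nat) (T m1 m2 : nat -> nat) (eta : nat -> nat -> R).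

Let I := sample_index S A.
Let U : pred I := @used_index S A K T m1 m2.
Let p := sample_law P.
Let ep y k := svmd_epochs c gamma hbar h omega grad T m1 m2 eta y k.

Let p_simplex j : simplex (p j).
Proof. by case: j => [[[[k t] s] a] i]; exact: P_kernel. Qed.

Lemma svmd_epochs_policy y k : is_policy (ep y k).1 /\ is_policy (ep y k).2.
Proof.
elim: k => [|k [IH1 IH2]]; first by split; exact: @uniform_policy_is_policy R S A A_gt0.
rewrite /ep svmd_epochsS; split; first exact: inner_pi_policy.
exact: inner_tpi_policy.
Qed.

Variables (alpha beta : nat -> R) (delta : R).
Hypothesis T_gt1 : forall k, (k < K)%N -> (1 < T k)%N.
Hypothesis m1_gt0 : forall k, (k < K)%N -> (0 < m1 k)%N.
Hypothesis m2_gt0 : forall k, (k < K)%N -> (0 < m2 k)%N.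
Hypothesis alpha_gt0 : forall k, (k < K)%N -> 0 < alpha k.
Hypothesis beta_gt0 : forall k, (k < K)%N -> 0 < beta k.
Hypothesis K_gt0 : (0 < K)%N.
Hypothesis delta_ge0 : 0 <= delta.
Hypothesis alpha_tail : forall k, (k < K)%N ->
  expR (- ((m1 k)%:R * alpha k ^+ 2)) <= delta / (12 * K%:R * #|S|%:R * #|A|%:R).
Hypothesis beta_tail : forall k, (k < K)%N ->
  expR (- ((m2 k)%:R * beta k ^+ 2)) <=
  delta / (4 * K%:R * ((T k)%:R - 1) * #|S|%:R * #|A|%:R).

Let T_gt0 k : (k < K)%N -> (0 < T k)%N. Proof. by move=> /T_gt1 /ltnW. Qed.

Let bad_absorbed k s a y :=
  ~ `|kernel_app (epoch_kernel m1 y k)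
        (absorbed_value P c gamma h (ep y k).1 (epoch_kernel m1 y k) s) s a
      - kernel_app P (absorbed_value P c gamma h (ep y k).1 (epoch_kernel m1 y k) s) s a|
    <= deviation (P s a) (absorbed_value P c gamma h (ep y k).1 (epoch_kernel m1 y k) s)
         ((1 + hbar) / (1 - gamma)) (alpha k).

Let bad_hitting k s a y :=
  ~ `|kernel_app (epoch_kernel m1 y k)
        (hitting_weight gamma (ep y k).1 (epoch_kernel m1 y k) s) s a
      - kernel_app P (hitting_weight gamma (ep y k).1 (epoch_kernel m1 y k) s) s a|
    <= deviation (P s a) (hitting_weight gamma (ep y k).1 (epoch_kernel m1 y k) s)
         1 (alpha k).

Let incr y k t := increment c gamma hbar h omega grad T m1 m2 eta y k t.

Let bad_step k t s a y :=
  ~ `|kernel_app (step_kernel m2 y k t) (incr y k t) s a - kernel_app P (incr y k t) s a|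
    <= deviation (P s a) (incr y k t) (supnorm (incr y k t)) (beta k).

Let ev (E : (I -> S) -> Prop) y0 := expect p (used_indices K T m1 m2) (fun y => `[< E y >]%:R) y0.

Let blockP k t s a (j : I) : j \in block m1 m2 k t s a ->
  [/\ j.1.1.1.1 = k, j.1.1.1.2 = t & j.1.1.2 = s].
Proof. by case/mapP => i _ ->. Qed.

Let epoch_kernelP k (y : I -> S) : (k < K)%N -> is_kernel (epoch_kernel (R := R) m1 y k).
Proof. by move=> kK; apply/empirical_kernel_is_kernel/m1_gt0. Qed.

Let outside_block0 k s a (y y' : I -> S) : (k < K)%N ->
  (forall j, U j -> j \notin block m1 m2 k 0 s a -> y j = y' j) ->
  ep y k = ep y' k /\
  (forall s' a', s' != s ->
    epoch_kernel (R := R) m1 y k s' a' = epoch_kernel m1 y' k s' a').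
Proof.
move=> kK yy'; split.
- apply: (@eq_svmd_epochs _ _ _ _ _ _ _ _ _ K) => //; first exact: ltnW.
  move=> j Uj jk; apply: yy' => //; apply/negP => /blockP[jk' _ _].
  by rewrite jk' ltnn in jk.
- move=> s' a' s's; apply: (@eq_epoch_kernel_row _ _ _ K T m1 m2) => //; first exact: T_gt0.
  move=> i Ui; apply: yy' => //; apply/negP => /blockP[_ _ /= e].
  by rewrite e eqxx in s's.
Qed.

Context d (W : measurableType d) (Pr : probability W R) (X : I -> W -> S).
Hypothesis X_samples : is_generative_sample U P Pr X.

Let absorbed_prob k s a y0 : (k < K)%N ->
  ev (bad_absorbed k s a) y0 <= 2 * expR (- ((m1 k)%:R * alpha k ^+ 2)).
Proof.
move=> kK.
pose F y := absorbed_value P c gamma h (ep y k).1 (epoch_kernel m1 y k) s.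
have Fl y y' : (forall j, U j -> j \notin block m1 m2 k 0 s a -> y j = y' j) -> F y = F y'.
  move=> /(outside_block0 kK)[e1 e2]; rewrite /F /absorbed_value e1.
  by congr resolvent; apply: absorbed_kernel_local => s' a' s's; apply: e2.
have Fb y z : `|F y z - dotp (P s a) (F y)| <= (1 + hbar) / (1 - gamma).
  rewrite -[leRHS]subr0; apply: ler_norm_sub_dotp => // z'.
  apply: absorbed_value_bound => //; first exact: (svmd_epochs_policy y k).1.
  exact: epoch_kernelP.
have [_] := block_deviation_prob (b := fun=> _) P_kernel X_samples y0 kK (T_gt0 kK)
  (m1_gt0 kK) (alpha_gt0 kK) Fl (fun _ _ _ => erefl) Fb.
exact.
Qed.

Let hitting_prob k s a y0 : (k < K)%N ->
  ev (bad_hitting k s a) y0 <= 2 * expR (- ((m1 k)%:R * alpha k ^+ 2)).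
Proof.
move=> kK.
pose F y := hitting_weight gamma (ep y k).1 (epoch_kernel m1 y k) s.
have Fl y y' : (forall j, U j -> j \notin block m1 m2 k 0 s a -> y j = y' j) -> F y = F y'.
  move=> /(outside_block0 kK)[e1 e2]; rewrite /F /hitting_weight e1.
  by congr resolvent; apply: absorbed_kernel_local => s' a' s's; apply: e2.
have Fb y z : `|F y z - dotp (P s a) (F y)| <= 1.
  rewrite -[leRHS]subr0; apply: ler_norm_sub_dotp => // z'.
  apply: hitting_weight_bound => //; first exact: (svmd_epochs_policy y k).1.
  exact: epoch_kernelP.
have [_] := block_deviation_prob (b := fun=> _) P_kernel X_samples y0 kK (T_gt0 kK)
  (m1_gt0 kK) (alpha_gt0 kK) Fl (fun _ _ _ => erefl) Fb.
exact.
Qed.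

Let step_prob k t s a y0 : (k < K)%N -> (0 < t < T k)%N ->
  ev (bad_step k t s a) y0 <= 2 * expR (- ((m2 k)%:R * beta k ^+ 2)).
Proof.
move=> kK /andP[t0 tT].
have Fl y y' : (forall j, U j -> j \notin block m1 m2 k t s a -> y j = y' j) ->
    incr y k t = incr y' k t.
  move=> yy'; apply: (@eq_increment _ _ _ _ _ _ _ _ _ K) => //; first by rewrite t0.
  move=> j Uj jkt; apply: yy' => //; apply/negP => /blockP[jk jt _].
  by move: jkt; rewrite jk jt !ltnn andbF.
have Fb y z : `|incr y k t z - dotp (P s a) (incr y k t)| <= supnorm (incr y k t).
  rewrite -[leRHS]opprK -[leRHS]add0r; apply: ler_norm_sub_dotp => // z'; apply/andP; split.
    by have := le_supnorm (incr y k t) z'; rewrite ler_norml => /andP[].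
  by rewrite subr_le0 /epoch_iterate /epoch_start; apply: inner_V_le.
have m0 : (0 < block_size m1 m2 k t)%N by rewrite /block_size gtn_eqF // m2_gt0.
have := (block_deviation_prob P_kernel X_samples y0 kK tT m0 (beta_gt0 kK) Fl
  (fun y y' yy' => congr1 supnorm (Fl y y' yy')) Fb).2.
by rewrite /block_size gtn_eqF.
Qed.

(** The union bound is carried out inside [expect]; it then transfers to [G], whose probability is
    such a finite sum because it depends only on the used samples. *)
Lemma good_events_prob (G : (I -> S) -> Prop) : local_event K T m1 m2 G ->
  (forall y, (forall k, (k < K)%N ->
    [/\ good_absorbed P c gamma hbar h omega grad T m1 m2 eta alpha y k,
        good_hitting P c gamma hbar h omega grad T m1 m2 eta alpha y k
      & good_steps P c gamma hbar h omega grad T m1 m2 eta beta y k]) -> G y) ->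
  ((1 - delta)%:E <= Pr [set w | G (fun j => X j w)])%E.
Proof.
move=> Gl Ggood; have [s0 _] : exists s : S, true by case/card_gt0P: S_gt0 => s _; exists s.
pose y0 : I -> S := fun=> s0.
have [_ ->] := prob_enumeration X_samples y0 (undup_uniq _) (mem_used_indices K T m1 m2) Gl.
pose bad (x : (nat * nat) * (S * A)) y := if x.1.2 == 0%N then
    bad_absorbed x.1.1 x.2.1 x.2.2 y \/ bad_hitting x.1.1 x.2.1 x.2.2 y
  else bad_step x.1.1 x.1.2 x.2.1 x.2.2 y.
pose kts := [seq (k, t) | k <- iota 0 K, t <- iota 0 (T k)].
pose bl := [seq (x, z) | x <- kts, z <- enum {: S * A}].
have memkt k t : (k < K)%N -> (t < T k)%N -> (k, t) \in kts.
  by move=> kK tT; apply/allpairsPdep; exists k, t; rewrite !mem_iota !add0n.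
have ktmem x : x \in kts -> (x.1 < K)%N /\ (x.2 < T x.1)%N.
  by move=> /allpairsPdep[k [t [+ + ->]]]; rewrite !mem_iota !add0n.
have membl k t s a : (k < K)%N -> (t < T k)%N -> ((k, t), (s, a)) \in bl.
  move=> kK tT; apply/allpairsPdep; exists (k, t), (s, a).
  by rewrite memkt // mem_enum.
have union y : 1 - `[< G y >]%:R <= \sum_(x <- bl) `[< bad x y >]%:R :> R.
  have sum0 (r : seq ((nat * nat) * (S * A))) : 0 <= \sum_(x <- r) `[< bad x y >]%:R :> R.
    by apply: sumr_ge0 => x _; rewrite ler0n.
  case: (asboolP (G y)) => nG; first by rewrite subrr.
  rewrite subr0; case: (boolP (has (fun x => `[< bad x y >]) bl)) => [/hasP[x xbl bx]|/hasPn nb].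
    by rewrite (big_rem x) //= bx lerDl.
  case: nG; apply: Ggood => k kK; split.
  - move=> s a; have /asboolP := nb _ (membl k 0%N s a kK (T_gt0 kK)).
    rewrite /bad /= => nbad; apply: contrapT => b; apply: nbad; left; exact: b.
  - move=> s a; have /asboolP := nb _ (membl k 0%N s a kK (T_gt0 kK)).
    rewrite /bad /= => nbad; apply: contrapT => b; apply: nbad; right; exact: b.
  - move=> t s a /andP[t0 tT]; have /asboolP := nb _ (membl k t s a kK tT).
    by rewrite /bad /= gtn_eqF // => nbad; apply: contrapT => b; apply: nbad; exact: b.
rewrite lee_fin.
set e := expect _ _ _ _.
have : 1 - e <= \sum_(x <- bl) ev (bad x) y0.
  rewrite /ev -expect_sum //.
  have -> : 1 - e = expect p (used_indices K T m1 m2) (fun y => 1 + (-1) * `[< G y >]%:R) y0.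
    by rewrite expectD expectZ expect_cst // mulN1r.
  by apply: le_expect => // y; rewrite mulN1r.
suff : \sum_(x <- bl) ev (bad x) y0 <= delta by lra.
have S0 : 0 < #|S|%:R :> R by rewrite ltr0n.
have A0 : 0 < #|A|%:R :> R by rewrite ltr0n.
have K0 : 0 < K%:R :> R by rewrite ltr0n.
(* At [t = 0] there are two vectors with two tails each; at later steps, one vector with two
   tails. *)
pose b0 := 4 * (delta / (12 * K%:R * #|S|%:R * #|A|%:R)) : R.
pose b1 k := 2 * (delta / (4 * K%:R * ((T k)%:R - 1) * #|S|%:R * #|A|%:R)) : R.
apply: (@le_trans _ _ (\sum_(x <- bl) (if x.1.2 == 0%N then b0 else b1 x.1.1))).
  rewrite !big_seq; apply: ler_sum => -[[k t] [s a]] /allpairsPdep[[k' t'] [[s' a']]].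
  move=> [/ktmem /= [kK tT] _ [-> -> _ _]]; rewrite /bad /=; case: eqP => [_|/eqP t0].
    apply: (@le_trans _ _ (ev (bad_absorbed k' s a) y0 + ev (bad_hitting k' s a) y0)).
      rewrite /ev -expectD; apply: le_expect => // y.
      case: (asboolP (_ \/ _)) => [[b|b]|_]; last by rewrite addr_ge0 // ler0n.
        by rewrite (asboolT b) lerDl ler0n.
      by rewrite (asboolT b) lerDr ler0n.
    have := absorbed_prob s a y0 kK; have := hitting_prob s a y0 kK.
    have := alpha_tail kK; rewrite /b0; lra.
  have t0T : (0 < t' < T k')%N by rewrite lt0n t0.
  have := step_prob s a y0 kK t0T; have := beta_tail kK; rewrite /b1; lra.
rewrite big_allpairs_dep /= big_allpairs_dep /=.
(* Each epoch receives [4 / 12 + 2 / 4 = 5 / 6] of [delta / K]; the second share is spread over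
   [T k - 1] steps. *)
apply: (@le_trans _ _ (\sum_(k <- iota 0 K) (5 / 6 * (delta / K%:R)))); last first.
  rewrite big_const_seq count_predT size_iota iter_addr_0 -[leLHS]mulr_natr.
  by rewrite -mulrA divfK ?gt_eqF //; have := delta_ge0; lra.
rewrite !big_seq; apply: ler_sum => k; rewrite mem_iota add0n => /= kK.
have cst (x : R) : \sum_(z <- enum {: S * A}) x = #|S|%:R * #|A|%:R * x.
  by rewrite big_const_seq count_predT iter_addr_0 -cardE card_prod -[LHS]mulr_natl natrM.
under eq_bigr do rewrite cst.
have [T' TE] : exists T', T k = T'.+1 by exists (T k).-1; rewrite prednK // T_gt0.
have T'0 : 0 < T'%:R :> R by rewrite ltr0n; have := T_gt1 kK; rewrite TE.
rewrite TE /= big_cons eqxx.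
rewrite (eq_big_seq (fun=> #|S|%:R * #|A|%:R * b1 k)); last first.
  by move=> t; rewrite mem_iota => /andP[t1 _]; rewrite gtn_eqF.
rewrite big_const_seq count_predT size_iota iter_addr_0 -[_ *+ T']mulr_natr.
rewrite /b0 /b1 TE -[T'.+1%:R]natr1 addrK.
rewrite le_eqVlt; apply/orP; left; apply/eqP; field.
by rewrite !gt_eqF.
Qed.

End HighProbability.

(** * Logarithms, ceilings and sample sizes *)

Section StepConstants.
Context {R : realType}.
Implicit Types (x l m w : R).

Lemma log2_le_nat x (n : nat) : 0 < x -> (log2 x <= n%:R) = (x <= 2 ^+ n).
Proof.
move=> x0; have l2 : 0 < ln (2 : R) by rewrite ln_gt0 // ltr1n.
by rewrite /log2 ler_pdivrMr // mulr_natl -lnXn // ler_ln // posrE // exprn_gt0.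
Qed.

Lemma nat_ceil x (n : nat) : n%:Z = Num.ceil x -> x <= n%:R /\ n%:R < x + 1.
Proof.
move=> nx; have := ceil_itv x; rewrite -nx => /andP[lo up]; split => //.
by rewrite -ltrBlDr; move: lo; rewrite intrB.
Qed.

Lemma log2_gt0 x : 1 < x -> 0 < log2 x.
Proof. by move=> x1; rewrite divr_gt0 // ln_gt0 // ltr1n. Qed.

Lemma log2M x y : 0 < x -> 0 < y -> log2 (x * y) = log2 x + log2 y.
Proof. by move=> x0 y0; rewrite /log2 lnM ?posrE // mulrDl. Qed.

(** Inverts a sample-size condition: [Num.sqrt (l / m)] is the Bernstein parameter whose tail is
    [expR (- l)]. *)
Lemma sqrt_ratio_le l m w : 0 < l -> 0 < w -> l / w ^+ 2 <= m ->
  [/\ 0 < m, 0 < Num.sqrt (l / m), Num.sqrt (l / m) <= w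
    & m * Num.sqrt (l / m) ^+ 2 = l].
Proof.
move=> l0 w0 lm; have w2 : 0 < w ^+ 2 by rewrite exprn_gt0.
have m0 : 0 < m by apply: lt_le_trans lm; rewrite divr_gt0.
split => //; first by rewrite sqrtr_gt0 divr_gt0.
  rewrite -[leRHS](gtr0_norm w0) -sqrtr_sqr ler_sqrt ?(ltW w2) // ler_pdivrMr //.
  by rewrite mulrC -ler_pdivrMr.
by rewrite sqr_sqrtr ?divr_ge0 ?ltW // mulrC divfK // gt_eqF.
Qed.

Lemma expRN_ln x : 0 < x -> expR (- ln x) = x^-1.
Proof. by move=> x0; rewrite expRN lnK // posrE. Qed.

End StepConstants.

Theorem theorem2 (R : realType) (S A : finType)
    (* the regularized discounted MDP *)
    (P : S -> A -> S -> R) (c : S -> A -> R) (gamma hbar : R)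
    (h : (A -> R) -> R)
    (S_gt0 : (0 < #|S|)%N) (A_gt0 : (0 < #|A|)%N)
    (P_kernel : is_kernel P)
    (c_bound : forall s a, 0 <= c s a <= 1)
    (gamma_bound : 0 < gamma < 1)
    (h_bound : forall x, simplex x -> 0 <= h x <= hbar)
    (h_cont : continuous_on_simplex h)
    (h_convex : convex_function (E := A -> R) simplex h)
    (* the distance generating function and its gradient *)
    (omega : (A -> R) -> R) (grad_omega : (A -> R) -> A -> R)
    (N : (A -> R) -> R)
    (N_norm : is_norm N)
    (omega_C1 : is_C1_gradient omega grad_omega)
    (omega_sc : strongly_convex1 N omega)
    (* the trajectory process (s_t, a_t), with its law for each policy and
       initial state *)
    (dtraj : measure_display) (Wtraj : measurableType dtraj)
    (Ptraj : (S -> A -> R) -> S -> probability Wtraj R)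
    (st : nat -> Wtraj -> S) (act : nat -> Wtraj -> A)
    (traj_model : is_trajectory_model P Ptraj st act)
    (* an optimal policy *)
    (pistar : S -> A -> R)
    (pistar_opt : is_optimal (value c gamma h Ptraj st act) pistar)
    (* the parameters of the algorithm *)
    (delta eps D0 : R) (K k0 : nat) (T m1 m2 : nat -> nat)
    (eta : nat -> nat -> R)
    (delta_bound : 0 < delta < 1) (eps_bound : 0 < eps < 1)
    (D0_bound : forall pi : S -> A -> R, is_policy pi ->
      supnorm (bregman_policy omega grad_omega uniform_policy pi) <= D0)
    (k0_def : k0%:Z = Num.ceil (log2 ((1 + hbar) / (1 - gamma))))
    (K_def : K%:Z = Num.ceil (log2 ((1 + hbar) / ((1 - gamma) * eps))))
    (T_def : forall k, (k < K)%N ->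
      (T k)%:Z = Num.ceil (28 / ((1 - gamma) *
                                 Num.min (epoch_gap hbar gamma k) 1)))
    (eta_def : forall k t, (k < K)%N -> (t < T k)%N ->
      eta k t = 2 ^+ minn k k0 * D0 / (7 * Num.max (epoch_gap hbar gamma k) 1))
    (m1_bound : forall k, (k < K)%N ->
      (250 * Num.sqrt 2 * (1 + hbar)) ^+ 2
        * ln (12 * K%:R * #|S|%:R * #|A|%:R * delta^-1)
        * (Num.ceil (log2 eps^-1))%:~R ^+ 2
        / ((1 - gamma) ^+ 3 * Num.min (epoch_gap hbar gamma k) 1 ^+ 2)
      <= (m1 k)%:R)
    (m2_bound : forall k, (k < K)%N ->
      (100 * Num.sqrt 2) ^+ 2
        * ln (4 * K%:R * ((T k)%:R - 1) * #|S|%:R * #|A|%:R * delta^-1)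
        * (Num.ceil (log2 eps^-1))%:~R ^+ 2
        / (1 - gamma) ^+ 2
      <= (m2 k)%:R)
    (* the samples from the generative model *)
    (d : measure_display) (W : measurableType d) (Pr : probability W R)
    (X : sample_index S A -> W -> S)
    (X_samples : is_generative_sample (used_index K T m1 m2) P Pr X) :
  ((1 - delta)%:E <= Pr [set w | (
    let pihat := svmd_output c gamma hbar h omega grad_omega T m1 m2 eta
                   (fun j => X j w) K in
    supnorm (fun s => value c gamma h Ptraj st act pihat s
                      - value c gamma h Ptraj st act pistar s) <= eps /\
    supnorm (bregman_policy omega grad_omega pihat pistar)
      <= 4 * (1 + hbar) * D0 / (1 - gamma) ^+ 2)%R])%E.
Proof.
have [pistarp pistarv] := pistar_opt.
have g0 : 0 < gamma by case/andP: gamma_bound.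
have g1 : 0 < 1 - gamma by rewrite subr_gt0; case/andP: gamma_bound.
have hbar0 : 0 <= hbar.
  case/card_gt0P: (S_gt0) => s _; have /andP[h0 h1] := h_bound _ (pistarp s).
  exact: le_trans h0 h1.
have H0 : 0 < 1 + hbar by rewrite ltr_wpDr.
have H1 : 1 <= 1 + hbar by rewrite lerDl.
have [e0 e1] := andP eps_bound; have [dl0 dl1] := andP delta_bound.
set B := (1 + hbar) / (1 - gamma).
have B1 : 1 < B.
  rewrite ltr_pdivlMr // mul1r; apply: lt_le_trans H1.
  by rewrite ltrBlDr ltrDl.
have B0 : 0 < B by apply: lt_trans B1.
have valueE pi s : is_policy pi ->
    value c gamma h Ptraj st act pi s = policy_value P c gamma h pi s.
  move=> pip; case: traj_model => mst mact tr.
  rewrite /value (value_trajectory P_kernel pip mst mact (tr pi s pip) gamma_bound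
    (H := 1 + hbar)) // => s' a.
  have /andP[c0 c1] := c_bound s' a; have /andP[h0 h1] := h_bound _ (pip s').
  by rewrite addr_ge0 // lerD.
have opt pi : is_policy pi -> forall s,
    policy_value P c gamma h pistar s <= policy_value P c gamma h pi s.
  by move=> pip s; rewrite -!valueE //; exact: pistarv.
pose u k := epoch_gap hbar gamma k.
pose kap k := Num.min (u k) 1.
have uE k : u k = B / 2 ^+ k.
  by rewrite /u /epoch_gap /B; field; rewrite !gt_eqF // exprn_gt0.
have u0 k : 0 < u k by rewrite uE divr_gt0 // exprn_gt0.
have kap0 k : 0 < kap k by rewrite lt_min u0 ltr01.
have kap1 k : kap k <= 1 by rewrite ge_min lexx orbT.
have einv : 1 < eps^-1 by rewrite invf_gt1.
have Lgt0 : 0 < Num.ceil (log2 eps^-1) by rewrite ceil_gt0 log2_gt0.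
pose L := `|Num.ceil (log2 eps^-1)|%N.
have LE : L%:Z = Num.ceil (log2 eps^-1) by rewrite /L gez0_abs // ltW.
have L0 : (0 < L)%N by rewrite /L absz_gt0 gt_eqF.
have L0' : 0 < L%:R :> R by rewrite ltr0n.
pose nu : R := L%:R^-1.
have nu0 : 0 < nu by rewrite invr_gt0.
have nu1 : nu <= 1 by rewrite invf_le1 // ler1n.
have [K_lo _] := nat_ceil K_def.
have [k0_lo k0_hi] := nat_ceil k0_def.
have [L_lo _] := nat_ceil LE.
have k0_ge : u k0 <= 1.
  by rewrite uE ler_pdivrMr ?exprn_gt0 // mul1r -log2_le_nat.
(* A ceiling exceeds its argument by less than 1, hence the factor 2. *)
have k0_le : 2 ^+ k0 <= 2 * B.
  rewrite leNgt; apply/negP => lt.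
  have : log2 B + 1 <= k0%:R.
    have log22 : log2 (2 : R) = 1 by rewrite /log2 divff // gt_eqF // ln_gt0 // ltr1n.
    rewrite -[X in _ + X <= _]log22 -log2M // log2_le_nat; last exact: mulr_gt0.
    by rewrite mulrC; exact: ltW.
  by rewrite leNgt k0_hi.
have Beps : (1 + hbar) / ((1 - gamma) * eps) = B * eps^-1.
  by rewrite /B invfM mulrA.
rewrite Beps in K_lo K_def.
(* Ceilings are subadditive, and [log2 (B / eps) = log2 B + log2 (1 / eps)]. *)
have K_le : (K <= k0 + L)%N.
  rewrite -lez_nat K_def ceil_le_int log2M ?invr_gt0 //.
  by rewrite PoszD intrD lerD.
have K0 : (0 < K)%N.
  rewrite -ltz_nat K_def ceil_gt0 log2_gt0 //.
  by rewrite -[ltLHS]mulr1 ltr_pM // ler01.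
have K0' : 0 < K%:R :> R by rewrite ltr0n.
have uK : u K <= eps.
  move: K_lo; rewrite log2_le_nat ?mulr_gt0 ?invr_gt0 // => K_lo.
  by rewrite uE ler_pdivrMr ?exprn_gt0 // mulrC -ler_pdivrMr.
have gk1 k : 0 < (1 - gamma) * kap k <= 1.
  by rewrite mulr_gt0 //= mulr_ile1 ?(ltW g1) ?(ltW (kap0 k)) // gerBl ltW.
have T_lo k : (k < K)%N -> 28 / ((1 - gamma) * kap k) <= (T k)%:R.
  by move=> /T_def /nat_ceil[].
have T_hi k : (k < K)%N -> (T k)%:R <= 29 / ((1 - gamma) * kap k).
  move=> /T_def /nat_ceil[_ up]; apply: (le_trans (ltW up)).
  have /andP[q0 q1] := gk1 k.
  have -> : 29 / ((1 - gamma) * kap k) = 28 / ((1 - gamma) * kap k) + ((1 - gamma) * kap k)^-1.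
    by rewrite -[X in _ = _ + X]mul1r -mulrDl natr1.
  by rewrite lerD2l invf_ge1.
have T_ge28 k : (k < K)%N -> 28 <= (T k)%:R :> R.
  move=> kK; apply: le_trans (T_lo k kK); have /andP[q0 q1] := gk1 k.
  by rewrite ler_pdivlMr // ler_piMr.
have T_gt1 k : (k < K)%N -> (1 < T k)%N.
  by move=> /T_ge28 T28; rewrite -(ltr1n R); apply: lt_le_trans T28; rewrite ltr1n.
have S1 : 1 <= #|S|%:R :> R by rewrite ler1n.
have A1 : 1 <= #|A|%:R :> R by rewrite ler1n.
have K1 : 1 <= K%:R :> R by rewrite ler1n.
have SA1 : 1 <= #|S|%:R * #|A|%:R :> R by rewrite mulr_ege1.
have dinv : 1 <= delta^-1 by rewrite invf_ge1 // ltW.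
pose x1 : R := 12 * K%:R * #|S|%:R * #|A|%:R * delta^-1.
have x1_gt1 : 1 < x1.
  have : 1 <= K%:R * (#|S|%:R * #|A|%:R) * delta^-1 :> R by rewrite !mulr_ege1.
  by rewrite /x1; lra.
pose x2 k : R := 4 * K%:R * ((T k)%:R - 1) * #|S|%:R * #|A|%:R * delta^-1.
have x2_gt1 k : (k < K)%N -> 1 < x2 k.
  move=> /T_ge28 T28; have T1 : 1 <= (T k)%:R - 1 :> R by lra.
  have : 1 <= K%:R * ((T k)%:R - 1) * (#|S|%:R * #|A|%:R) * delta^-1 :> R.
    by rewrite !mulr_ege1.
  by rewrite /x2; lra.
pose z := Num.sqrt (1 - gamma).
have z0 : 0 < z by rewrite sqrtr_gt0.
have z2 : z ^+ 2 = 1 - gamma by rewrite sqr_sqrtr // ltW.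
have sqrt2_ge (q : R) : 0 <= q -> q ^+ 2 <= 2 -> q <= Num.sqrt 2.
  by move=> q0 q2; rewrite -[leLHS]ger0_norm // -sqrtr_sqr ler_sqrt.
(* Chosen so that the tails are exactly [x1^-1] and [(x2 k)^-1], the shares of [delta] in the union
   bound. *)
pose alpha k := Num.sqrt (ln x1 / (m1 k)%:R).
pose beta k := Num.sqrt (ln (x2 k) / (m2 k)%:R).
have alphaP k : (k < K)%N -> [/\ 0 < (m1 k)%:R :> R, 0 < alpha k,
    alpha k <= z ^+ 3 * (kap k * nu / 353) / (1 + hbar) & (m1 k)%:R * alpha k ^+ 2 = ln x1].
  move=> kK; apply: sqrt_ratio_le; first exact: ln_gt0.
    by rewrite divr_gt0 // !mulr_gt0 ?exprn_gt0.
  apply: le_trans (m1_bound k kK); rewrite -/x1 -LE -/(u k) -/(kap k).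
  have -> : ln x1 / (z ^+ 3 * (kap k * nu / 353) / (1 + hbar)) ^+ 2 =
      (353 * (1 + hbar)) ^+ 2 * ln x1 * L%:R ^+ 2 / ((1 - gamma) ^+ 3 * kap k ^+ 2).
    rewrite -z2 /nu; field.
    by rewrite !gt_eqF.
  rewrite ler_pM2r ?invr_gt0 ?mulr_gt0 ?exprn_gt0 //.
  rewrite ler_pM2r ?exprn_gt0 // ler_pM2r ?ln_gt0 //.
  rewrite ler_pXn2r ?nnegrE ?mulr_ge0 ?sqrtr_ge0 ?(ltW H0) //.
  (* The rational 353 stands for [250 * Num.sqrt 2]; likewise 141 below for [100 * Num.sqrt 2]. *)
  rewrite ler_pM2r //; have := sqrt2_ge (353 / 250); lra.
have betaP k : (k < K)%N -> [/\ 0 < (m2 k)%:R :> R, 0 < beta k,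
    beta k <= (1 - gamma) * (nu / 141) & (m2 k)%:R * beta k ^+ 2 = ln (x2 k)].
  move=> kK; apply: sqrt_ratio_le; first exact/ln_gt0/x2_gt1.
    by rewrite !mulr_gt0.
  apply: le_trans (m2_bound k kK); rewrite -/(x2 k) -LE.
  have -> : ln (x2 k) / ((1 - gamma) * (nu / 141)) ^+ 2 =
      141 ^+ 2 * ln (x2 k) * L%:R ^+ 2 / (1 - gamma) ^+ 2.
    by rewrite /nu; field; rewrite !gt_eqF.
  rewrite ler_pM2r ?invr_gt0 ?exprn_gt0 //.
  rewrite ler_pM2r ?exprn_gt0 // ler_pM2r ?ln_gt0 ?x2_gt1 //.
  rewrite ler_pXn2r ?nnegrE ?mulr_ge0 ?sqrtr_ge0 //.
  have := sqrt2_ge (141 / 100); lra.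
pose G (y : sample_index S A -> S) :=
  let pihat := svmd_output c gamma hbar h omega grad_omega T m1 m2 eta y K in
  supnorm (fun s => value c gamma h Ptraj st act pihat s
                    - value c gamma h Ptraj st act pistar s) <= eps /\
  supnorm (bregman_policy omega grad_omega pihat pistar)
    <= 4 * (1 + hbar) * D0 / (1 - gamma) ^+ 2.
apply: (@good_events_prob R S A P c gamma hbar h omega grad_omega S_gt0 A_gt0 P_kernel
  c_bound gamma_bound h_bound hbar0 h_cont omega_C1 K T m1 m2 eta alpha beta delta
  _ _ _ _ _ _ _ _ _ d W Pr X X_samples G).
- exact: T_gt1.
- by move=> k /alphaP[]; rewrite ltr0n.
- by move=> k /betaP[]; rewrite ltr0n.
- by move=> k /alphaP[].
- by move=> k /betaP[].
- exact: K0.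
- exact: ltW.
- move=> k /alphaP[_ _ _ ->]; rewrite expRN_ln; last exact: lt_trans x1_gt1.
  by rewrite /x1 invfM invrK mulrC.
- move=> k kK; have [_ _ _ ->] := betaP k kK.
  rewrite expRN_ln; last by apply: lt_trans (x2_gt1 k kK).
  by rewrite /x2 invfM invrK mulrC.
- move=> y y' yy'; rewrite /G /svmd_output.
  rewrite (@eq_svmd_epochs _ _ _ c gamma hbar h omega grad_omega K T m1 m2 eta y y' K) //.
    by move=> k /T_gt1 /ltnW.
  by move=> j Uj _; exact: yy'.
move=> y good.
have [outp gap brg] := @svmd_accuracy R S A P c gamma hbar h S_gt0 A_gt0 P_kernel c_bound
  gamma_bound h_bound h_cont h_convex omega grad_omega N N_norm omega_C1 omega_sc pistar
  pistarp opt D0 nu K k0 L T m1 m2 eta alpha beta D0_bound nu0 nu1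
  (eq_ind_r (fun x => x <= 1) (lexx 1) (divff (lt0r_neq0 L0')))
  k0_ge k0_le K_le T_lo T_hi eta_def
  (fun k kK => let: And4 m0 _ _ _ := alphaP k kK in eq_ind _ is_true m0 _ (ltr0n R (m1 k)))
  (fun k kK => let: And4 _ a0 _ _ := alphaP k kK in ltW a0)
  (fun k kK => let: And4 _ _ al _ := alphaP k kK in
     eq_ind _ is_true al _ (ler_pdivlMr (alpha k) (z ^+ 3 * (kap k * nu / 353)) H0))
  (fun k kK => let: And4 _ b0 _ _ := betaP k kK in ltW b0)
  (fun k kK => let: And4 _ _ bl _ := betaP k kK in bl) y good.
rewrite /G /svmd_output /=; set out := (svmd_epochs _ _ _ _ _ _ _ _ _ _ _ _).1 in outp gap brg *.
split.
  apply: supnorm_le => [|s]; first exact: ltW.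
  rewrite !valueE // ger0_norm ?subr_ge0 ?opt //.
  exact: le_trans (gap s) uK.
apply: supnorm_le => [|s].
  have D00 : 0 <= D0 by apply: le_trans (D0_bound pistar pistarp); exact: supnorm_ge0.
  by rewrite divr_ge0 ?exprn_ge0 ?(ltW g1) // mulr_ge0 // mulr_ge0 // ltW.
rewrite /bregman_policy ger0_norm; first exact: brg.
apply: (bregman_ge0 omega_C1 omega_sc); first exact: outp.
exact: pistarp.
Qed.
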